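(* Let $\mathrm{R}$ be a real closed field, let $d \geq 2$, and let $\mathcal{P} \subset \mathrm{R}[X_1,\ldots,X_n]_{\leq d}$ and $\mathcal{Q} \subset \mathrm{R}[X_1,\ldots,X_n,Y]_{\leq d}$ be finite sets of polynomials. Let $A \subset \mathrm{R}^n$ be a closed and bounded $\mathcal{P}$-semi-algebraic set, and let $f,g: A \rightarrow \mathrm{R}$ be continuous $\mathcal{Q}$-semi-algebraic functions satisfying $f^{-1}(0) \subset g^{-1}(0)$. Then there exist $c \in \mathrm{R}$ (depending on $A,f,g$) and $N \leq (8 d)^{2(n+7)}$ such that for all $x \in A$, \[ |g(x)|^{N} \leq c \cdot |f(x)|. \] Moreover, in the special case where $\mathrm{R} = \mathbb{R}$, $\mathcal{P} \subset \mathbb{Z}[X_1,\ldots,X_n]_{\leq d}$, $\mathcal{Q} \subset \mathbb{Z}[X_1,\ldots,X_n,Y]_{\leq d}$, and the bit-sizes of the coefficients of the polynomials in $\mathcal{P}\cup\mathcal{Q}$ are bounded by $\tau$, there exists \[ c \leq \min\{2^{\tau d^{O(n^2)}},\,2^{\tau d^{O(n\log d)}}\} \] such that $|g(x)|^N \le c\cdot |f(x)|$ holds for all $x\in A$ with $N =(8 d)^{2(n+7)}$.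
   Context: $\mathrm{R}[X_1,\ldots,X_n]_{\leq d}$ denotes the set of polynomials of degree at most $d$. For a finite set of polynomials $\mathcal{P}$, a $\mathcal{P}$-formula is a quantifier-free first-order formula whose atoms are of the form $P=0$, $P>0$, $P<0$ with $P \in \mathcal{P}$; a $\mathcal{P}$-semi-algebraic set is the set of points satisfying some $\mathcal{P}$-formula. A $\mathcal{Q}$-semi-algebraic function $f:A\to\mathrm{R}$ (with $A\subset \mathrm{R}^n$) is one whose graph $\{(x,f(x))\}\subset\mathrm{R}^{n+1}$ is a $\mathcal{Q}$-semi-algebraic set. The notation $O(\cdot)$ in the exponents means bounded by an absolute constant times the indicated expression. *)

(* Defs.v *)
From HB Require Import structures.
From mathcomp Require Import all_boot all_order all_algebra.
From mathcomp Require Import mpoly.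
From mathcomp Require Import reals.
Set Implicit Arguments.
Unset Strict Implicit.
Unset Printing Implicit Defensive.
Import Order.TTheory GRing.Theory Num.Theory.
Local Open Scope ring_scope.

Inductive qf_formula (T : Type) : Type :=
  | FTrue
  | FEq0 of T
  | FGt0 of T
  | FLt0 of T
  | FNot of qf_formula T
  | FAnd of qf_formula T & qf_formula T
  | FOr of qf_formula T & qf_formula T.
Arguments FTrue {T}.

Fixpoint atoms_in (T : eqType) (P : seq T) (phi : qf_formula T) : Prop :=
  match phi with
  | FTrue => True
  | FEq0 p | FGt0 p | FLt0 p => p \in P
  | FNot psi => atoms_in P psi
  | FAnd a b | FOr a b => atoms_in P a /\ atoms_in P b
  end.

Fixpoint holds (R : realDomainType) (n : nat) (x : 'I_n -> R)
    (phi : qf_formula {mpoly R[n]}) : Prop :=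
  match phi with
  | FTrue => True
  | FEq0 p => p.@[x] = 0
  | FGt0 p => 0 < p.@[x]
  | FLt0 p => p.@[x] < 0
  | FNot psi => ~ holds x psi
  | FAnd a b => holds x a /\ holds x b
  | FOr a b => holds x a \/ holds x b
  end.

Definition semialg (R : realDomainType) (n : nat) (P : seq {mpoly R[n]})
    (A : ('I_n -> R) -> Prop) : Prop :=
  exists phi : qf_formula {mpoly R[n]},
    atoms_in P phi /\ forall x, A x <-> holds x phi.

(* the point (x, y) of R^(n+1); Y is the last variable *)
Definition ext_pt (R : Type) (n : nat) (x : 'I_n -> R) (y : R) : 'I_n.+1 -> R :=
  fun i => match unlift ord_max i with Some j => x j | None => y end.

Definition semialg_fun (R : realDomainType) (n : nat) (Q : seq {mpoly R[n.+1]})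
    (A : ('I_n -> R) -> Prop) (f : ('I_n -> R) -> R) : Prop :=
  exists phi : qf_formula {mpoly R[n.+1]},
    atoms_in Q phi /\
    forall x y, (A x /\ y = f x) <-> holds (ext_pt x y) phi.

(* Euclidean topology on R^n, via the (equivalent) sup-norm neighbourhoods. *)
Definition closed_set (R : realDomainType) (n : nat) (A : ('I_n -> R) -> Prop) :=
  forall x : 'I_n -> R,
    (forall e : R, 0 < e -> exists y, A y /\ forall i, `|y i - x i| < e) -> A x.

Definition bounded_set (R : realDomainType) (n : nat) (A : ('I_n -> R) -> Prop) :=
  exists M : R, forall x, A x -> forall i, `|x i| <= M.

Definition continuous_on (R : realDomainType) (n : nat)
    (A : ('I_n -> R) -> Prop) (f : ('I_n -> R) -> R) :=
  forall x, A x -> forall e : R, 0 < e ->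
    exists2 delta : R, 0 < delta &
      forall y, A y -> (forall i, `|y i - x i| < delta) -> `|f y - f x| < e.

(* all polynomials of P have total degree <= d (msize = 1 + degree) *)
Definition deg_le (R : ringType) (n d : nat) (P : seq {mpoly R[n]}) :=
  forall p, p \in P -> (msize p <= d.+1)%N.

Definition bitsize_le (n tau : nat) (P : seq {mpoly int[n]}) :=
  forall p, p \in P -> forall m, `|p@_m| < (2 ^ tau)%:Z.

Definition intpolys (R : ringType) (n : nat) (P : seq {mpoly int[n]}) :
  seq {mpoly R[n]} := map (map_mpoly (fun z : int => z%:~R)) P.

(* Main.v *)
(* Consider the points (x, u, v) with x in A, u = |f(x)|, v = |g(x)| >= s, for a
   level s > 0. They form a closed bounded set S described by signs of polynomials
   of degree at most d. Minimise u on S, choose a minimiser at which as many of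
   these polynomials as possible vanish, and let q be the sum of the squares of the
   vanishing ones. Put h = 1 + sum_i X_i^(2d+2) / (2d+2). For eta large there are
   local minima of u on {eta q <= h} whose u-coordinate tends to the minimum of u on
   S. At such a point eta q = h and X_i^(2d+1) = eta dq/dX_i. These equations allow
   every monomial to be reduced to exponents at most 2d, so that a determinant
   over K[s][u][eta] vanishes; it is nonzero because it is nonzero at eta = 0.
   Its leading coefficient chi(u, s) in eta vanishes at (min u, s), and the lowest
   coefficient of chi in u gives min u >= s^N / c for small s > 0, where N bounds
   the degree of chi in s. As the minimum is taken over v >= s, this also settles
   the points where |g| is not small, once |g| is bounded; the bound comes from the
   same argument applied to the minimum of -|g|. Over Z the l1-norm of chi controls
   c. Over a general real closed field, compactness is replaced by quantifier
   elimination: definable subsets of the line have suprema. *)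
Require Import Defs.
From HB Require Import structures.
From mathcomp Require Import all_boot all_order all_algebra.
From mathcomp Require Import perm mpoly.
From mathcomp Require Import reals boolp.
From mathcomp Require Import ordered_qelim.
From mathcomp Require qe_rcf polyrcf.
From mathcomp Require Import ring lra zify.
Set Implicit Arguments.
Unset Strict Implicit.
Unset Printing Implicit Defensive.
Import Order.TTheory GRing.Theory Num.Theory.
Local Open Scope ring_scope.

(** * Definable sets *)

(** Two obstacles shape the construction. The critical points of u on the zero set of q may be
    infinite in number, and an ordinary resultant could then vanish identically. The deformation eta
    q <= h avoids this: h has degree 2d + 2 > deg q, so its partial derivatives are the pure powers
    X_i^(2d+1), each of which can be traded, whatever q is, for terms of degree below 2d + 1. The
    original problem sits at eta = infinity, which is why the leading coefficient in eta is the one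
    that matters.

    The second obstacle is that the minimiser, hence the set of polynomials active there, depends on
    the level s. There are finitely many such sets, so one determinant per set is fixed beforehand
    and all constants are uniform in s. Only v - s involves s, and it enters q squared: this factor
    2 is the only contribution of s to N beyond the size of the elimination. Any N above the degree
    bound is admissible, so (8d)^(2(n+7)) itself serves in both halves.

    The coefficient ring K is kept apart from R: K = R gives the first half, K = [int] the
    second. *)

Section Definable.
Variable R : rcfType.

(** Quantifying over every placement [a] of the variables, injective or not, makes substitution of
    variables ([def_sub]) immediate: formulas are never renamed. *)
Definition definable (I : finType) (S : (I -> R) -> Prop) : Prop :=
  forall a : I -> nat, exists phi : ord.formula R,
    forall e : seq R, ord.holds e phi <-> S (fun i => e`_(a i)).

Inductive polyfun (I : Type) : ((I -> R) -> R) -> Prop :=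
  | pf_const c : polyfun (fun=> c)
  | pf_var i : polyfun (fun x => x i)
  | pf_add p q : polyfun p -> polyfun q -> polyfun (fun x => p x + q x)
  | pf_mul p q : polyfun p -> polyfun q -> polyfun (fun x => p x * q x).

Lemma pf_opp (I : Type) (p : (I -> R) -> R) :
  polyfun p -> polyfun (fun x => - p x).
Proof.
move=> pp; have -> : (fun x => - p x) = (fun x => -1 * p x).
  by apply/funext=> x; rewrite mulN1r.
by apply: pf_mul => //; apply: pf_const.
Qed.

Lemma pf_sub (I : Type) (p q : (I -> R) -> R) :
  polyfun p -> polyfun q -> polyfun (fun x => p x - q x).
Proof. by move=> pp pq; apply: pf_add => //; apply: pf_opp. Qed.

Lemma pf_exp (I : Type) (p : (I -> R) -> R) k :
  polyfun p -> polyfun (fun x => p x ^+ k).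
Proof.
move=> pp; elim: k => [|k IHk]; first exact: pf_const.
have -> : (fun x => p x ^+ k.+1) = (fun x => p x * p x ^+ k).
  by apply/funext=> x; rewrite exprS.
exact: pf_mul.
Qed.

Lemma pf_sum (I T : Type) (r : seq T) (P : pred T) (p : T -> (I -> R) -> R) :
  (forall t, polyfun (p t)) -> polyfun (fun x => \sum_(t <- r | P t) p t x).
Proof.
move=> pp; elim: r => [|t r IHr].
  have -> : (fun x => \sum_(t <- [::] | P t) p t x) = fun=> 0.
    by apply/funext=> x; rewrite big_nil.
  exact: pf_const.
have -> : (fun x => \sum_(t <- t :: r | P t) p t x) =
    (fun x => (P t)%:R * p t x + \sum_(t <- r | P t) p t x).
  apply/funext=> x; rewrite big_cons; case: (P t) => //=.
    by rewrite mul1r.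
  by rewrite mul0r add0r.
by apply: pf_add => //; apply: pf_mul => //; apply: pf_const.
Qed.

Lemma pf_prod (I T : Type) (r : seq T) (p : T -> (I -> R) -> R) :
  (forall t, polyfun (p t)) -> polyfun (fun x => \prod_(t <- r) p t x).
Proof.
move=> pp; elim: r => [|t r IHr].
  have -> : (fun x => \prod_(t <- [::]) p t x) = fun=> 1.
    by apply/funext=> x; rewrite big_nil.
  exact: pf_const.
have -> : (fun x => \prod_(t <- t :: r) p t x) =
    (fun x => p t x * \prod_(t <- r) p t x).
  by apply/funext=> x; rewrite big_cons.
exact: pf_mul.
Qed.

Lemma pf_sub_var (I J : Type) (s : J -> I) (p : (J -> R) -> R) :
  polyfun p -> polyfun (fun x : I -> R => p (fun j => x (s j))).
Proof.
elim=> [c|i|p1 q1 _ IHp _ IHq|p1 q1 _ IHp _ IHq].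
- exact: pf_const.
- exact: pf_var.
- exact: pf_add.
- exact: pf_mul.
Qed.

Lemma polyfun_term (I : Type) (p : (I -> R) -> R) (a : I -> nat) :
  polyfun p -> exists t : GRing.term R,
    forall e, GRing.eval e t = p (fun i => e`_(a i)).
Proof.
elim=> [c|i|p1 q1 _ [t Ht] _ [u Hu]|p1 q1 _ [t Ht] _ [u Hu]].
- by exists (GRing.Const c).
- by exists (GRing.Var R (a i)).
- by exists (GRing.Add t u) => e /=; rewrite Ht Hu.
- by exists (GRing.Mul t u) => e /=; rewrite Ht Hu.
Qed.

Lemma def_eq (I : finType) (p q : (I -> R) -> R) :
  polyfun p -> polyfun q -> definable (fun x => p x = q x).
Proof.
move=> pp pq a; have [t Ht] := polyfun_term a pp.
have [u Hu] := polyfun_term a pq.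
by exists (ord.Equal t u) => e /=; rewrite Ht Hu.
Qed.

Lemma def_lt (I : finType) (p q : (I -> R) -> R) :
  polyfun p -> polyfun q -> definable (fun x => p x < q x).
Proof.
move=> pp pq a; have [t Ht] := polyfun_term a pp.
have [u Hu] := polyfun_term a pq.
by exists (ord.Lt t u) => e /=; rewrite Ht Hu.
Qed.

Lemma def_le (I : finType) (p q : (I -> R) -> R) :
  polyfun p -> polyfun q -> definable (fun x => p x <= q x).
Proof.
move=> pp pq a; have [t Ht] := polyfun_term a pp.
have [u Hu] := polyfun_term a pq.
by exists (ord.Le t u) => e /=; rewrite Ht Hu.
Qed.

Lemma def_iff (I : finType) (S T : (I -> R) -> Prop) :
  (forall x, S x <-> T x) -> definable S -> definable T.
Proof.
move=> ST dS a; have [phi Hphi] := dS a.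
by exists phi => e; rewrite Hphi ST.
Qed.

Lemma def_and (I : finType) (S T : (I -> R) -> Prop) :
  definable S -> definable T -> definable (fun x => S x /\ T x).
Proof.
move=> dS dT a; have [phi Hphi] := dS a; have [psi Hpsi] := dT a.
by exists (ord.And phi psi) => e /=; rewrite Hphi Hpsi.
Qed.

Lemma def_or (I : finType) (S T : (I -> R) -> Prop) :
  definable S -> definable T -> definable (fun x => S x \/ T x).
Proof.
move=> dS dT a; have [phi Hphi] := dS a; have [psi Hpsi] := dT a.
by exists (ord.Or phi psi) => e /=; rewrite Hphi Hpsi.
Qed.

Lemma def_imp (I : finType) (S T : (I -> R) -> Prop) :
  definable S -> definable T -> definable (fun x => S x -> T x).
Proof.
move=> dS dT a; have [phi Hphi] := dS a; have [psi Hpsi] := dT a.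
by exists (ord.Implies phi psi) => e /=; rewrite Hphi Hpsi.
Qed.

Lemma def_not (I : finType) (S : (I -> R) -> Prop) :
  definable S -> definable (fun x => ~ S x).
Proof.
move=> dS a; have [phi Hphi] := dS a.
by exists (ord.Not phi) => e /=; rewrite Hphi.
Qed.

Lemma def_cst (I : finType) (P : Prop) : definable (fun _ : I -> R => P).
Proof.
move=> a; have [HP|HP] := pselect P.
  by exists (ord.Bool true) => e; split.
by exists (ord.Bool false) => e; split.
Qed.

Lemma def_sub (I J : finType) (s : J -> I) (S : (J -> R) -> Prop) :
  definable S -> definable (fun x : I -> R => S (fun j => x (s j))).
Proof. by move=> dS a; apply: (dS (fun j => a (s j))). Qed.

Lemma holds_foldr_exists (s : seq nat) (phi : ord.formula R) (e : seq R) :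
  ord.holds e (foldr (@ord.Exists R) phi s) <->
  exists2 e' : seq R, (forall k, k \notin s -> e'`_k = e`_k)
                      & ord.holds e' phi.
Proof.
elim: s e => [|i s IHs] e /=.
  split=> [He|[e' He' H]]; first by exists e.
  by apply: ord.eq_holds H => k; rewrite He'.
split=> [[x /IHs[e' He' H]]|[e' He' H]].
  exists e' => // k; rewrite inE negb_or => /andP[ki ks].
  by rewrite He' // nth_set_nth /= (negbTE ki).
exists e'`_i; apply/IHs; exists e' => // k ks; rewrite nth_set_nth /=.
have [->//|ki] := eqVneq k i.
by apply: He'; rewrite inE negb_or ki.
Qed.

Lemma def_ex (I J : finType) (P : (I -> R) -> (J -> R) -> Prop) :
  definable (fun z : (I + J)%type -> R =>
               P (fun i => z (inl i)) (fun j => z (inr j))) ->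
  definable (fun x => exists y, P x y).
Proof.
(* [N] exceeds every [a i], so the variables [N + enum_rank j] to be bound are fresh. *)
move=> dP a; pose N := (\sum_(i : I) a i).+1.
pose a' (s : (I + J)%type) :=
  match s with inl i => a i | inr j => (N + enum_rank j)%N end.
have aN i : (a i < N)%N by rewrite ltnS /N (bigD1 i) //= leq_addr.
have [phi Hphi] := dP a'.
exists (foldr (@ord.Exists R) phi (iota N #|J|)) => e.
rewrite holds_foldr_exists; split=> [[e' He' /Hphi /= H]|[y Py]].
  exists (fun j => e'`_(N + enum_rank j)); suff -> : (fun i => e`_(a i)) =
    (fun i => e'`_(a i)) by [].
  apply/funext=> i; rewrite He' // mem_iota negb_and -ltnNge aN //.
pose e' := mkseq (fun k => if (k < N)%N then e`_k else
  nth 0 [seq y j | j <- enum J] (k - N)) (N + #|J| + size e).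
have e'E k : e'`_k = if (k < N)%N then e`_k else
    nth 0 [seq y j | j <- enum J] (k - N).
  have [kl|kl] := ltnP k (N + #|J| + size e); first by rewrite nth_mkseq.
  rewrite nth_default ?size_mkseq //.
  case: ifP => kN.
    by rewrite nth_default //; apply: leq_trans kl; apply: leq_addl.
  have cJ : size (enum J) = #|J| by rewrite cardE.
  rewrite nth_default // size_map cJ.
  by move: kl kN; set m := #|J|; lia.
exists (mkseq (fun k => if (k < N + #|J|)%N then e'`_k else e`_k)
     (N + #|J| + size e)).
  move=> k; rewrite mem_iota negb_and -ltnNge -leqNgt => kN.
  have [kl|kl] := ltnP k (N + #|J| + size e); last first.
    rewrite !nth_default ?size_mkseq //.
    by apply: leq_trans kl; apply: leq_addl.
  rewrite nth_mkseq //; case: ltnP => // kNJ.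
  by rewrite e'E; move: kN; case: ltnP => //= kN /(leq_trans kNJ); lia.
apply/Hphi; rewrite /a'.
have EI : (fun i : I => (mkseq (fun k => if (k < N + #|J|)%N then e'`_k else e`_k)
     (N + #|J| + size e))`_(a i)) = (fun i => e`_(a i)).
  apply/funext=> i; have := aN i => ai.
  rewrite nth_mkseq; last by rewrite -addnA (leq_trans ai) ?leq_addr.
  by rewrite e'E ai if_same.
have EJ : (fun j : J => (mkseq (fun k => if (k < N + #|J|)%N then e'`_k else e`_k)
     (N + #|J| + size e))`_(N + enum_rank j)) = y.
  apply/funext=> j; have rj := ltn_ord (enum_rank j).
  rewrite nth_mkseq; last by rewrite -addnA ltn_add2l (leq_trans rj) ?leq_addr.
  rewrite ltn_add2l rj e'E ltnNge leq_addr /= addKn.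
  by rewrite (nth_map j) -?cardE // nth_enum_rank.
by rewrite EI EJ.
Qed.

Lemma def_exr (I : finType) (P : (I -> R) -> R -> Prop) :
  definable (fun z : (I + unit)%type -> R =>
               P (fun i => z (inl i)) (z (inr tt))) ->
  definable (fun x => exists y, P x y).
Proof.
move=> dP; have := def_ex (P := fun x (y : unit -> R) => P x (y tt)) dP.
apply: def_iff => x; split=> [[y Py]|[y Py]]; first by exists (y tt).
by exists (fun=> y).
Qed.

Lemma def_all (I J : finType) (P : (I -> R) -> (J -> R) -> Prop) :
  definable (fun z : (I + J)%type -> R =>
               P (fun i => z (inl i)) (fun j => z (inr j))) ->
  definable (fun x => forall y, P x y).
Proof.
move=> dP; have := def_not (def_ex (P := fun x y => ~ P x y) (def_not dP)).
apply: def_iff => x; split=> [H y|H [y Py]]; last by [].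
by apply: contrapT => nP; apply: H; exists y.
Qed.

Lemma def_exfin (I T : finType) (S : T -> (I -> R) -> Prop) :
  (forall t, definable (S t)) -> definable (fun x => exists t, S t x).
Proof.
move=> dS a.
have H t := dS t a.
have [phi Hphi] := choice H.
exists (foldr (@ord.Or R) (ord.Bool false) [seq phi t | t <- enum T]) => e.
have -> : (exists t, S t (fun i => e`_(a i))) <->
    (exists2 t, t \in enum T & S t (fun i => e`_(a i))).
  by split=> [[t St]|[t _ St]]; [exists t; rewrite ?mem_enum | exists t].
elim: (enum T) => [|t s IHs] /=; first by split=> // -[].
rewrite Hphi IHs; split=> [[St|[t' ts St]]|[t' + St]].
- by exists t; rewrite ?mem_head.
- by exists t'; rewrite // inE ts orbT.
- by rewrite inE => /orP[/eqP <-|ts]; [left | right; exists t'].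
Qed.

Lemma def_allfin (I T : finType) (S : T -> (I -> R) -> Prop) :
  (forall t, definable (S t)) -> definable (fun x => forall t, S t x).
Proof.
move=> dS.
have := def_not (def_exfin (S := fun t x => ~ S t x) (fun t => def_not (dS t))).
apply: def_iff => x; split=> [H t|H [t St]]; last by [].
by apply: contrapT => nS; apply: H; exists t.
Qed.

End Definable.

(** * Definable compactness *)

Section Compactness.
Variable R : rcfType.

Lemma term_poly (t : GRing.term R) : GRing.rterm t ->
  exists p : {poly R}, forall x, GRing.eval [:: x] t = p.[x].
Proof.
elim: t => //=.
- case=> [|i] _; first by exists 'X => x; rewrite hornerX.
  (* Variables other than the first read the default value 0 off the environment [[:: x]]. *)
  by exists 0 => x; rewrite horner0 /= nth_nil.
- by move=> c _; exists c%:P => x; rewrite hornerC.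
- by move=> k _; exists k%:R => x; rewrite -polyC_natr hornerC.
- move=> t IHt u IHu /andP[/IHt[p Hp] /IHu[q Hq]].
  by exists (p + q) => x; rewrite hornerD Hp Hq.
- by move=> t IHt /IHt[p Hp]; exists (- p) => x; rewrite hornerN Hp.
- by move=> t IHt k /IHt[p Hp]; exists (p *+ k) => x; rewrite hornerMn Hp.
- move=> t IHt u IHu /andP[/IHt[p Hp] /IHu[q Hq]].
  by exists (p * q) => x; rewrite hornerM Hp Hq.
- by move=> t IHt k /IHt[p Hp]; exists (p ^+ k) => x; rewrite horner_exp Hp.
Qed.

(** [p] is a product of the differences of the two sides of the atoms, an identically zero
    difference being replaced by 1: on an interval without roots of [p] every atom keeps its truth
    value. *)
Lemma qf_eval_const (f : ord.formula R) : ord.qf_form f -> ord.rformula f ->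
  exists2 p : {poly R}, p != 0 &
    forall x y, x <= y -> (forall z, x <= z <= y -> p.[z] != 0) ->
      ord.qf_eval [:: x] f = ord.qf_eval [:: y] f.
Proof.
have sg_const (d : {poly R}) : exists2 p : {poly R}, p != 0 &
    forall x y, x <= y -> (forall z, x <= z <= y -> p.[z] != 0) ->
      Num.sg d.[x] = Num.sg d.[y].
  have [->|d0] := eqVneq d 0.
    by exists 1; rewrite ?oner_neq0 // => x y _ _; rewrite !horner0.
  exists d => // x y xy Hd.
  have := @polyrcf.polyrN0_itv R `[x, y] d.
  move=> /(_ _ y x); apply.
  - by move=> z; rewrite in_itv /= => /Hd; rewrite rootE.
  - by rewrite in_itv /= xy lexx.
  - by rewrite in_itv /= xy lexx.
have combine (f1 f2 : ord.formula R) (op : bool -> bool -> bool) :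
  (exists2 p : {poly R}, p != 0 &
    forall x y, x <= y -> (forall z, x <= z <= y -> p.[z] != 0) ->
      ord.qf_eval [:: x] f1 = ord.qf_eval [:: y] f1) ->
  (exists2 p : {poly R}, p != 0 &
    forall x y, x <= y -> (forall z, x <= z <= y -> p.[z] != 0) ->
      ord.qf_eval [:: x] f2 = ord.qf_eval [:: y] f2) ->
  exists2 p : {poly R}, p != 0 &
    forall x y, x <= y -> (forall z, x <= z <= y -> p.[z] != 0) ->
      op (ord.qf_eval [:: x] f1) (ord.qf_eval [:: x] f2) =
      op (ord.qf_eval [:: y] f1) (ord.qf_eval [:: y] f2).
  move=> [p p0 Hp] [q q0 Hq]; exists (p * q); first by rewrite mulf_neq0.
  move=> x y xy H; rewrite (Hp x y) ?(Hq x y) // => z /H;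
    by rewrite hornerM mulf_eq0 negb_or => /andP[].
elim: f => //=.
- by move=> b _ _; exists 1; rewrite ?oner_neq0.
- move=> t u _ /andP[/term_poly[p Hp] /term_poly[q Hq]].
  have [r r0 Hr] := sg_const (q - p); exists r => // x y xy /(Hr x y xy) H.
  have dE w : (p.[w] == q.[w]) = (Num.sg (q - p).[w] == 0).
    by rewrite sgr_eq0 hornerD hornerN subr_eq0 eq_sym.
  by rewrite !Hp !Hq !dE H.
- move=> t u _ /andP[/term_poly[p Hp] /term_poly[q Hq]].
  have [r r0 Hr] := sg_const (q - p); exists r => // x y xy /(Hr x y xy) H.
  have dE w : (p.[w] < q.[w]) = (0 < Num.sg (q - p).[w]).
    by rewrite sgr_gt0 hornerD hornerN subr_gt0.
  by rewrite !Hp !Hq !dE H.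
- move=> t u _ /andP[/term_poly[p Hp] /term_poly[q Hq]].
  have [r r0 Hr] := sg_const (q - p); exists r => // x y xy /(Hr x y xy) H.
  have dE w : (p.[w] <= q.[w]) = (0 <= Num.sg (q - p).[w]).
    by rewrite sgr_ge0 hornerD hornerN subr_ge0.
  by rewrite !Hp !Hq !dE H.
- move=> f1 IH1 f2 IH2 /andP[q1 q2] /andP[r1 r2].
  exact: (combine _ _ andb (IH1 q1 r1) (IH2 q2 r2)).
- move=> f1 IH1 f2 IH2 /andP[q1 q2] /andP[r1 r2].
  exact: (combine _ _ orb (IH1 q1 r1) (IH2 q2 r2)).
- move=> f1 IH1 f2 IH2 /andP[q1 q2] /andP[r1 r2].
  exact: (combine _ _ implb (IH1 q1 r1) (IH2 q2 r2)).
- move=> f1 IH1 q1 r1; exact: (combine _ _ (fun b _ => ~~ b) (IH1 q1 r1) (IH1 q1 r1)).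
Qed.

(** Quantifier elimination enters here only, turning the formula into a quantifier-free one in a
    single variable. The conclusion says that the set is a finite union of points and intervals. *)
Lemma definable_const (S : R -> Prop) :
  definable (fun x : unit -> R => S (x tt)) ->
  exists2 p : {poly R}, p != 0 &
    forall x y, x <= y -> (forall z, x <= z <= y -> p.[z] != 0) ->
      (S x <-> S y).
Proof.
move=> /(_ (fun=> 0%N)) [phi Hphi].
pose wp n s := qe_rcf.qfr_to_formula (@qe_rcf.wproj R n s).
pose psi := ord.quantifier_elim wp (ord.to_rform phi).
have rphi := ord.to_rform_rformula phi.
have /andP[qpsi rpsi] : ord.qf_form psi && ord.rformula psi.
  exact: (@ord.quantifier_elim_wf R wp (@qe_rcf.wf_QE_wproj R) _ rphi).
have HS x : S x <-> ord.qf_eval [:: x] psi.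
  rewrite -(Hphi [:: x]) -ord.to_rformP; apply: rwP.
  exact: (@ord.quantifier_elim_rformP R wp (@qe_rcf.wf_QE_wproj R)
    (@qe_rcf.valid_QE_wproj R) _ _ rphi).
have [p p0 Hp] := qf_eval_const qpsi rpsi; exists p => // x y xy /(Hp x y xy) H.
by rewrite !HS H.
Qed.

Lemma seq_has_min (s : seq R) (x0 : R) : x0 \in s ->
  exists2 m, m \in s & forall y, y \in s -> m <= y.
Proof.
elim: s x0 => // a s IHs x0 _; case: s IHs => [|b s] IHs.
  by exists a; rewrite ?mem_head // => y; rewrite inE => /eqP ->.
have [m ms Hm] := IHs b (mem_head _ _).
have [am|ma] := leP a m.
  exists a; rewrite ?mem_head // => y; rewrite inE => /orP[/eqP ->//|/Hm].
  exact: le_trans.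
exists m; first by rewrite inE ms orbT.
by move=> y; rewrite inE => /orP[/eqP ->|/Hm//]; apply: ltW.
Qed.

(** The supremum is the least root of [p] that is an upper bound. Such a root exists, since
    otherwise some element of [S] would lie beyond all roots and [S] would contain a whole
    half-line. *)
Lemma definable_sup (S : R -> Prop) :
  definable (fun x : unit -> R => S (x tt)) ->
  (exists x, S x) -> (exists b, forall x, S x -> x <= b) ->
  exists2 m, (forall x, S x -> x <= m)
           & forall t, t < m -> exists2 x, S x & t < x.
Proof.
move=> /definable_const[p p0 Hp] [x0 Sx0] [b Hb].
pose UB r := forall x, S x -> x <= r.
have roots r : (r \in polyrcf.rootsR p) = (p.[r] == 0).
  by rewrite -(polyrcf.roots_on_rootsR p0) in_itv /= rootE.
have nUB r : ~ UB r -> exists2 x, S x & r < x.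
  move=> nU; apply: contrapT => H; apply: nU => x Sx; rewrite leNgt.
  by apply/negP=> rx; apply: H; exists x.
pose L := [seq r <- polyrcf.rootsR p | `[< UB r >]].
(* One element of [S] beats all these roots at once: it is enough to exceed the largest, obtained as
   the minimum of the opposites. *)
have maxN (P : pred R) : (forall r, P r -> p.[r] = 0 -> ~ UB r) ->
    exists2 x, S x & forall r, P r -> p.[r] = 0 -> r < x.
  move=> HP; pose L2 := [seq - r | r <- polyrcf.rootsR p & P r].
  have [E|/negP nE] := pselect (L2 == [::] = true).
    exists x0 => // r Pr r0; have : - r \in L2.
      by apply: map_f; rewrite mem_filter Pr roots r0 eqxx.
    by rewrite (eqP E).
  have [y yL] : exists y, y \in L2.
    by case: L2 nE => // y s _; exists y; rewrite mem_head.
  have [m /mapP[r + ->] Hm] := seq_has_min yL.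
  rewrite mem_filter roots => /andP[Pr /eqP r0].
  have [x Sx rx] := nUB r (HP r Pr r0); exists x => // r' Pr' r'0.
  apply: le_lt_trans rx; rewrite -lerN2; apply: Hm.
  by apply: map_f; rewrite mem_filter Pr' roots r'0 eqxx.
have [E|/negP nE] := pselect (L == [::] = true).
  exfalso.
  have [|x Sx Hx] := maxN xpredT.
    move=> r _ r0 Ur; have : r \in L.
      by rewrite mem_filter roots r0 eqxx andbT; apply/asboolP.
    by rewrite (eqP E).
  have xb := Hb x Sx.
  have : S (b + 1).
    apply/(Hp x); [by lra| |by []] => z /andP[xz _].
    apply/eqP => z0; have := Hx z isT z0; by rewrite ltNge xz.
  by move/Hb; lra.
have [y yL] : exists y, y \in L.
  by case: (L) nE => // y s _; exists y; rewrite mem_head.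
have [m + Hm] := seq_has_min yL.
rewrite mem_filter roots => /andP[/asboolP Um /eqP m0].
exists m => // t tm.
have [|x Sx Hx] := maxN (fun r => r < m).
  move=> r rm r0 Ur; have : m <= r; last by rewrite leNgt rm.
  by apply: Hm; rewrite mem_filter roots r0 eqxx andbT; apply/asboolP.
have [xm|mx] := ltP x m; last by exists x => //; apply: lt_le_trans mx.
pose z := Num.max x ((t + m) / 2).
have zm : z < m by rewrite gt_max xm /=; lra.
exists z; last by rewrite lt_max; apply/orP; right; lra.
apply/(Hp x); [by rewrite le_max lexx| |by []] => w /andP[xw wz].
apply/eqP => w0; have := Hx w (le_lt_trans wz zm) w0.
by rewrite ltNge xw.
Qed.

(* Plays the role of sequential compactness, over an arbitrary real closed field. *)
Lemma definable_cluster (J : finType) (B : R -> (J -> R) -> Prop) (M : R) :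
  definable (fun z : (J + unit)%type -> R =>
               B (z (inr tt)) (fun j => z (inl j))) ->
  (forall e e' y, 0 < e -> e <= e' -> B e y -> B e' y) ->
  (forall e, 0 < e -> exists y, B e y) ->
  (forall y, B 1 y -> forall j, `|y j| <= M) ->
  exists z : J -> R, forall e, 0 < e ->
    exists2 y, B e y & forall j, `|y j - z j| < e.
Proof.
move=> dB mB nB bB.
suff [z Hz] : exists z : J -> R, forall e, 0 < e ->
    exists2 y, B e y & forall j, j \in enum J -> `|y j - z j| < e.
  exists z => e /Hz[y By Hy]; exists y => // j.
  by apply: Hy; rewrite mem_enum.
elim: (enum J) => [|i s [z Hz]].
  by exists (fun=> 0) => e /nB[y By]; exists y.
pose B' e (y : J -> R) := B e y /\ forall j, j \in s -> `|y j - z j| < e.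
have mB' e e' y : 0 < e -> e <= e' -> B' e y -> B' e' y.
  move=> e0 ee' [/(mB _ _ _ e0 ee') By Hy]; split=> // j /Hy H.
  exact: lt_le_trans ee'.
(* Coordinates are treated one at a time. The supremum of [S] is the lower limit of [y i] over
   [B' e] as [e] tends to 0. *)
pose S a := exists e, 0 < e /\ forall y, B' e y -> a <= y i.
have dS : definable (fun x : unit -> R => S (x tt)).
  apply: def_exr; apply: def_and.
    by apply: def_lt; [apply: pf_const | apply: pf_var].
  apply: def_all; apply: def_imp; last first.
    by apply: def_le; apply: pf_var.
  apply: def_and.
    pose si (u : (J + unit)%type) : (unit + unit + J)%type :=
      match u with inl j => inr j | inr _ => inl (inr tt) end.
    exact: (def_sub si dB).
  have : definable (fun zz : unit + unit + J -> R => forall j : J,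
      j \in s -> `|zz (inr j) - z j| < zz (inl (inr tt))).
    apply: def_allfin => j; apply: def_imp; first exact: def_cst.
    apply: (def_iff (S := fun zz => - zz (inl (inr tt)) < zz (inr j) - z j /\
       zz (inr j) - z j < zz (inl (inr tt)))).
      by move=> zz; rewrite ltr_norml; split=> [[-> ->]|/andP].
    apply: def_and; apply: def_lt.
    - by apply: pf_opp; apply: pf_var.
    - by apply: pf_sub; [apply: pf_var | apply: pf_const].
    - by apply: pf_sub; [apply: pf_var | apply: pf_const].
    - exact: pf_var.
  by [].
have nB' e : 0 < e -> exists y, B' e y.
  by move=> /Hz[y By Hy]; exists y.
have [|| m Um Lm] := definable_sup dS.
- exists (- M), 1; split=> // y [/bB/(_ i) + _].
  by rewrite ler_norml => /andP[].
- exists M => a [e [e0 He]].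
  have e1 : 0 < Num.min e 1 by rewrite lt_min e0 ltr01.
  have [y By] := nB' _ e1.
  have /He : B' e y by apply: mB' By; rewrite // ge_min lexx.
  have : B' 1 y by apply: mB' By; rewrite // ge_min lexx orbT.
  by move=> [/bB/(_ i) + _]; rewrite ler_norml => /andP[_ H] /le_trans; apply.
exists (fun j => if j == i then m else z j) => e e0.
have [a [d [d0 Hd]] am] : exists2 a, S a & m - e < a by apply: Lm; lra.
pose d' := Num.min d e.
have d'0 : 0 < d' by rewrite lt_min d0 e0.
have [y By ye] : exists2 y, B' d' y & y i < m + e.
  apply: contrapT => H; have : m + e <= m; last by lra.
  apply: Um; exists d'; split=> // y By; rewrite leNgt; apply/negP=> yi.
  by apply: H; exists y.
have [Bey Hy] : B' e y by apply: mB' By; rewrite // ge_min lexx orbT.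
exists y => // j; rewrite inE; have [-> _|ji /= /Hy//] := eqVneq j i.
have /Hd yi : B' d y by apply: mB' By; rewrite // ge_min lexx.
by rewrite ltr_norml; apply/andP; split; lra.
Qed.

Lemma min_lel (a b : R) : Num.min a b <= a.
Proof. by rewrite ge_min lexx. Qed.

Lemma min_ler (a b : R) : Num.min a b <= b.
Proof. by rewrite ge_min lexx orbT. Qed.

Definition near_pt (J : Type) (d : R) (y z : J -> R) :=
  forall j, `|y j - z j| < d.

Lemma near_ptW (J : Type) (d d' : R) (y z : J -> R) :
  d <= d' -> near_pt d y z -> near_pt d' y z.
Proof. by move=> dd H j; apply: lt_le_trans dd. Qed.

Definition closedS (J : Type) (S : (J -> R) -> Prop) :=
  forall z, (forall e, 0 < e -> exists2 y, S y & near_pt e y z) -> S z.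

Lemma polyfun_cont (J : Type) (p : (J -> R) -> R) : polyfun p ->
  forall z e, 0 < e -> exists2 d, 0 < d &
    forall y, near_pt d y z -> `|p y - p z| < e.
Proof.
elim=> [c|i|p1 q1 _ IHp _ IHq|p1 q1 _ IHp _ IHq] z e e0.
- by exists 1; rewrite ?ltr01 // => y _; rewrite subrr normr0.
- by exists e => // y /(_ i).
- have e2 : 0 < e / 2 by lra.
  have [d d0 Hd] := IHp z _ e2; have [d' d'0 Hd'] := IHq z _ e2.
  exists (Num.min d d'); first by rewrite lt_min d0 d'0.
  move=> y Hy; have := Hd y (near_ptW (min_lel _ _) Hy).
  have := Hd' y (near_ptW (min_ler _ _) Hy).
  rewrite !ltr_norml => /andP[? ?] /andP[? ?]; apply/andP; split; lra.
- set a := p1 z; set b := q1 z.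
  pose k := `|a| + `|b| + 1 + e.
  have k0 : 0 < k by rewrite /k; have := normr_ge0 a; have := normr_ge0 b; lra.
  have e1 : 0 < Num.min 1 (e / (2 * k)).
    by rewrite lt_min ltr01 divr_gt0 // mulr_gt0.
  have [d d0 Hd] := IHp z _ e1; have [d' d'0 Hd'] := IHq z _ e1.
  exists (Num.min d d'); first by rewrite lt_min d0 d'0.
  move=> y Hy; have := Hd y (near_ptW (min_lel _ _) Hy).
  have := Hd' y (near_ptW (min_ler _ _) Hy).
  rewrite -/a -/b; set x := p1 y; set w := q1 y.
  rewrite !lt_min => /andP[w1 w2] /andP[x1 x2].
  have -> : x * w - a * b = (x - a) * (w - b) + (x - a) * b + a * (w - b).
    by ring.
  have ek : e / (2 * k) * (2 * k) = e by rewrite divfK // gt_eqF // mulr_gt0.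
  set t := e / (2 * k) in w2 x2 ek.
  apply: le_lt_trans (_ : `|x - a| * `|w - b| + `|x - a| * `|b| +
      `|a| * `|w - b| < e).
    rewrite -!normrM; apply: le_trans (ler_normD _ _) _.
    by rewrite lerD2r ler_normD.
  have := normr_ge0 (x - a); have := normr_ge0 (w - b).
  have := normr_ge0 a; have := normr_ge0 b.
  move: x1 x2 w1 w2 ek; rewrite /k.
  move: (`|x - a|) (`|w - b|) (`|a|) (`|b|) => X W A B x1 x2 w1 w2 ek B0 A0 W0 X0.
  have h1 : X * W <= t by nra.
  have h2 : X * B <= t * B by nra.
  have h3 : A * W <= A * t by nra.
  by nra.
Qed.

Lemma closed_le (J : Type) (p q : (J -> R) -> R) :
  polyfun p -> polyfun q -> closedS (fun z => p z <= q z).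
Proof.
move=> pp pq z Hz; rewrite leNgt; apply/negP => qp.
have e0 : 0 < p z - q z by lra.
have [d d0 Hd] := polyfun_cont (pf_sub pp pq) z e0.
have [y pqy /Hd] := Hz d d0.
by rewrite ltr_norml => /andP[]; lra.
Qed.

Lemma closed_and (J : Type) (S T : (J -> R) -> Prop) :
  closedS S -> closedS T -> closedS (fun z => S z /\ T z).
Proof.
move=> cS cT z Hz; split; [apply: cS | apply: cT] => e /Hz[y [Sy Ty] H];
  by exists y.
Qed.

Lemma definable_near (I J : finType) (p q : J -> (I -> R) -> R)
    (r : (I -> R) -> R) :
  (forall j, polyfun (p j)) -> (forall j, polyfun (q j)) -> polyfun r ->
  definable (fun x => near_pt (r x) (fun j => p j x) (fun j => q j x)).
Proof.
move=> pp pq pr; apply: def_allfin => j.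
apply: (def_iff (S := fun x => - r x < p j x - q j x /\ p j x - q j x < r x)).
  by move=> x; rewrite ltr_norml; split=> [[-> ->]|/andP].
by apply: def_and; apply: def_lt => //; [apply: pf_opp | |]; try exact: pf_sub.
Qed.

Definition boundedS (J : Type) (S : (J -> R) -> Prop) :=
  exists M, forall z, S z -> forall j, `|z j| <= M.

(** The greatest lower bound exists only once [p] is known to be bounded below, so cluster points
    are used twice: along p < -1/e, where they contradict continuity, then along p < m + e, where
    they give the minimiser. *)
Lemma min_attained (J : finType) (S : (J -> R) -> Prop) (p : (J -> R) -> R) :
  definable S -> closedS S -> boundedS S -> (exists z, S z) -> polyfun p ->
  exists2 z, S z & forall y, S y -> p z <= p y.
Proof.
move=> dS cS [M bS] [z0 Sz0] pp.
have pS (T : finType) (s : J -> T) : polyfun (fun x : T -> R => p (fun j => x (s j))).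
  exact: pf_sub_var.
have lowb : exists b, forall y, S y -> b <= p y.
  apply: contrapT => nb.
  have [||||z Hz] := @definable_cluster J (fun e y => S y /\ p y * e < -1) M.
  - apply: def_and; first exact: (def_sub inl dS).
    by apply: def_lt; [apply: pf_mul => //; apply: pf_var | apply: pf_const].
  - move=> e e' y e0 ee' [Sy H]; split=> //.
    have : p y < 0 by nra.
    by nra.
  - move=> e e0; apply: contrapT => H; apply: nb; exists (- e^-1) => y Sy.
    rewrite leNgt; apply/negP => Hy; apply: H; exists y; split=> //.
    by rewrite -ltr_pdivlMr // mulN1r.
  - by move=> y [/bS].
  have [d d0 Hd] := polyfun_cont pp z ltr01.
  pose k := `|p z| + 2.
  have k0 : 0 < k by rewrite /k; have := normr_ge0 (p z); lra.
  have e0 : 0 < Num.min d k^-1 by rewrite lt_min d0 invr_gt0.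
  have [y [Sy Hy] /(near_ptW (min_lel _ _))/Hd] := Hz _ e0.
  rewrite ltr_norml => /andP[py _].
  have pk : - k < p y.
    have : - `|p z| <= p z by rewrite lerNl -normrN ler_norm.
    by rewrite /k; lra.
  have : p y * Num.min d k^-1 >= - k * Num.min d k^-1 by rewrite ler_wpM2r // ltW.
  have : k * Num.min d k^-1 <= 1.
    by rewrite -ler_pdivlMl // mulr1 ge_min lexx orbT.
  by lra.
have [b Hb] := lowb.
pose V a := forall y, S y -> a <= p y.
have dV : definable (fun x : unit -> R => V (x tt)).
  apply: def_all; apply: def_imp; first exact: (def_sub inr dS).
  by apply: def_le => //; apply: pf_var.
have [||m Um Lm] := definable_sup dV; first by exists b.
  by exists (p z0) => a; apply.
have mV y : S y -> m <= p y.
  move=> Sy; rewrite leNgt; apply/negP => /Lm[a Va]; rewrite ltNge.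
  by rewrite Va.
have [||||z Hz] := @definable_cluster J (fun e y => S y /\ p y < m + e) M.
- apply: def_and; first exact: (def_sub inl dS).
  apply: def_lt => //; apply: pf_add; [exact: pf_const | exact: pf_var].
- by move=> e e' y e0 ee' [Sy H]; split=> //; lra.
- move=> e e0; apply: contrapT => H; have : m + e <= m; last by lra.
  apply: Um => y Sy; rewrite leNgt; apply/negP => Hy; apply: H.
  by exists y.
- by move=> y [/bS].
have Sz : S z.
  by apply: cS => e /Hz[y [Sy _] H]; exists y.
exists z => // y /mV; apply: le_trans.
rewrite leNgt; apply/negP => mz.
have e0 : 0 < (p z - m) / 2 by lra.
have [d d0 Hd] := polyfun_cont pp z e0.
have e1 : 0 < Num.min d ((p z - m) / 2) by rewrite lt_min d0 e0.
have [w [Sw Hw] /(near_ptW (min_lel _ _))/Hd] := Hz _ e1.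
have : Num.min d ((p z - m) / 2) <= (p z - m) / 2 by rewrite ge_min lexx orbT.
by rewrite ltr_norml => ? /andP[? _]; lra.
Qed.

End Compactness.

(** * Approximation of minima by critical points *)

Section LocalMinima.
Variable R : rcfType.

Lemma fin_pos (L : finType) (P : L -> R -> Prop) :
  (forall l d d', 0 < d -> d <= d' -> P l d' -> P l d) ->
  (forall l, exists2 d, 0 < d & P l d) ->
  exists2 d, 0 < d & forall l, P l d.
Proof.
move=> mP nP.
suff [d d0 Hd] : exists2 d, 0 < d & forall l, l \in enum L -> P l d.
  by exists d => // l; apply: Hd; rewrite mem_enum.
elim: (enum L) => [|l s [d d0 Hd]]; first by exists 1.
have [d' d'0 Hd'] := nP l.
have m0 : 0 < Num.min d d' by rewrite lt_min d0 d'0.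
exists (Num.min d d') => // k; rewrite inE => /orP[/eqP ->|/Hd].
  by apply: mP Hd' => //; apply: min_ler.
by apply: mP => //; apply: min_lel.
Qed.

Lemma sg_near (J : Type) (p : (J -> R) -> R) (z : J -> R) :
  polyfun p -> p z != 0 ->
  exists2 d, 0 < d & forall y, near_pt d y z -> Num.sg (p y) = Num.sg (p z).
Proof.
move=> pp pz; have e0 : 0 < `|p z| by rewrite normr_gt0.
have [d d0 Hd] := polyfun_cont pp z e0; exists d => // y /Hd.
rewrite ltr_norml => /andP[H1 H2].
have [pz0|pz0|pz0] := ltrgtP (p z) 0; last by rewrite pz0 eqxx in pz.
  by rewrite ltr0_norm // in H2; rewrite !ltr0_sg //; lra.
by rewrite gtr0_norm // in H1; rewrite !gtr0_sg //; lra.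
Qed.

Lemma definable_sg (J : finType) (p : (J -> R) -> R) (c : R) :
  polyfun p -> definable (fun z => Num.sg (p z) = c).
Proof.
move=> pp; apply: (def_iff (S := fun z => (0 < p z /\ c = 1) \/
  ((p z = 0 /\ c = 0) \/ (p z < 0 /\ c = -1)))).
  move=> z; split.
    move=> [[H ->]|[[-> ->]|[H ->]]]; last exact: ltr0_sg.
      exact: gtr0_sg.
    exact: sgr0.
  move=> <-; have [H|H|H] := ltrgtP (p z) 0.
  - by right; right; rewrite ltr0_sg.
  - by left; rewrite gtr0_sg.
  - by right; left; rewrite H sgr0.
apply: def_or; last apply: def_or; apply: def_and; try exact: def_cst.
- by apply: def_lt => //; apply: pf_const.
- by apply: def_eq => //; apply: pf_const.
- by apply: def_lt => //; apply: pf_const.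
Qed.

Variables (J L : finType) (j0 : J) (F : L -> (J -> R) -> R).
Variables (S : (J -> R) -> Prop) (h : (J -> R) -> R).
Hypothesis pF : forall l, polyfun (F l).
Hypothesis ph : polyfun h.
Hypothesis h_gt0 : forall z, 0 < h z.
Hypothesis dS : definable S.
Hypothesis cS : closedS S.
Hypothesis bS : boundedS S.
Hypothesis nS : exists z, S z.
Hypothesis locS : forall z z', S z ->
  (forall l, Num.sg (F l z') = Num.sg (F l z)) -> S z'.

Let zeros z := [set l | F l z == 0].

(* Choosing the minimiser p with as many vanishing F l as possible makes the set
   C of minimisers with the same signs as p compact, and near C the equations
   F l = 0 active at p already describe S. *)
Lemma critical_approx : exists p, [/\ S p, (forall z, S z -> p j0 <= z j0) &
  forall E e, 0 < e -> exists eta z r,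
    [/\ E < eta, 0 < eta, `|z j0 - p j0| < e, 0 < r &
        eta * (\sum_(l | F l p == 0) F l z ^+ 2) <= h z /\
        forall z', near_pt r z' z ->
          eta * (\sum_(l | F l p == 0) F l z' ^+ 2) <= h z' -> z j0 <= z' j0]].
Proof.
have [MM HMM] := bS.
have [p0 Sp0 mp0] := min_attained dS cS bS nS (pf_var R j0).
pose m := p0 j0; pose M z := S z /\ z j0 <= m.
have [p [Mp maxp]] : exists p, M p /\ forall z, M z ->
    (#|zeros z| <= #|zeros p|)%N.
  pose P k := `[< exists2 z, M z & #|zeros z| = k >].
  have exP : exists k, P k.
    by exists #|zeros p0|; apply/asboolP; exists p0 => //; split.
  have bP k : P k -> (k <= #|L|)%N.
    by move=> /asboolP[z _ <-]; apply: max_card.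
  case: (ex_maxnP exP bP) => k /asboolP[p Mp pk] Hk; exists p; split=> // z Mz.
  by rewrite pk; apply: Hk; apply/asboolP; exists z.
have [Sp pm] := Mp.
have pmE : p j0 = m by apply/eqP; rewrite eq_le pm mp0.
exists p; split=> //; first by move=> z /mp0; rewrite pmE.
pose q z := \sum_(l | F l p == 0) F l z ^+ 2.
have pq : polyfun q by apply: pf_sum => l; apply: pf_exp.
have q_ge0 z : 0 <= q z by apply: sumr_ge0 => l _; apply: sqr_ge0.
pose C z := M z /\ forall l, Num.sg (F l z) = Num.sg (F l p).
have Cp : C p by [].
have Cj0 c : C c -> c j0 = m.
  by move=> [[/mp0 H1 H2] _]; apply/eqP; rewrite eq_le H2 H1.
have dC : definable C.
  apply: def_and.
    apply: def_and => //; apply: def_le; [exact: pf_var | exact: pf_const].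
  by apply: def_allfin => l; apply: definable_sg.
have bC c : C c -> forall j, `|c j| <= MM by move=> [[/HMM]].
have closeM : closedS M.
  by apply: closed_and => //; apply: closed_le; [apply: pf_var | apply: pf_const].
have cC : closedS C.
  move=> z Hz.
  have Mz : M z by apply: closeM => e /Hz[y [My _] H]; exists y.
  have ge0 l : 0 <= F l p -> 0 <= F l z.
    move=> Hl; apply: (closed_le (pf_const _ 0) (pF l)) => e /Hz[y [_ Hy] H].
    by exists y => //; rewrite -sgr_ge0 Hy sgr_ge0.
  have le0 l : F l p <= 0 -> F l z <= 0.
    move=> Hl; apply: (closed_le (pF l) (pf_const _ 0)) => e /Hz[y [_ Hy] H].
    by exists y => //; rewrite -sgr_le0 Hy sgr_le0.
  (* In a limit, zeros can only be gained; as [p] already has the largest possible number among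
     minimisers, none is gained. *)
  have zz : zeros z = zeros p.
    apply/esym/eqP; rewrite eqEcard maxp // andbT; apply/subsetP=> l.
    rewrite !inE => /eqP Hl; rewrite eq_le.
    by rewrite ge0 ?le0 // Hl.
  split=> // l; have : (l \in zeros z) = (l \in zeros p) by rewrite zz.
  rewrite !inE; have [H|H|H] := ltrgtP (F l p) 0 => zl.
  - by rewrite !ltr0_sg // lt_neqAle zl le0 // ltW.
  - by rewrite !gtr0_sg // lt_neqAle eq_sym zl ge0 // ltW.
  - by rewrite (eqP zl) H.
(* By compactness of [C], one radius preserves the signs of the inactive [F l] around all points of
   [C]. *)
have [rho rho0 Hrho] : exists2 rho, 0 < rho & forall z c, C c ->
    near_pt rho z c -> forall l, F l p != 0 -> Num.sg (F l z) = Num.sg (F l p).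
  apply: contrapT => nr.
  pose B e z := exists c, (C c /\ near_pt e z c) /\
    exists l, F l p != 0 /\ Num.sg (F l z) <> Num.sg (F l p).
  have [||||z Hz] := @definable_cluster R J B (MM + 1).
  - apply: def_ex; apply: def_and.
      apply: def_and; first exact: (def_sub inr dC).
      by apply: definable_near => *; apply: pf_var.
    apply: def_exfin => l; apply: def_and; first exact: def_cst.
    have := def_not (definable_sg (Num.sg (F l p)) (pF l)).
    exact: (def_sub (fun j : J => inl (inl j))).
  - move=> e e' y e0 ee' [c [[Cc Hc] H]]; exists c; split=> //; split=> //.
    exact: near_ptW Hc.
  - move=> e e0; apply: contrapT => H; apply: nr; exists e => // z c Cc zc l Fl.
    apply: contrapT => Hs; apply: H; exists z, c; split=> //.
    by exists l.
  - move=> y [c [[Cc Hc] _]] j; have := bC c Cc j; have := Hc j.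
    rewrite ltr_norml !ler_norml => /andP[? ?] /andP[? ?].
    by apply/andP; split; lra.
  have Cz : C z.
    apply: cC => e e0; have e2 : 0 < e / 2 by lra.
    have [y [c [[Cc yc] _]] yz] := Hz _ e2; exists c => // j.
    have := yc j; have := yz j; rewrite !ltr_norml.
    by move=> /andP[? ?] /andP[? ?]; apply/andP; split; lra.
  have [d d0 Hd] : exists2 d, 0 < d & forall l, F l p != 0 ->
      forall y, near_pt d y z -> Num.sg (F l y) = Num.sg (F l p).
    apply: (@fin_pos L (fun l d => F l p != 0 ->
      forall y, near_pt d y z -> Num.sg (F l y) = Num.sg (F l p))).
      by move=> l d d' d0 dd' H Fl y /(near_ptW dd'); apply: H.
    move=> l; have [Fl|Fl] := eqVneq (F l p) 0; first by exists 1.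
    have Flz : F l z != 0 by have [_ /(_ l)] := Cz; rewrite -sgr_eq0 => ->; rewrite sgr_eq0.
    have [d d0 Hd] := sg_near (pF l) Flz; exists d => // _ y /Hd ->.
    by have [_ ->] := Cz.
  have [y [c [_ [l [Fl sFl]]]] yz] := Hz d d0.
  exact: sFl (Hd l Fl y yz).
move=> E e e0.
pose rh := rho / 2; have rh0 : 0 < rh by rewrite /rh; lra.
have rhl : rh < rho by rewrite /rh; lra.
pose le_pt d (z c : J -> R) := forall j, z j - c j <= d /\ c j - z j <= d.
have le_near d d' z c : d < d' -> le_pt d z c -> near_pt d' z c.
  move=> dd H j; have [? ?] := H j; rewrite ltr_norml; apply/andP; split; lra.
(* A closed tube around [C]. Working inside it keeps the problem compact; it then has to be shown
   that the minimiser does not lie on its boundary. *)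
pose K z := exists c, C c /\ le_pt rh z c.
have dK : definable K.
  apply: def_ex; apply: def_and; first exact: (def_sub inr dC).
  apply: def_allfin => j; apply: def_and; apply: def_le;
    by [exact: pf_const | apply: pf_sub; apply: pf_var].
have bK z : K z -> forall j, `|z j| <= MM + rh.
  move=> [c [Cc Hc]] j; have := bC c Cc j; have [? ?] := Hc j.
  by rewrite !ler_norml => /andP[? ?]; apply/andP; split; lra.
have cK : closedS K.
  move=> z Hz.
  have [||||c Hc] := @definable_cluster R J
      (fun e c => C c /\ le_pt (rh + e) z c) MM.
  - apply: def_and; first exact: (def_sub inl dC).
    apply: def_allfin => j; apply: def_and; apply: def_le.
    + by apply: pf_sub; [apply: pf_const | apply: pf_var].
    + by apply: pf_add; [apply: pf_const | apply: pf_var].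
    + by apply: pf_sub; [apply: pf_var | apply: pf_const].
    + by apply: pf_add; [apply: pf_const | apply: pf_var].
  - move=> d d' y d0 dd' [Cy H]; split=> // j; have [? ?] := H j; split; lra.
  - move=> d d0; have [y [c [Cc Hc]] yz] := Hz d d0; exists c; split=> // j.
    have [? ?] := Hc j; have := yz j; rewrite ltr_norml => /andP[? ?].
    by split; lra.
  - by move=> y [/bC].
  exists c; split; first by apply: cC => d /Hc[y [Cy _] H]; exists y.
  have Hd d : 0 < d -> le_pt (rh + 2 * d) z c.
    move=> d0 j; have [y [_ /(_ j)[? ?] /(_ j)]] := Hc d d0.
    by rewrite ltr_norml => /andP[? ?]; split; lra.
  move=> j; split; rewrite leNgt; apply/negP => H.
    have d0 : 0 < (z j - c j - rh) / 4 by lra.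
    by have [] := Hd _ d0 j; lra.
  have d0 : 0 < (c j - z j - rh) / 4 by lra.
  by have [] := Hd _ d0 j; lra.
pose e' := Num.min e rh / 2.
have mer : 0 < Num.min e rh by rewrite lt_min e0 rh0.
have e'0 : 0 < e' by rewrite /e'; lra.
have e'e : e' < e by have := min_lel e rh; rewrite /e'; lra.
have e'r : e' < rh by have := min_ler e rh; rewrite /e'; lra.
(* Otherwise a cluster point as t tends to 0 stays in the tube below level [m] with [q] = 0, so it
   has the signs of [p], lies in [S] by [locS], hence in [C], although it is a limit of points far
   from [C]. *)
have [t0 t00 Ht0] : exists2 t0, 0 < t0 & forall z, K z -> z j0 <= m ->
    q z <= t0 * h z -> exists c, C c /\ near_pt e' z c.
  apply: contrapT => nt.
  have [||||z Hz] := @definable_cluster R J (fun t z => (K z /\ z j0 <= m) /\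
     (q z <= t * h z /\ forall c, C c -> ~ near_pt e' z c)) (MM + rh).
  - apply: def_and.
      apply: def_and; first exact: (def_sub inl dK).
      by apply: def_le; [apply: pf_var | apply: pf_const].
    apply: def_and.
      apply: def_le; first exact: pf_sub_var.
      by apply: pf_mul; [apply: pf_var | apply: pf_sub_var].
    apply: def_all; apply: def_imp; first exact: (def_sub inr dC).
    by apply: def_not; apply: definable_near => *; [apply: pf_var|apply: pf_var|apply: pf_const].
  - move=> d d' y d0 dd' [Ky [H1 H2]]; split=> //; split=> //.
    by apply: le_trans H1 _; rewrite ler_pM2r.
  - move=> d d0; apply: contrapT => H; apply: nt; exists d => // z Kz zm qz.
    apply: contrapT => Hs; apply: H; exists z; split=> //; split=> // c Cc zc.
    by apply: Hs; exists c.
  - by move=> y [[/bK]].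
  have Kz : K z by apply: cK => d /Hz[y [[Ky _] _] H]; exists y.
  have zm : z j0 <= m.
    apply: (closed_le (pf_var _ j0) (pf_const _ m)) => d /Hz[y [[_ ym] _] H].
    by exists y.
  have qz : q z = 0.
    apply/eqP; rewrite eq_le q_ge0 andbT leNgt; apply/negP => qz.
    have q2 : 0 < q z / 2 by lra.
    have [d d0 Hd] := polyfun_cont pq z q2.
    have [d' d'0 Hd'] := polyfun_cont ph z ltr01.
    have hz := h_gt0 z.
    pose t := (q z / 2) / (h z + 1).
    have t0 : 0 < t by rewrite divr_gt0 //; lra.
    have tE : t * (h z + 1) = q z / 2 by rewrite divfK // gt_eqF //; lra.
    pose s := Num.min (Num.min d d') t.
    have s0 : 0 < s by rewrite !lt_min d0 d'0 t0.
    have [y [_ [qy _]] yz] := Hz s s0.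
    have := Hd y (near_ptW (le_trans (min_lel _ _) (min_lel _ _)) yz).
    have := Hd' y (near_ptW (le_trans (min_lel _ _) (min_ler _ _)) yz).
    rewrite !ltr_norml => /andP[h1 h2] /andP[q1 q2'].
    have st : s <= t by exact: min_ler.
    have hy := h_gt0 y.
    have : s * h y <= t * (h z + 1) by nra.
    by lra.
  have Cz : C z.
    have sgz l : Num.sg (F l z) = Num.sg (F l p).
      have [Fl|Fl] := eqVneq (F l p) 0.
        have : F l z ^+ 2 = 0.
          by apply: (psumr_eq0P (fun i _ => sqr_ge0 (F i z)) qz); rewrite Fl.
        by move=> /eqP; rewrite sqrf_eq0 => /eqP ->; rewrite Fl.
      have [c [Cc /(le_near _ _ _ _ rhl) zc]] := Kz.
      exact: (Hrho _ _ Cc zc).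
    by split=> //; split=> //; apply: locS Sp _.
  have [y [_ [_ Hy]] yz] := Hz _ e'0.
  exact: (Hy z Cz yz).
pose eta := Num.max (E + 1) (Num.max t0^-1 1).
have eta0 : 0 < eta by rewrite !lt_max ltr01 !orbT.
have t0eta : eta^-1 <= t0.
  by rewrite invf_ple ?posrE // !le_max lexx orbT.
(* The point [p] competes in this minimisation, so the minimiser lies below level [m] and within
   [e'] of [C]. As [e'] < [rh], it is interior to the tube, hence a local minimum without the
   constraint [K]. *)
have [|||||z [Kz qz] minz] := @min_attained R J (fun z => K z /\ eta * q z <= h z)
    (fun z => z j0).
- by apply: def_and => //; apply: def_le => //; apply: pf_mul => //; apply: pf_const.
- apply: closed_and => //; apply: closed_le => //; apply: pf_mul => //.
  exact: pf_const.
- by exists (MM + rh) => z [/bK].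
- exists p; split.
    by exists p; split=> // j; rewrite subrr; split; apply: ltW.
  have -> : q p = 0.
    by apply: big1 => l /eqP ->; rewrite expr0n.
  by rewrite mulr0; apply: ltW.
- exact: pf_var.
have Kp : K p by exists p; split=> // j; rewrite subrr; split; apply: ltW.
have qp : eta * q p <= h p.
  have -> : q p = 0 by apply: big1 => l /eqP ->; rewrite expr0n.
  by rewrite mulr0; apply: ltW.
have zm : z j0 <= m by rewrite -pmE; apply: minz.
have qz' : q z <= t0 * h z.
  apply: le_trans (_ : eta^-1 * h z <= _); first by rewrite ler_pdivlMl.
  by rewrite ler_pM2r.
have [c [Cc zc]] := Ht0 z Kz zm qz'.
exists eta, z, (rh - e'); split=> //.
- by rewrite lt_max; apply/orP; left; lra.
- by rewrite pmE -(Cj0 c Cc); apply: lt_trans e'e.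
- by lra.
split=> // z' zz' qz2; apply: minz; split=> //.
exists c; split=> // j; have := zz' j; have := zc j.
by rewrite !ltr_norml => /andP[? ?] /andP[? ?]; split; lra.
Qed.

End LocalMinima.

(** * Elimination *)

Lemma mmap1M (T : comNzRingType) (k : nat) (x : 'I_k -> T) (m1 m2 : 'X_{1..k}) :
  mmap1 x (m1 + m2)%MM = mmap1 x m1 * mmap1 x m2.
Proof. by apply: commr_mmap1_M => i y; apply: mulrC. Qed.

Section Elimination.

(** An abstract form of [degree at most a]. The determinant is estimated once for all filtrations;
    the instances are the total degree and the degree in s read through nested polynomial rings. *)
Record degfil (T : comNzRingType) (B : nat -> T -> Prop) : Prop := DegFil {
  degfil0 : forall a, B a 0;
  degfil1 : B 0 1;
  degfilD : forall a x y, B a x -> B a y -> B a (x + y);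
  degfilN : forall a x, B a x -> B a (- x);
  degfilM : forall a b x y, B a x -> B b y -> B (a + b)%N (x * y);
  degfilW : forall a b x, (a <= b)%N -> B a x -> B b x }.

(** The abstract counterpart for the size of integer coefficients, to be instantiated by
    l1-norms. *)
Record seminorm (T : comNzRingType) (nu : T -> nat) : Prop := SemiNorm {
  seminorm0 : nu 0 = 0%N;
  seminorm1 : (nu 1%R <= 1)%N;
  seminormD : forall x y, (nu (x + y)%R <= nu x + nu y)%N;
  seminormN : forall x, nu (- x) = nu x;
  seminormM : forall x y, (nu (x * y)%R <= nu x * nu y)%N }.

Section DegFilTheory.
Variables (T : comNzRingType) (B : nat -> T -> Prop).
Hypothesis fB : degfil B.

Lemma degfil_sum (I : Type) (r : seq I) (P : pred I) (F : I -> T) a :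
  (forall i, P i -> B a (F i)) -> B a (\sum_(i <- r | P i) F i).
Proof.
move=> H; apply: (big_ind (B a)) => //; first exact: degfil0.
exact: degfilD.
Qed.

Lemma degfil_nat a x k : B a x -> B a (x * k%:R).
Proof.
move=> Bx; elim: k => [|k IHk]; first by rewrite mulr0; apply: degfil0.
by rewrite mulrSr mulrDr mulr1; apply: degfilD.
Qed.

Lemma degfil_prod (I : finType) (F : I -> T) a :
  (forall i, B a (F i)) -> B (#|I| * a)%N (\prod_i F i).
Proof.
move=> H; rewrite -sum1_card big_distrl /=.
elim/big_ind2: _ => [|x m y l Hx Hy|i _]; first exact: degfil1.
  exact: degfilM.
by rewrite mul1n.
Qed.
End DegFilTheory.

Section SeminormTheory.
Variables (T : comNzRingType) (nu : T -> nat).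
Hypothesis fnu : seminorm nu.

Lemma seminorm_sum (I : Type) (r : seq I) (P : pred I) (F : I -> T) :
  (nu (\sum_(i <- r | P i) F i)%R <= \sum_(i <- r | P i) nu (F i))%N.
Proof.
elim/big_ind2: _ => [|x m y l Hx Hy|i _//]; first by rewrite seminorm0.
by apply: leq_trans (seminormD _ _ _) (leq_add _ _).
Qed.

Lemma seminorm_nat k : (nu k%:R <= k)%N.
Proof.
elim: k => [|k IHk]; first by rewrite seminorm0.
rewrite mulrSr -addn1; apply: leq_trans (seminormD _ _ _) (leq_add IHk _) => //.
exact: seminorm1.
Qed.

Lemma seminorm_prod (I : finType) (F : I -> T) E :
  (forall i, nu (F i) <= E)%N -> (nu (\prod_i F i)%R <= E ^ #|I|)%N.
Proof.
move=> H; rewrite -prod_nat_const.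
elim/big_ind2: _ => [|x m y l Hx Hy|i _]; first exact: seminorm1.
  by apply: leq_trans (seminormM _ _ _) (leq_mul _ _).
exact: H.
Qed.

Lemma seminorm_sign (b : bool) : (nu ((-1) ^+ b)%R <= 1)%N.
Proof. by case: b; rewrite ?expr1 ?expr0 ?seminormN // ?seminorm1. Qed.
End SeminormTheory.

Lemma degfil_det (T : comNzRingType) (B : nat -> T -> Prop) r (M : 'M[T]_r) a :
  degfil B -> (forall i j, B a (M i j)) -> B (r * a)%N (\det M).
Proof.
move=> fB H; apply: degfil_sum => // s _; rewrite -[(r * a)%N]add0n.
apply: degfilM => //.
  by case: (odd_perm s); rewrite ?expr1 ?expr0;
    [apply: degfilN => //|]; apply: degfil1.
by have := degfil_prod fB (fun i => H i (s i)); rewrite card_ord.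
Qed.

Lemma seminorm_det (T : comNzRingType) (nu : T -> nat) r (M : 'M[T]_r) E :
  seminorm nu -> (forall i j, nu (M i j) <= E)%N ->
  (nu (\det M) <= r`! * E ^ r)%N.
Proof.
move=> fnu H; apply: leq_trans (seminorm_sum fnu _ _ _) _.
rewrite -(card_Sn r) -sum_nat_const.
rewrite [X in (_ <= X)%N](eq_bigl (fun=> true)); last by move=> s; rewrite inE.
apply: leq_sum => s _.
apply: leq_trans (seminormM fnu _ _) _; rewrite -[X in (_ <= X)%N]mul1n.
apply: leq_mul; first exact: seminorm_sign.
by have := seminorm_prod fnu (fun i => H i (s i)); rewrite card_ord.
Qed.

Variables (A : idomainType) (R : idomainType).

(** Iterated, it evaluates an element of K[s][u][eta] at numbers: [evp (evp (evp iota s) u) eta],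
    the variable eta being the outermost. *)
Definition evp (phi : {rmorphism A -> R}) (eta : R) : {poly A} -> R :=
  horner_eval eta \o map_poly phi.

HB.instance Definition _ phi eta := GRing.RMorphism.copy (evp phi eta)
  (horner_eval eta \o map_poly phi).

Lemma evpC phi eta c : evp phi eta c%:P = phi c.
Proof. by rewrite /evp /= map_polyC /horner_eval hornerC. Qed.

Lemma evpX phi eta : evp phi eta 'X = eta.
Proof. by rewrite /evp /= map_polyX /horner_eval hornerX. Qed.

Variables (k D0 : nat) (q : {mpoly A[k]}).
Let D := D0.+1.
Hypothesis deg_q : forall m, m \in msupp q -> (mdeg m < D)%N.

(* Critical points of u on eta * q = h with h = 1 + sum_i x_i^(D+1) / (D+1):
   crit1 says that the x-gradient vanishes; by crit1 and Euler's relation the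
   equation eta * q = h becomes crit2. *)
Definition crit1 (phi : {rmorphism A -> R}) (eta : R) (x : 'I_k -> R) :=
  forall i, x i ^+ D = eta *
    \sum_(m <- msupp q) phi (q@_m) * (m i)%:R * mmap1 x (m - U_(i))%MM.

Definition crit2 (phi : {rmorphism A -> R}) (eta : R) (x : 'I_k -> R) :=
  eta * (\sum_(m <- msupp q) phi (q@_m) * (D.+1 - mdeg m)%:R * mmap1 x m) =
  D.+1%:R.

Let Box := {ffun 'I_k -> 'I_D}.
Let bm (b : Box) : 'X_{1..k} := [multinom b i : nat | i < k].

(** The variable eta gets weight 0, so only the coefficients of [q] contribute to the degree. *)
Definition coef_filtered beta (B : nat -> {poly A} -> Prop) :=
  [/\ degfil B, B 0%N 'X & forall m, B beta (q@_m)%:P].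

Definition coef_normed (Lambda : nat) (nu : {poly A} -> nat) :=
  [/\ seminorm nu, (nu 'X <= 1)%N &
      (\sum_(m <- msupp q) nu (q@_m)%:P <= Lambda)%N].

Lemma mdeg_box (b : Box) : (mdeg (bm b) <= k * D0)%N.
Proof.
rewrite mdegE -[X in (_ <= X * _)%N](card_ord k) -sum_nat_const.
by apply: leq_sum => i _; rewrite mnmE -ltnS.
Qed.

(** Replacing x_i^D by means of [crit1] produces monomials of strictly smaller total degree, so at
    most [mdeg a] replacements reach the box. Each costs [beta] in degree, and in norm a factor
    [Lambda] for the coefficients of [q] and [D] for the factors [m i] from differentiation. The
    coefficients [c] are chosen before [phi], [eta] and [x]. *)
Lemma reduce_mono (a : 'X_{1..k}) : exists c : Box -> {poly A},
  [/\ forall phi eta x, crit1 phi eta x ->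
        mmap1 x a = \sum_b evp phi eta (c b) * mmap1 x (bm b),
      forall beta B, coef_filtered beta B ->
        forall b, B (beta * mdeg a)%N (c b) &
      forall Lambda nu, (0 < Lambda)%N -> coef_normed Lambda nu ->
        (\sum_b nu (c b) <= (D * Lambda) ^ mdeg a)%N].
Proof.
have [n] := ubnP (mdeg a); elim: n a => // n IHn a.
rewrite ltnS => an.
have [/forallP abox|] := boolP [forall i, a i < D]%N.
  pose b0 : Box := [ffun i => Ordinal (abox i)].
  have ab0 : bm b0 = a by apply/mnmP=> i; rewrite mnmE ffunE.
  exists (fun b => (b == b0)%:R); split.
  - move=> phi eta x _; rewrite (bigD1 b0) //= eqxx rmorph1 mul1r ab0.
    rewrite big1 ?addr0 // => b /negbTE ->.
    by rewrite rmorph0 mul0r.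
  - move=> beta B [fB _ _] b; apply: (degfilW fB (leq0n _)).
    by case: (b == b0); [apply: degfil1 | apply: degfil0].
  - move=> Lambda nu L0 [fnu _ _]; rewrite (bigD1 b0) //= eqxx big1.
      rewrite addn0; apply: leq_trans (seminorm1 fnu) _.
      by rewrite expn_gt0 muln_gt0 L0.
    by move=> b /negbTE ->; rewrite seminorm0.
rewrite negb_forall => /existsP[i]; rewrite -leqNgt => Dai.
pose a' := (a - U_(i) *+ D)%MM.
have aE : a = (U_(i) *+ D + a')%MM.
  apply/mnmP=> j; rewrite mnmDE mulmnE mnm1E /a' mnmBE mulmnE mnm1E.
  by have [<-|_] := eqVneq i j; rewrite ?mul1n ?mul0n ?subnKC ?add0n ?subn0.
have dega : mdeg a = (D + mdeg a')%N.
  by rewrite [in LHS]aE mdegD mdegMn mdeg1 mul1n.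
(* If x_i does not occur in [m], the truncated difference is [m] itself: its term carries the factor
   [m i] = 0, and its degree is still below [D]. *)
pose t (m : 'X_{1..k}) := (a' + (m - U_(i)))%MM.
have degt m : m \in msupp q -> (mdeg (t m) < mdeg a)%N.
  move=> /deg_q mD; rewrite mdegD dega addnC ltn_add2r.
  exact: leq_ltn_trans (mdegB _ _) mD.
have ex m : exists c : Box -> {poly A}, m \in msupp q ->
  [/\ forall phi eta x, crit1 phi eta x ->
        mmap1 x (t m) = \sum_b evp phi eta (c b) * mmap1 x (bm b),
      forall beta B, coef_filtered beta B ->
        forall b, B (beta * mdeg (t m))%N (c b) &
      forall Lambda nu, (0 < Lambda)%N -> coef_normed Lambda nu ->
        (\sum_b nu (c b) <= (D * Lambda) ^ mdeg (t m))%N].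
  have [mq|mq] := boolP (m \in msupp q); last by exists (fun=> 0).
  have [|c Hc] := IHn (t m); last by exists c.
  exact: leq_trans (degt m mq) an.
have [c Hc] := choice ex.
exists (fun b => \sum_(m <- msupp q) 'X * (q@_m)%:P * (m i)%:R * c m b); split.
- move=> phi eta x H1.
  have -> : mmap1 x a = x i ^+ D * mmap1 x a'.
    rewrite {1}aE mmap1M /mmap1; congr (_ * _); rewrite (bigD1 i) //=.
    rewrite mulmnE mnm1E eqxx mul1n big1 ?mulr1 // => j ji.
    by rewrite mulmnE mnm1E eq_sym (negbTE ji) mul0n expr0.
  rewrite H1 -mulrA big_distrl big_distrr /=.
  under [RHS]eq_bigr do rewrite rmorph_sum big_distrl /=.
  rewrite exchange_big /= !big_seq; apply: eq_bigr => m mq.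
  have [/(_ phi eta x H1) Hm _ _] := Hc m mq.
  rewrite -[_ * mmap1 x a']mulrA -mmap1M [(_ + a')%MM]addmC -/(t m) Hm.
  rewrite big_distrr big_distrr /=; apply: eq_bigr => b _.
  by rewrite !rmorphM /= evpX evpC rmorph_nat; ring.
- move=> beta B cB b; have [fB BX Bq] := cB.
  rewrite big_seq; apply: degfil_sum => // m mq.
  have [_ /(_ beta B cB b) Hm _] := Hc m mq.
  apply: (degfilW fB (a := (0 + beta + beta * mdeg (t m))%N)).
    by rewrite add0n -mulnS leq_mul2l degt ?orbT.
  by apply: (degfilM fB) => //; apply: degfil_nat => //; apply: degfilM.
- move=> Lambda nu L0 cnu; have [fnu nX nq] := cnu.
  have Hm m : m \in msupp q -> (\sum_b nu ('X * (q@_m)%:P * (m i)%:R * c m b)%R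
      <= nu (q@_m)%:P * (D * (D * Lambda) ^ (mdeg a).-1))%N.
    move=> mq; have [_ _ /(_ Lambda nu L0 cnu) Hm] := Hc m mq.
    have Dm : (m i <= D)%N.
      apply: leq_trans (ltnW (deg_q mq)); rewrite mdegE (bigD1 i) //=.
      exact: leq_addr.
    apply: leq_trans (_ : \sum_b nu (q@_m)%:P * D * nu (c m b) <= _)%N.
      apply: leq_sum => b _; apply: leq_trans (seminormM fnu _ _) _.
      rewrite leq_mul2r; apply/orP; right.
      apply: leq_trans (seminormM fnu _ _) _; apply: leq_mul.
        apply: leq_trans (seminormM fnu _ _) _.
        by rewrite -[X in (_ <= X)%N]mul1n leq_mul2r nX orbT.
      exact: leq_trans (seminorm_nat fnu _) Dm.
    rewrite -big_distrr /= mulnA leq_mul2l; apply/orP; right.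
    apply: leq_trans Hm _; apply: leq_pexp2l; first by rewrite muln_gt0 L0.
    by have := degt m mq; case: (mdeg a).
  apply: leq_trans (_ : \sum_(m <- msupp q) nu (q@_m)%:P *
      (D * (D * Lambda) ^ (mdeg a).-1) <= _)%N; last first.
    rewrite -big_distrl /=; apply: leq_trans (leq_mul nq (leqnn _)) _.
    rewrite mulnA [(Lambda * D)%N]mulnC -expnS prednK // dega.
    by rewrite addSn.
  apply: leq_trans (_ : \sum_b \sum_(m <- msupp q)
      nu ('X * (q@_m)%:P * (m i)%:R * c m b)%R <= _)%N.
    by apply: leq_sum => b _; apply: seminorm_sum.
  rewrite exchange_big /= !big_seq; apply: leq_sum => m mq; exact: Hm.
Qed.

(* By crit2, (eta (sum_m (D+1-|m|) q_m x^m) - (D+1)) x^a = 0 for every monomial x^a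
   in the box; reducing to the box with crit1, the vector (x^b)_b lies in the kernel
   of a matrix which specialises to -(D+1) times the identity at eta = 0. *)
Lemma elimination : (D.+1%:R != 0 :> A) -> exists P : {poly A},
  [/\ P != 0,
      forall phi eta x, crit1 phi eta x -> crit2 phi eta x ->
        evp phi eta P = 0,
      forall beta B, coef_filtered beta B ->
        B (D ^ k * (beta * (k.+1 * D0).+1))%N P &
      forall Lambda nu, (0 < Lambda)%N -> coef_normed Lambda nu ->
        (nu P <= (D ^ k)`! *
          (D.+1 * Lambda * (D * Lambda) ^ (k.+1 * D0) + D.+1) ^ (D ^ k))%N].
Proof.
move=> D0'.
have [c Hc] := choice reduce_mono.
pose N (a b : Box) : {poly A} := 'X * (\sum_(m <- msupp q)
   (q@_m)%:P * (D.+1 - mdeg m)%:R * c (bm a + m)%MM b) - ((a == b)%:R * D.+1%:R).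
pose r := #|Box|.
have rE : r = (D ^ k)%N by rewrite /r card_ffun !card_ord.
pose M : 'M[{poly A}]_r := \matrix_(i, j) N (enum_val i) (enum_val j).
(* Origin of the exponent [k.+1 * D0]: at most [k * D0] from a monomial of the box and at most [D0]
   from [q]. *)
have degam (a : Box) m : m \in msupp q -> (mdeg (bm a + m) <= k.+1 * D0)%N.
  move=> /deg_q mD; rewrite mdegD mulSn addnC leq_add //.
  exact: mdeg_box.
exists (\det M); split.
- have : horner_eval 0 (\det M) != 0; last first.
    by apply: contraNneq => ->; rewrite rmorph0.
  rewrite -det_map_mx.
  have -> : map_mx (horner_eval 0) M = (- D.+1%:R)%:M.
    apply/matrixP=> i j; rewrite !mxE /horner_eval /N hornerD hornerN hornerM.
    rewrite hornerX mul0r add0r (inj_eq enum_val_inj).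
    case: (i == j); last by rewrite mul0r horner0 oppr0.
    by rewrite mul1r -polyC_natr hornerC.
  by rewrite det_scalar expf_neq0 // oppr_eq0.
- move=> phi eta x H1 H2.
  rewrite -det_map_mx; apply/eqP; rewrite -det_tr; apply/det0P.
  exists (\row_j mmap1 x (bm (enum_val j))).
    (* The coordinate of the monomial 1 shows that the kernel vector is nonzero. *)
    pose z : Box := [ffun=> ord0].
    apply/eqP => /rowP/(_ (enum_rank z)); rewrite !mxE enum_rankK.
    rewrite /mmap1 big1; last by move=> i _; rewrite mnmE ffunE expr0.
    by move/eqP; rewrite oner_eq0.
  apply/rowP=> i; rewrite !mxE.
  set a := enum_val i.
  transitivity (mmap1 x (bm a) * (eta * (\sum_(m <- msupp q)
      phi (q@_m) * (D.+1 - mdeg m)%:R * mmap1 x m) - D.+1%:R)); last first.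
    by rewrite H2 subrr mulr0.
  under eq_bigr do rewrite !mxE.
  rewrite (reindex (@enum_rank Box)) /=; last first.
    by apply: onW_bij; apply: enum_rank_bij.
  under eq_bigr do rewrite enum_rankK rmorphB rmorphM /= evpX mulrBr.
  rewrite sumrB mulrBr; congr (_ - _); last first.
    rewrite (bigD1 a) //= eqxx mul1r rmorph_nat big1 ?addr0 // => b ba.
    by rewrite eq_sym (negbTE ba) mul0r rmorph0 mulr0.
  under [LHS]eq_bigr do rewrite rmorph_sum !big_distrr /=.
  rewrite exchange_big /= !big_distrr /= !big_seq; apply: eq_bigr => m mq.
  have [/(_ phi eta x H1) Hm _ _] := Hc (bm a + m)%MM.
  have -> : mmap1 x (bm a) * (eta * (phi q@_m * (D.+1 - mdeg m)%:R * mmap1 x m))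
     = eta * phi q@_m * (D.+1 - mdeg m)%:R * mmap1 x (bm a + m)%MM.
    by rewrite mmap1M; ring.
  rewrite Hm big_distrr /=; apply: eq_bigr => b _.
  by rewrite !rmorphM /= evpC rmorph_nat; ring.
- move=> beta B cB; have [fB BX Bq] := cB; rewrite -rE.
  apply: degfil_det => // i j; rewrite mxE.
  apply: (degfilD fB); last first.
    apply: (degfilN fB); apply: (degfil_nat fB).
    apply: (degfilW fB (leq0n _)).
    by case: (_ == _); [apply: degfil1 | apply: degfil0].
  rewrite -[(beta * _)%N]add0n; apply: degfilM => //.
  rewrite big_seq; apply: degfil_sum => // m mq; rewrite mulnS.
  apply: degfilM => //; first exact: degfil_nat.
  have [_ /(_ beta B cB) Hm _] := Hc (bm (enum_val i) + m)%MM.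
  by apply: degfilW (Hm _) => //; rewrite leq_mul2l degam ?orbT.
- move=> Lambda nu L0 cnu; have [fnu nX nq] := cnu; rewrite -rE.
  apply: seminorm_det => // i j; rewrite mxE.
  apply: leq_trans (seminormD fnu _ _) _; rewrite seminormN //.
  apply: leq_add; last first.
    apply: leq_trans (seminormM fnu _ _) _; rewrite -[X in (_ <= X)%N]mul1n.
    apply: leq_mul; last exact: seminorm_nat.
    by case: (_ == _); rewrite ?seminorm1 ?seminorm0.
  apply: leq_trans (seminormM fnu _ _) _; rewrite -[X in (_ <= X)%N]mul1n.
  apply: leq_mul => //; apply: leq_trans (seminorm_sum fnu _ _ _) _.
  apply: leq_trans (_ : \sum_(m <- msupp q) nu (q@_m)%:P *
      (D.+1 * (D * Lambda) ^ (k.+1 * D0)) <= _)%N; last first.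
    rewrite -big_distrl /=; apply: leq_trans (leq_mul nq (leqnn _)) _.
    by rewrite mulnCA mulnA.
  rewrite !big_seq; apply: leq_sum => m mq.
  apply: leq_trans (seminormM fnu _ _) _; rewrite mulnA; apply: leq_mul.
    apply: leq_trans (seminormM fnu _ _) _; apply: leq_mul => //.
    by apply: leq_trans (seminorm_nat fnu _) _; rewrite leq_subr.
  have [_ _ /(_ Lambda nu L0 cnu) Hm] := Hc (bm (enum_val i) + m)%MM.
  apply: leq_trans (_ : _ <= (D * Lambda) ^ mdeg (bm (enum_val i) + m))%N _.
    by apply: leq_trans Hm; rewrite (bigD1 (enum_val j)) //= leq_addr.
  by apply: leq_pexp2l; [rewrite muln_gt0 L0 | apply: degam].
Qed.

End Elimination.

(** * Real critical points and the limit eta -> infinity *)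

Section CriticalValues.
Variable R : rcfType.

Lemma polyfun_horner (J : Type) (g : {poly R}) (p : (J -> R) -> R) :
  polyfun p -> polyfun (fun z => g.[p z]).
Proof.
move=> pp; have -> : (fun z => g.[p z]) = (fun z => \sum_(i < size g) g`_i * p z ^+ i).
  by apply/funext=> z; rewrite horner_coef.
apply: pf_sum => i; apply: pf_mul; first exact: pf_const.
exact: pf_exp.
Qed.

Lemma deriv0_of_local_min (g : {poly R}) (r : R) : 0 < r -> g.[0] = 0 ->
  (forall t, `|t| < r -> 0 <= g.[t]) -> g^`().[0] = 0.
Proof.
move=> r0 g0 gmin.
have /factor_theorem[g1 gE] : root g 0 by rewrite rootE g0.
rewrite subr0 in gE.
have dg : g^`().[0] = g1.[0].
  by rewrite gE derivM derivX hornerD !hornerM hornerX mulr0 add0r hornerC mulr1.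
rewrite dg; apply/eqP/negPn/negP => g10.
have pg := @polyfun_horner unit g1 _ (pf_var R tt).
have [d d0 Hd] := @sg_near R unit _ (fun=> 0) pg g10.
(* The sign of [t] is opposite to that of [g1] near 0, so that g(t) = t g1(t) is negative. *)
pose t := Num.min d r / 2 * - Num.sg g1.[0].
have m0 : 0 < Num.min d r by rewrite lt_min d0 r0.
have tn : `|t| = Num.min d r / 2.
  rewrite normrM normrN normr_sg g10 mulr1 gtr0_norm //; lra.
have tr : `|t| < r by rewrite tn; have := min_ler d r; lra.
have td : near_pt d (fun=> t) (fun _ : unit => 0).
  by move=> j; rewrite subr0 tn; have := min_lel d r; lra.
have := gmin t tr; rewrite gE hornerM hornerX.
have := Hd _ td => /= sg1; rewrite -sgr_ge0 sgrM sg1 /t sgrM sgrN sgr_id.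
rewrite (gtr0_sg (x := Num.min d r / 2)); last by lra.
rewrite mul1r mulrN -expr2 sqr_sg g10 /=; lra.
Qed.

(** Restriction to the line through [x] in direction [i] turns a partial derivative into a
    univariate one, so that [deriv0_of_local_min] suffices for critical points. *)
Lemma mmap_deriv (A : comNzRingType) (k : nat) (phi : {rmorphism A -> R})
    (x : 'I_k -> R) (p : {mpoly A[k]}) (i : 'I_k) :
  exists2 r : {poly R},
    forall t, r.[t] = mmap phi (fun j => x j + (j == i)%:R * t) p
  & r^`().[0] = \sum_(m <- msupp p) phi p@_m * (m i)%:R * mmap1 x (m - U_(i))%MM.
Proof.
pose y (j : 'I_k) : {poly R} := (x j)%:P + (j == i)%:R *: 'X.
exists (\sum_(m <- msupp p) (phi p@_m)%:P * mmap1 y m).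
  move=> t; rewrite horner_sum /mmap; apply: eq_bigr => m _.
  rewrite hornerM hornerC; congr (_ * _); rewrite /mmap1 horner_prod.
  apply: eq_bigr => j _; rewrite horner_exp /y hornerD hornerC hornerZ hornerX.
  by [].
rewrite raddf_sum /= horner_sum; apply: eq_bigr => m _.
rewrite derivM derivC mul0r add0r hornerM hornerC -mulrA; congr (_ * _).
have -> : mmap1 y m = ((x i)%:P + 'X) ^+ m i *
    (\prod_(j | j != i) x j ^+ m j)%:P.
  rewrite /mmap1 (bigD1 i) //= /y eqxx scale1r; congr (_ * _).
  rewrite rmorph_prod /=; apply: eq_bigr => j /negbTE ->.
  by rewrite scale0r addr0 rmorphXn.
rewrite derivM derivC mulr0 addr0 hornerM hornerC deriv_exp derivD derivC derivX.
rewrite add0r mul1r hornerMn horner_exp hornerD hornerC hornerX addr0.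
rewrite -mulr_natl -mulrA; congr (_ * _).
rewrite /mmap1 [RHS](bigD1 i) //= mnmBE mnm1E eqxx subn1; congr (_ * _).
apply: eq_bigr => j ji; rewrite mnmBE mnm1E eq_sym (negbTE ji).
by rewrite subn0.
Qed.

Lemma polyfun_mmap (J : Type) (A : idomainType) (psi : {rmorphism A -> R}) k
    (p : {mpoly {poly A}[k]}) (x : 'I_k -> (J -> R) -> R) (u : (J -> R) -> R) :
  (forall i, polyfun (x i)) -> polyfun u ->
  polyfun (fun z => mmap (evp psi (u z)) (fun i => x i z) p).
Proof.
move=> px pu; apply: pf_sum => m; apply: pf_mul.
  exact: polyfun_horner.
by apply: pf_prod => i; apply: pf_exp.
Qed.

(** Dividing P(u', eta) = 0 by the top power of eta bounds the leading coefficient at u' by [C] /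
    eta, where [C] controls the other coefficients near [u]. Let eta tend to infinity and u' to
    [u]. *)
Lemma lead_coef_limit (E : idomainType) (psi : {rmorphism E -> R})
    (P : {poly {poly E}}) (u : R) :
  (forall M e, 0 < e -> exists eta u', [/\ M < eta, `|u' - u| < e &
     evp (evp psi u') eta P = 0]) ->
  evp psi u (lead_coef P) = 0.
Proof.
move=> HP; apply/eqP/negPn/negP => a0.
pose f c (z : unit -> R) := evp psi (z tt) c.
have pf c : polyfun (f c) by apply: polyfun_horner; apply: pf_var.
pose a := evp psi u (lead_coef P).
pose C := \sum_(i < (size P).-1) (`|evp psi u P`_i| + 1).
have an : 0 < `|a| / 2 by rewrite divr_gt0 // normr_gt0.
have [d d0 Hd] := polyfun_cont (pf (lead_coef P)) (fun=> u) an.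
have [d' d'0 Hd'] : exists2 d', 0 < d' & forall (i : 'I_(size P).-1) u',
    `|u' - u| < d' -> `|evp psi u' P`_i| <= `|evp psi u P`_i| + 1.
  apply: (@fin_pos R 'I_(size P).-1 (fun i d => forall u',
    `|u' - u| < d -> `|evp psi u' P`_i| <= `|evp psi u P`_i| + 1)).
    by move=> l c c' c0 cc' H u' Hu; apply: H; apply: lt_le_trans cc'.
  move=> i; have [c c0 Hc] := polyfun_cont (pf P`_i) (fun=> u) ltr01.
  exists c => // u' Hu; have := Hc (fun=> u') (fun=> Hu); rewrite /f => H.
  have := ler_normD (evp psi u P`_i) (evp psi u' P`_i - evp psi u P`_i).
  rewrite addrC subrK; lra.
have e0 : 0 < Num.min d d' by rewrite lt_min d0 d'0.
have [eta [u' [Meta Hu HPu]]] := HP (Num.max 1 (C / (`|a| / 2))) _ e0.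
have ud : `|u' - u| < d by apply: lt_le_trans Hu (min_lel _ _).
have ud' : `|u' - u| < d' by apply: lt_le_trans Hu (min_ler _ _).
have eta1 : 1 <= eta by apply: ltW; apply: le_lt_trans Meta; rewrite le_max lexx.
have etaC : C < eta * (`|a| / 2).
  by rewrite -ltr_pdivrMr //; apply: le_lt_trans Meta; rewrite le_max lexx orbT.
have P0 : P != 0.
  by apply: contraNneq a0 => ->; rewrite lead_coef0 rmorph0.
have sP : (0 < size P)%N by rewrite size_poly_gt0.
pose n := (size P).-1.
move: HPu; rewrite /(evp _ eta) /= /horner_eval (@horner_coef_wide _ (size P)); last first.
  exact: size_poly.
rewrite -(prednK sP) big_ord_recr /= coef_map /= -/n.
move/eqP; rewrite addrC addr_eq0 => /eqP Hn.
have la : `|a| / 2 < `|evp psi u' P`_n|.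
  have := Hd (fun=> u') (fun=> ud); rewrite /f -/a /lead_coef -/n => H.
  have := ler_normB (evp psi u' P`_n) (evp psi u' P`_n - a).
  by rewrite opprB addrC subrK; lra.
have : `|evp psi u' P`_n| * eta ^+ n.+1 <= C * eta ^+ n.
  have eta0 : 0 < eta by lra.
  rewrite exprSr mulrA -[X in _ * X * _](gtr0_norm (exprn_gt0 _ eta0)) -normrM.
  rewrite Hn normrN; apply: le_trans (_ : _ <= \sum_(i < n) 
     `|(map_poly (evp psi u') P)`_i * eta ^+ i| * eta) _.
    by rewrite -mulr_suml ler_pM2r //; apply: ler_norm_sum.
  rewrite /C -/n mulr_suml; apply: ler_sum => i _.
  rewrite coef_map /= normrM -mulrA; apply: ler_pM => //.
  - by rewrite mulr_ge0 // ltW.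
  - exact: Hd'.
  rewrite gtr0_norm ?exprn_gt0 // -exprSr.
  by rewrite ler_weXn2l.
have en : 0 < eta ^+ n by rewrite exprn_gt0 //; lra.
rewrite exprSr mulrA mulrAC ler_pM2r // leNgt => /negP; apply.
apply: lt_trans etaC _; rewrite mulrC ltr_pM2r //; lra.
Qed.

Variables (E : idomainType) (psi : {rmorphism E -> R}) (k d : nat) (L : finType).
Variable F : L -> {mpoly {poly E}[k]}.
Hypothesis degF : forall l, (msize (F l) <= d.+1)%N.
Variable S : (option 'I_k -> R) -> Prop.

(** The coordinate [None] is the minimised one, u. It is absorbed into the coefficient ring as the
    variable of [{poly E}], so elimination concerns only the [k] coordinates [Some i]. *)
Definition point_eval (z : option 'I_k -> R) (p : {mpoly {poly E}[k]}) : R :=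
  mmap (evp psi (z None)) (fun i => z (Some i)) p.

Definition sum_sqr (I : {set L}) : {mpoly {poly E}[k]} := \sum_(l in I) F l ^+ 2.

Lemma deg_sum_sqr (I : {set L}) m : m \in msupp (sum_sqr I) ->
  (mdeg m < (2 * d).+1)%N.
Proof.
have : (msize (sum_sqr I) <= (2 * d).+1)%N; last first.
  by move=> H /msize_mdeg_lt mH; apply: leq_trans H.
apply: leq_trans (msize_sum _ _ _) _; apply/bigmax_leqP => l _.
have [->|F0] := eqVneq (F l) 0; first by rewrite expr0n msize0.
have := degF l; rewrite expr2 msizeM //; move: (msize (F l)) => n Hn.
by lia.
Qed.

Hypothesis dS : definable S.
Hypothesis cS : closedS S.
Hypothesis bS : boundedS S.
Hypothesis nS : exists z, S z.
Hypothesis locS : forall z z', S z ->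
  (forall l, Num.sg (point_eval z' (F l)) = Num.sg (point_eval z (F l))) -> S z'.

Let D := (2 * d).+1.

(** No Lagrange multiplier is needed: a local minimum of u on {eta q <= h} is a zero and a local
    minimum of eta q - h on the slice of constant u, whence both critical equations. The set [I] is
    found before [P] is given, so a determinant fixed in advance for each [I] can be used. *)
Lemma critical_value : exists p, [/\ S p, forall z, S z -> p None <= z None &
  exists I : {set L}, forall P : {poly {poly E}},
     (forall phi (eta : R) x, crit1 (2 * d) (sum_sqr I) phi eta x ->
        crit2 (2 * d) (sum_sqr I) phi eta x -> evp phi eta P = 0) ->
     evp psi (p None) (lead_coef P) = 0].
Proof.
pose h (z : option 'I_k -> R) := D.+1%:R^-1 * (\sum_i z (Some i) ^+ D.+1) + 1.
have pF l : polyfun (fun z => point_eval z (F l)).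
  by apply: polyfun_mmap => [i|]; apply: pf_var.
have ph : polyfun h.
  apply: pf_add; last exact: pf_const.
  apply: pf_mul; first exact: pf_const.
  by apply: pf_sum => i; apply: pf_exp; apply: pf_var.
have h0 z : 0 < h z.
  rewrite ltr_wpDl // mulr_ge0 ?invr_ge0 // sumr_ge0 // => i _.
  by rewrite exprn_even_ge0 // /D /= negbK mul2n odd_double.
have [p [Sp minp Hp]] := critical_approx None pF ph h0 dS cS bS nS locS.
pose I := [set l | point_eval p (F l) == 0].
exists p; split=> //; exists I => P HP; apply: lead_coef_limit => M e e0.
have [eta [z [r [Meta eta0 zp r0 [qz Hz]]]]] := Hp M e e0.
exists eta, (z None); split=> //.
set q := sum_sqr I in HP.
have qE z' : \sum_(l | point_eval p (F l) == 0) point_eval z' (F l) ^+ 2 =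
    point_eval z' q.
  rewrite /point_eval /q /sum_sqr raddf_sum /=.
  apply: eq_big => l; first by rewrite inE.
  by move=> _; rewrite rmorphXn.
rewrite qE in qz.
pose Phi z' := eta * point_eval z' q - h z'.
have pPhi : polyfun Phi.
  apply: pf_sub => //; apply: pf_mul; first exact: pf_const.
  by apply: polyfun_mmap => [i|]; apply: pf_var.
(* Were [Phi] negative at [z'], lowering the u-coordinate of [z'] slightly would keep it negative
   and stay near [z], giving a feasible point with u below that of [z]. *)
have Phi_ge0 z' : near_pt r z' z -> z' None <= z None -> 0 <= Phi z'.
  move=> zz' zN; rewrite leNgt; apply/negP => Pz'.
  have nP : 0 < - Phi z' by lra.
  have [c c0 Hc] := polyfun_cont pPhi z' nP.
  have zr := zz' None.
  pose g := r - `|z' None - z None|.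
  have g0 : 0 < g by rewrite /g; lra.
  pose t := Num.min c g / 2.
  have m0 : 0 < Num.min c g by rewrite lt_min c0 g0.
  have tc : t < c by have := min_lel c g; rewrite /t; lra.
  have tg : t < g by have := min_ler c g; rewrite /t; lra.
  have t0 : 0 < t by rewrite /t; lra.
  pose w (o : option 'I_k) := if o is Some i then z' (Some i) else z' None - t.
  have wz' : near_pt c w z'.
    move=> [i|]; rewrite /w ?subrr ?normr0 //.
    by rewrite addrAC subrr sub0r normrN gtr0_norm.
  have wz : near_pt r w z.
    move=> [i|]; first exact: zz'.
    rewrite /w; have := ler_normB (z' None - z None) t.
    have -> : z' None - z None - t = z' None - t - z None by ring.
    by rewrite (gtr0_norm t0) /g in tg *; lra.
  have Pw : Phi w < 0.
    by have := Hc w wz'; rewrite ltr_norml => /andP[_]; lra.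
  have := Hz w wz; rewrite qE => /(_ _).
  have -> : eta * point_eval w q <= h w by rewrite /Phi in Pw; lra.
  by move=> /(_ isT); rewrite /w; lra.
have zz : near_pt r z z by move=> j; rewrite subrr normr0.
have Phi0 : Phi z = 0.
  by apply/eqP; rewrite eq_le Phi_ge0 // andbT /Phi; lra.
pose x i := z (Some i).
have D1 : D.+1%:R != 0 :> R by rewrite pnatr_eq0.
have C1 : crit1 (2 * d) q (evp psi (z None)) eta x.
  move=> i; have [rq rqE rq'] := mmap_deriv (evp psi (z None)) x q i.
  pose cst := D.+1%:R^-1 * (\sum_(j | j != i) x j ^+ D.+1) + 1.
  pose g := eta *: rq - (D.+1%:R^-1 *: ((x i)%:P + 'X) ^+ D.+1 + cst%:P).
  pose zt t (o : option 'I_k) :=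
    if o is Some j then x j + (j == i)%:R * t else z None.
  have gE t : g.[t] = Phi (zt t).
    rewrite /g /Phi hornerD hornerN !hornerZ rqE; congr (_ - _).
    rewrite hornerD hornerZ hornerC horner_exp hornerD hornerC hornerX /h /cst.
    rewrite [in RHS](bigD1 i) //= eqxx mul1r mulrDr -addrA; congr (_ + (_ + _)).
    by congr (_ * _); apply: eq_bigr => j /negbTE ->; rewrite mul0r addr0.
  have zt0 : zt 0 = z.
    by apply/funext=> -[j|] //=; rewrite mulr0 addr0.
  have := @deriv0_of_local_min g r r0.
  rewrite gE zt0 Phi0 => /(_ erefl) H.
  have : g^`().[0] = 0.
    apply: H => t tr; rewrite gE; apply: Phi_ge0 => // -[j|] /=.
      rewrite /x addrAC subrr add0r; case: (j == i); rewrite ?mul1r //.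
      by rewrite mul0r normr0.
    by rewrite subrr normr0.
  rewrite /g derivB derivD !derivZ derivC addr0 deriv_exp derivD derivC derivX.
  rewrite add0r mul1r hornerD hornerN !hornerZ rq' hornerMn horner_exp hornerD.
  rewrite hornerC hornerX addr0 -[_ ^+ _ *+ _]mulr_natl mulrA mulVf // mul1r => /eqP.
  by rewrite subr_eq0 => /eqP <-.
apply: HP (C1) _.
have := Phi0; rewrite /Phi /h /point_eval /mmap.
set fq := \sum_(m <- _) _; rewrite -/x => Hf.
have E1 : D.+1%:R * (eta * fq) = \sum_i x i ^+ D.+1 + D.+1%:R.
  have -> : eta * fq = D.+1%:R^-1 * (\sum_i x i ^+ D.+1) + 1.
    by apply/eqP; rewrite -subr_eq0 Hf.
  by rewrite mulrDr mulrA mulfV // mul1r mulr1.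
have E2 : \sum_i x i ^+ D.+1 = eta * \sum_(m <- msupp q)
    evp psi (z None) q@_m * (mdeg m)%:R * mmap1 x m.
  transitivity (\sum_i \sum_(m <- msupp q) eta *
      (evp psi (z None) q@_m * (m i)%:R * mmap1 x m)).
    apply: eq_bigr => i _; rewrite exprS C1 mulrCA big_distrr /= big_distrr /=.
    apply: eq_bigr => m _; congr (_ * _).
    have [->|mi] := posnP (m i); first by rewrite !mulr0 !mul0r mulr0.
    rewrite mulrCA; congr (_ * _).
    have mE : m = (U_(i) + (m - U_(i)))%MM.
      by rewrite addmC submK // lep1mP -lt0n.
    by rewrite {2}mE mmap1M mmap1U.
  rewrite exchange_big /= big_distrr /=; apply: eq_bigr => m _.
  by rewrite -big_distrr /= -mulr_suml -mulr_sumr -natr_sum -mdegE.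
rewrite /crit2 -/D.
have -> : \sum_(m <- msupp q) evp psi (z None) q@_m * (D.+1 - mdeg m)%:R *
    mmap1 x m = D.+1%:R * fq - \sum_(m <- msupp q)
    evp psi (z None) q@_m * (mdeg m)%:R * mmap1 x m.
  rewrite /fq big_distrr /= -sumrB !big_seq; apply: eq_bigr => m mq.
  rewrite natrB; first by ring.
  by have := deg_sum_sqr mq; rewrite -/D => /ltnW/leqW.
rewrite mulrBr -E2 mulrCA E1; ring.
Qed.

End CriticalValues.

(** * Degree filtrations and l1-norms on nested polynomial rings *)

Section Lifts.

Lemma rmorph_mmap (A S T : comNzRingType) (k : nat) (f : A -> S)
    (h : 'I_k -> S) (g : {rmorphism S -> T}) (p : {mpoly A[k]}) :
  g (mmap f h p) = mmap (g \o f) (g \o h) p.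
Proof.
rewrite /mmap rmorph_sum; apply: eq_bigr => m _; rewrite rmorphM; congr (_ * _).
by rewrite /mmap1 rmorph_prod; apply: eq_bigr => i _; rewrite rmorphXn.
Qed.

(** The new variable has weight 0. Nested over the degree in s, these filtrations count the degree
    in s alone. *)
Definition polyfil (T : comNzRingType) (B : nat -> T -> Prop) (a : nat)
  (p : {poly T}) := forall i, B a p`_i.

Definition mpolyfil (T : comNzRingType) k (B : nat -> T -> Prop) (a : nat)
  (p : {mpoly T[k]}) := forall m, B a p@_m.

Lemma degfil_size (T : idomainType) :
  degfil (fun a (p : {poly T}) => (size p <= a.+1)%N).
Proof.
split.
- by move=> a; rewrite size_poly0.
- by rewrite size_poly1.
- by move=> a x y xa ya; apply: leq_trans (size_polyD _ _) _; rewrite geq_max xa.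
- by move=> a x; rewrite size_polyN.
- move=> a b x y xa yb; apply: leq_trans (size_polyMleq _ _) _; lia.
- by move=> a b x ab xa; apply: leq_trans xa _.
Qed.

Lemma degfil_msize (T : idomainType) k :
  degfil (fun a (p : {mpoly T[k]}) => (msize p <= a.+1)%N).
Proof.
split.
- by move=> a; rewrite msize0.
- by rewrite msize1.
- by move=> a x y xa ya; apply: leq_trans (msizeD_le _ _) _; rewrite geq_max xa.
- by move=> a x; rewrite msizeN.
- move=> a b x y; have [->|x0] := eqVneq x 0; first by rewrite mul0r msize0.
  have [->|y0] := eqVneq y 0; first by rewrite mulr0 msize0.
  by rewrite msizeM //; move: (msize x) (msize y) => i j; lia.
- by move=> a b x ab xa; apply: leq_trans xa _.
Qed.

Lemma degfil_poly (T : comNzRingType) (B : nat -> T -> Prop) :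
  degfil B -> degfil (polyfil B).
Proof.
move=> fB; split.
- by move=> a i; rewrite coef0; apply: degfil0.
- move=> i; rewrite coef1; case: (i == _); [exact: degfil1 | exact: degfil0].
- by move=> a x y Bx By i; rewrite coefD; apply: degfilD.
- by move=> a x Bx i; rewrite coefN; apply: degfilN.
- move=> a b x y Bx By i; rewrite coefM; apply: degfil_sum => // j _.
  exact: degfilM.
- by move=> a b x ab Bx i; apply: degfilW ab _.
Qed.

Lemma degfil_mpoly (T : comNzRingType) k (B : nat -> T -> Prop) :
  degfil B -> degfil (@mpolyfil T k B).
Proof.
move=> fB; split.
- by move=> a m; rewrite mcoeff0; apply: degfil0.
- move=> m; rewrite mcoeff1; case: (m == _); [exact: degfil1 | exact: degfil0].
- by move=> a x y Bx By m; rewrite mcoeffD; apply: degfilD.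
- by move=> a x Bx m; rewrite mcoeffN; apply: degfilN.
- move=> a b x y Bx By m; rewrite mcoeffM; apply: degfil_sum => // j _.
  exact: degfilM.
- by move=> a b x ab Bx m; apply: degfilW ab _.
Qed.

Lemma degfil_mmap (A T : comNzRingType) (B : nat -> T -> Prop) k d e
    (f : A -> T) (h : 'I_k -> T) (p : {mpoly A[k]}) :
  degfil B -> (forall c, B 0%N (f c)) -> (forall i, B e (h i)) ->
  (msize p <= d.+1)%N -> B (d * e)%N (mmap f h p).
Proof.
move=> fB Bf Bh pd; rewrite /mmap big_seq; apply: degfil_sum => // m mp.
rewrite -[(d * e)%N]add0n; apply: degfilM => //.
have md : (mdeg m <= d)%N by rewrite -ltnS (leq_trans (msize_mdeg_lt mp)).
apply: (degfilW fB (leq_mul md (leqnn e))); rewrite mdegE big_distrl /mmap1 /=.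
elim/big_ind2: _ => [|x a y b Hx Hy|i _]; first exact: degfil1.
  exact: degfilM.
elim: (m i) => [|c IHc]; first exact: degfil1.
by rewrite exprS mulSn; apply: degfilM.
Qed.

Definition polynorm (T : comNzRingType) (nu : T -> nat) (p : {poly T}) : nat :=
  (\sum_(i < size p) nu (p`_i)%R)%N.

Definition mpolynorm (T : comNzRingType) k (nu : T -> nat) (p : {mpoly T[k]}) :=
  (\sum_(m <- msupp p) nu p@_m)%N.

Section PolyNorm.
Variables (T : comNzRingType) (nu : T -> nat).
Hypothesis fnu : seminorm nu.

Lemma polynorm_wide (p : {poly T}) n : (size p <= n)%N ->
  polynorm nu p = (\sum_(i < n) nu (p`_i)%R)%N.
Proof.
move=> pn; rewrite /polynorm (big_ord_widen _ (fun i => nu (p`_i)%R) pn).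
rewrite big_mkcond; apply: eq_bigr => i _; case: ltnP => // si.
by rewrite nth_default // seminorm0.
Qed.

Lemma polynormC c : polynorm nu c%:P = nu c.
Proof.
rewrite (polynorm_wide (n := 1)); last exact: size_polyC_leq1.
by rewrite big_ord1 coefC.
Qed.

Lemma polynormMX p : polynorm nu (p * 'X)%R = polynorm nu p.
Proof.
have [->|p0] := eqVneq p 0; first by rewrite mul0r.
rewrite /polynorm size_mulX // big_ord_recl coefMX /= seminorm0 // add0n.
by apply: eq_bigr => i _; rewrite coefMX.
Qed.

Lemma polynormMXaddC p c : polynorm nu (p * 'X + c%:P)%R = (polynorm nu p + nu c)%N.
Proof.
have sp : (size (p * 'X + c%:P)%R <= (size p).+1)%N.
  apply: leq_trans (size_polyD _ _) _; rewrite geq_max.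
  rewrite (leq_trans (size_polyMleq _ _)) ?size_polyX ?addn2 //=.
  exact: leq_trans (size_polyC_leq1 _) _.
rewrite (polynorm_wide sp) big_ord_recl addnC; congr (_ + _)%N.
  by apply: eq_bigr => i _; rewrite coefD coefMX coefC addr0.
by rewrite coefD coefMX coefC add0r.
Qed.

Lemma polynormD p q : (polynorm nu (p + q)%R <= polynorm nu p + polynorm nu q)%N.
Proof.
rewrite (polynorm_wide (size_polyD p q)).
rewrite (polynorm_wide (leq_maxl (size p) (size q))).
rewrite (polynorm_wide (leq_maxr (size p) (size q))) -big_split /=.
by apply: leq_sum => i _; rewrite coefD; apply: seminormD.
Qed.

Lemma polynormCM c p : (polynorm nu (c%:P * p)%R <= nu c * polynorm nu p)%N.
Proof.
have sp : (size (c%:P * p)%R <= size p)%N.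
  by rewrite mul_polyC; apply: size_scale_leq.
rewrite (polynorm_wide sp) /polynorm big_distrr /=; apply: leq_sum => i _.
by rewrite coefCM; apply: seminormM.
Qed.

Lemma seminorm_poly : seminorm (polynorm nu).
Proof.
split.
- by rewrite /polynorm size_poly0 big_ord0.
- by rewrite polynormC; apply: seminorm1.
- exact: polynormD.
- by move=> p; rewrite /polynorm size_polyN; apply: eq_bigr => i _;
    rewrite coefN seminormN.
- move=> p q; elim/poly_ind: p => [|p c IHp].
    by rewrite mul0r /polynorm size_poly0 !big_ord0.
  rewrite mulrDl polynormMXaddC mulnDl.
  apply: leq_trans (polynormD _ _) (leq_add _ (polynormCM _ _)).
  by rewrite mulrAC polynormMX.
Qed.

Lemma polynormX : (polynorm nu 'X <= 1)%N.
Proof.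
rewrite -['X]mul1r polynormMX (_ : 1 = 1%:P) // polynormC.
exact: seminorm1.
Qed.

Lemma polynorm_coef (p : {poly T}) i : (nu (p`_i)%R <= polynorm nu p)%N.
Proof.
have [ip|pi] := ltnP i (size p); last by rewrite nth_default // seminorm0.
by rewrite /polynorm (bigD1 (Ordinal ip)) //= leq_addr.
Qed.

Variable k : nat.
Local Notation mnorm := (@mpolynorm T k nu).

Lemma mpolynorm_wide (p : {mpoly T[k]}) b : (msize p <= b)%N ->
  mnorm p = (\sum_(m : 'X_{1..k < b}) nu p@_m)%N.
Proof.
move=> pb; rewrite /mpolynorm.
pose I : subFinType _ := 'X_{1..k < b}.
rewrite (ssrcomplements.big_mksub I) ?msupp_uniq //=; last first.
  by move=> x /msize_mdeg_lt /leq_trans; apply.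
by rewrite big_rmcond //= => j /memN_msupp_eq0 ->; rewrite seminorm0.
Qed.

Lemma mpolynormD p q : (mnorm (p + q)%R <= mnorm p + mnorm q)%N.
Proof.
pose b := maxn (msize p) (msize q).
rewrite (mpolynorm_wide (b := b)); last exact: msizeD_le.
rewrite (mpolynorm_wide (leq_maxl _ (msize q))).
rewrite (mpolynorm_wide (leq_maxr (msize p) _)) -big_split /=.
by apply: leq_sum => i _; rewrite mcoeffD; apply: seminormD.
Qed.

Lemma mpolynormZ c p : (mnorm (c *: p)%R%R <= nu c * mnorm p)%N.
Proof.
have sp : (msize (c *: p)%R <= msize p)%N by exact: msizeZ_le.
rewrite (mpolynorm_wide sp) (mpolynorm_wide (leqnn (msize p))) big_distrr /=.
by apply: leq_sum => i _; rewrite mcoeffZ; apply: seminormM.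
Qed.

Lemma mpolynormMX p m : mnorm (p * 'X_[m])%R = mnorm p.
Proof.
rewrite /mpolynorm (perm_big _ (msuppMX p m)) big_map.
by apply: eq_bigr => m' _; rewrite mcoeffMX.
Qed.

Lemma mpolynorm_sum (I : Type) (r : seq I) (P : pred I) (F : I -> {mpoly T[k]}) :
  (mnorm (\sum_(i <- r | P i) F i)%R <= \sum_(i <- r | P i) mnorm (F i))%N.
Proof.
elim/big_ind2: _ => [|x a y c Hx Hy|i _//].
  by rewrite /mpolynorm msupp0 big_nil.
by apply: leq_trans (mpolynormD _ _) (leq_add _ _).
Qed.

Lemma mpolynormC c : mnorm c%:MP = nu c.
Proof.
rewrite /mpolynorm msuppC; case: eqP => [->|_].
  by rewrite big_nil seminorm0.
by rewrite big_seq1 mcoeffC eqxx mulr1.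
Qed.

Lemma seminorm_mpoly : seminorm mnorm.
Proof.
split.
- by rewrite -(mpolyC0) mpolynormC seminorm0.
- by rewrite -(mpolyC1) mpolynormC; apply: seminorm1.
- exact: mpolynormD.
- move=> p; rewrite /mpolynorm (perm_big _ (msuppN p)).
  by apply: eq_bigr => m _; rewrite mcoeffN seminormN.
- move=> p q; rewrite [in (p * q)%R](mpolyE p) mulr_suml.
  apply: leq_trans (mpolynorm_sum _ _ _) _.
  rewrite {2}/mpolynorm big_distrl /=; apply: leq_sum => m _.
  rewrite -scalerAl; apply: leq_trans (mpolynormZ _ _) _.
  by rewrite mulrC mpolynormMX.
Qed.

Lemma mpolynormX m : (mnorm 'X_[m] <= 1)%N.
Proof.
rewrite -['X_[m]]mul1r mpolynormMX -mpolyC1 mpolynormC.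
exact: seminorm1.
Qed.

End PolyNorm.

Lemma seminorm_mmap (A T : comNzRingType) (nu : T -> nat) k
    (f : A -> T) (h : 'I_k -> T) (p : {mpoly A[k]}) :
  seminorm nu -> (forall i, nu (h i) <= 1)%N ->
  (nu (mmap f h p) <= \sum_(m <- msupp p) nu (f p@_m))%N.
Proof.
move=> fnu Hh; apply: leq_trans (seminorm_sum fnu _ _ _) _.
apply: leq_sum => m _; apply: leq_trans (seminormM fnu _ _) _.
rewrite -[X in (_ <= X)%N]muln1 leq_mul2l; apply/orP; right.
rewrite /mmap1; elim/big_ind: _ => [|x y Hx Hy|i _]; first exact: seminorm1.
  apply: leq_trans (seminormM fnu _ _) _.
  by rewrite -[1%N]mul1n; apply: leq_mul.
elim: (m i) => [|e IHe]; first exact: seminorm1.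
rewrite exprS; apply: leq_trans (seminormM fnu _ _) _.
by rewrite -[1%N]mul1n; apply: leq_mul.
Qed.

Lemma seminorm_absz : seminorm (fun c : int => absz c).
Proof.
split=> // [x y|x|x y]; first by lia.
  by rewrite abszN.
by rewrite abszM.
Qed.

End Lifts.

(** * The level sets of the graph of (f, g) *)

Section GraphMinimum.
Variables (R : rcfType) (K : idomainType) (iota : {rmorphism K -> R}).
Variables (n d : nat) (Q : seq {mpoly K[n.+1]}).
Hypothesis d_gt1 : (2 <= d)%N.
Hypothesis degQ : deg_le d Q.

Local Notation E := {poly K}.
Local Notation QR := (map (map_mpoly iota) Q).

Definition lift_coef : K -> {mpoly {poly E}[n.+1]} :=
  @mpolyC n.+1 {poly E} \o (polyC \o polyC).

HB.instance Definition _ := GRing.RMorphism.copy lift_coef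
  (@mpolyC n.+1 {poly E} \o (polyC \o polyC)).

(* The graph coordinate Y of Q(X, Y) is replaced by w; the last of the n.+1
   variables is now the value of |g|, while the value of |f| is the polynomial
   variable of {poly E} and the level s that of E. *)
Definition subst_last (w : {mpoly {poly E}[n.+1]}) (p : {mpoly K[n.+1]}) :
    {mpoly {poly E}[n.+1]} :=
  mmap lift_coef (fun j => if j == ord_max then w else 'X_j) p.

(** For each member of [Q]: which of u, v replaces Y, and with which sign, as u and v agree with f
    and g only up to sign. The two further indices stand for u and v - s. *)
Definition Lidx := ('I_(size Q) * bool * bool + bool)%type.

Definition Ufam (l : Lidx) : {mpoly {poly E}[n.+1]} :=
  match l with
  | inl (i, isU, sgn) =>
      subst_last ((-1) ^+ sgn * (if isU then 'X%:MP else 'X_ord_max)) (Q`_i)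
  | inr true => 'X%:MP
  | inr false => 'X_ord_max - ('X%:P)%:MP
  end.

Definition xpart (z : option 'I_n.+1 -> R) (i : 'I_n) : R :=
  z (Some (lift ord_max i)).

Lemma meval_map_mpoly (v : 'I_n.+1 -> R) (p : {mpoly K[n.+1]}) :
  (map_mpoly iota p).@[v] = mmap iota v p.
Proof.
rewrite /map_mpoly [LHS]rmorph_mmap; apply: eq_bigr => m _; congr (_ * _).
  by rewrite /= mevalC.
by apply: mmap1_eq => i; rewrite /= mevalXU.
Qed.

Lemma point_eval_subst s (z : option 'I_n.+1 -> R) w p :
  point_eval (evp iota s) z (subst_last w p) =
  (map_mpoly iota p).@[ext_pt (xpart z) (point_eval (evp iota s) z w)].
Proof.
rewrite meval_map_mpoly /point_eval /subst_last rmorph_mmap.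
apply: eq_bigr => m _; congr (_ * _).
  by rewrite /= /lift_coef /comp mmapC /= evpC /= evpC.
apply: mmap1_eq => i /=; rewrite /ext_pt /xpart.
case: unliftP => [j ->|->].
  by rewrite eq_sym (negbTE (neq_lift _ _)) mmapX mmap1U.
by rewrite eqxx.
Qed.

Lemma point_eval_U s (z : option 'I_n.+1 -> R) :
  point_eval (evp iota s) z 'X%:MP = z None.
Proof. by rewrite /point_eval mmapC /= evpX. Qed.

Lemma point_eval_V s (z : option 'I_n.+1 -> R) :
  point_eval (evp iota s) z 'X_ord_max = z (Some ord_max).
Proof. by rewrite /point_eval mmapX mmap1U. Qed.

Lemma point_eval_Vs s (z : option 'I_n.+1 -> R) :
  point_eval (evp iota s) z ('X_ord_max - ('X%:P)%:MP) = z (Some ord_max) - s.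
Proof.
by rewrite /point_eval rmorphB /= mmapX mmap1U mmapC /= evpC /= evpX.
Qed.

Lemma point_eval_signed s (z : option 'I_n.+1 -> R) (b sgn : bool) :
  point_eval (evp iota s) z ((-1) ^+ sgn * (if b then 'X%:MP else 'X_ord_max)) =
  (-1) ^+ sgn * (if b then z None else z (Some ord_max)).
Proof.
rewrite /point_eval rmorphM rmorphXn rmorphN1; congr (_ * _).
by case: b; [exact: point_eval_U | exact: point_eval_V].
Qed.

Lemma nth_mem_Q (i : 'I_(size Q)) : Q`_i \in Q.
Proof. exact: mem_nth. Qed.

Lemma msize_Ufam l : (msize (Ufam l) <= d.+1)%N.
Proof.
have fB := @degfil_msize {poly E} n.+1.
have B1 a : (msize (a%:MP : {mpoly {poly E}[n.+1]}) <= 1)%N.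
  by rewrite msizeC leq_b1.
have BX : (msize ('X_ord_max : {mpoly {poly E}[n.+1]}) <= 2)%N.
  by rewrite msizeX mdeg1.
case: l => [[[i b] sgn]|[]] /=.
- have -> : d.+1 = (d * 1).+1 by rewrite muln1.
  apply: (degfil_mmap fB (d := d) (e := 1)) => [c|j|]; first exact: B1.
    case: (_ == _); last by rewrite msizeX mdeg1.
    rewrite -[2%N]/(0 + 1).+1; apply: (degfilM fB).
      case: sgn; rewrite ?expr1 ?expr0; last exact: (degfil1 fB).
      by apply: (degfilN fB); apply: (degfil1 fB).
    by case: b => //; apply: leq_trans (B1 _) _.
  exact: degQ (nth_mem_Q i).
- exact: leq_trans (B1 _) _.
- apply: (degfilW fB (a := 1)); first exact: ltnW.
  apply: (degfilD fB) => //; apply: (degfilN fB).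
  exact: leq_trans (B1 _) _.
Qed.

Lemma polyfun_meval (J : Type) k (p : {mpoly R[k]}) (w : 'I_k -> (J -> R) -> R) :
  (forall i, polyfun (w i)) -> polyfun (fun z => p.@[fun i => w i z]).
Proof.
move=> pw; apply: pf_sum => m; apply: pf_mul; first exact: pf_const.
by apply: pf_prod => i; apply: pf_exp.
Qed.

Lemma definable_holds (J : finType) k (phi : qf_formula {mpoly R[k]})
    (w : 'I_k -> (J -> R) -> R) :
  (forall i, polyfun (w i)) -> definable (fun z => holds (fun i => w i z) phi).
Proof.
move=> pw; elim: phi => [|p|p|p|phi IH|phi1 IH1 phi2 IH2|phi1 IH1 phi2 IH2] /=.
- exact: def_cst.
- by apply: def_eq; [apply: polyfun_meval | apply: pf_const].
- by apply: def_lt; [apply: pf_const | apply: polyfun_meval].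
- by apply: def_lt; [apply: polyfun_meval | apply: pf_const].
- exact: def_not.
- exact: def_and.
- exact: def_or.
Qed.

Lemma polyfun_ext (J : Type) (x : 'I_n -> (J -> R) -> R) (y : (J -> R) -> R) :
  (forall i, polyfun (x i)) -> polyfun y ->
  forall i, polyfun (fun z => ext_pt (fun j => x j z) (y z) i).
Proof. by move=> px py i; rewrite /ext_pt; case: (unlift ord_max i). Qed.

Lemma definable_graph (J : finType) (phi : qf_formula {mpoly R[n.+1]})
    (x : 'I_n -> (J -> R) -> R) (y : (J -> R) -> R) :
  (forall i, polyfun (x i)) -> polyfun y ->
  definable (fun z => holds (ext_pt (fun j => x j z) (y z)) phi).
Proof.
move=> px py.
exact: (@definable_holds J n.+1 phi (fun i z => ext_pt (fun j => x j z) (y z) i)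
   (polyfun_ext px py)).
Qed.

Lemma holds_sg (v v' : 'I_n.+1 -> R) (phi : qf_formula {mpoly R[n.+1]}) :
  atoms_in QR phi ->
  (forall p, p \in Q -> Num.sg (map_mpoly iota p).@[v'] =
                        Num.sg (map_mpoly iota p).@[v]) ->
  holds v phi <-> holds v' phi.
Proof.
move=> Hphi sgE.
have sgE' p : p \in QR -> Num.sg p.@[v'] = Num.sg p.@[v].
  by move=> /mapP[p0 p0Q ->]; apply: sgE.
elim: phi Hphi => [|p|p|p|phi IH|phi1 IH1 phi2 IH2|phi1 IH1 phi2 IH2] //=.
- move=> /sgE' H; split=> /eqP; rewrite -sgr_eq0.
    by rewrite -H sgr_eq0 => /eqP.
  by rewrite H sgr_eq0 => /eqP.
- by move=> /sgE' H; rewrite -sgr_gt0 -H sgr_gt0.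
- by move=> /sgE' H; rewrite -sgr_lt0 -H sgr_lt0.
- by move=> /IH ->.
- by move=> [/IH1 -> /IH2 ->].
- by move=> [/IH1 -> /IH2 ->].
Qed.

Variables (A : ('I_n -> R) -> Prop) (f g : ('I_n -> R) -> R).
Hypothesis closedA : closed_set A.
Hypothesis boundedA : bounded_set A.
Hypothesis contf : continuous_on A f.
Hypothesis contg : continuous_on A g.
Hypothesis saf : semialg_fun QR A f.
Hypothesis sag : semialg_fun QR A g.

(** Formulas reach [h] only through its graph, hence the existential [y]. A cluster point of the
    sets where |h| > 1/e lies in [A] and contradicts continuity there. *)
Lemma fun_bounded (h : ('I_n -> R) -> R) : continuous_on A h ->
  semialg_fun QR A h -> exists M, forall x, A x -> `|h x| <= M.
Proof.
move=> conth [phi [_ Hphi]]; have [M HM] := boundedA.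
apply: contrapT => nb.
have [||||z Hz] := @definable_cluster R 'I_n (fun e x => exists y,
    holds (ext_pt x y) phi /\ (1 < e * y \/ 1 < - (e * y))) M.
- apply: def_exr; apply: def_and.
    by apply: definable_graph => [i|]; apply: pf_var.
  apply: def_or; apply: def_lt; try exact: pf_const.
    by apply: pf_mul; apply: pf_var.
  by apply: pf_opp; apply: pf_mul; apply: pf_var.
- move=> e e' x e0 ee' [y [Hy H]]; exists y; split=> //.
  case: H => H; [left | right].
    by have y0 : 0 < y; nra.
  by have y0 : y < 0; nra.
- move=> e e0; apply: contrapT => H; apply: nb; exists e^-1 => x Ax.
  rewrite leNgt; apply/negP => ex; apply: H; exists x, (h x).
  split; first by apply/Hphi.
  move: ex; rewrite -[e^-1]mulr1 ltr_pdivrMl //; have [h0|h0] := ger0P (h x).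
    by left.
  by rewrite mulrN; right.
- by move=> x [y [/Hphi[/HM Hx _] _]] j.
have Az : A z.
  apply: closedA => e /Hz[x [y [/Hphi[Ax _] _]] H]; by exists x.
have [c c0 Hc] := conth z Az 1 ltr01.
pose k := `|h z| + 1.
have k0 : 0 < k by rewrite /k; have := normr_ge0 (h z); lra.
have e0 : 0 < Num.min c k^-1 by rewrite lt_min c0 invr_gt0.
have [x [y [/Hphi[Ax ->] Hy]] xz] := Hz _ e0.
have hx : `|h x| < k.
  have := Hc x Ax (fun j => lt_le_trans (xz j) (min_lel _ _)).
  have := ler_normD (h x - h z) (h z); rewrite subrK /k; lra.
have : Num.min c k^-1 * `|h x| > 1.
  have := ler_norm (h x); have := ler_norm (- h x); rewrite normrN.
  by case: Hy => Hy ? ?; nra.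
have : Num.min c k^-1 * `|h x| <= k^-1 * `|h x|.
  by rewrite ler_wpM2r // min_ler.
have : k^-1 * `|h x| < 1 by rewrite ltr_pdivrMl // mulr1.
lra.
Qed.

(* u = z None is +-f(x), v = z (Some ord_max) is +-g(x); with flag, u = |f(x)|.
   Without it, minimising u amounts to maximising |f|. *)
Definition levelset (s : R) (flag : bool) (z : option 'I_n.+1 -> R) : Prop :=
  A (xpart z) /\
  ((f (xpart z) = z None \/ f (xpart z) = - z None) /\
   ((g (xpart z) = z (Some ord_max) \/ g (xpart z) = - z (Some ord_max)) /\
    (s <= z (Some ord_max) /\ (flag -> 0 <= z None)))).

Lemma pm_norm (a b : R) : a = b \/ a = - b <-> `|a| = `|b|.
Proof.
split=> [[->//|->]|/eqP]; first by rewrite normrN.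
by rewrite eqr_norm2 => /orP[/eqP|/eqP]; [left | right].
Qed.

Lemma definable_levelset s flag : definable (levelset s flag).
Proof.
have [phif [_ Hf]] := saf; have [phig [_ Hg]] := sag.
apply: (def_iff (S := fun z : option 'I_n.+1 -> R =>
  (holds (ext_pt (xpart z) (z None)) phif \/
   holds (ext_pt (xpart z) (- z None)) phif) /\
  ((holds (ext_pt (xpart z) (z (Some ord_max))) phig \/
    holds (ext_pt (xpart z) (- z (Some ord_max))) phig) /\
   (s <= z (Some ord_max) /\ (flag -> 0 <= z None))))).
  move=> z; rewrite -!Hf -!Hg /levelset.
  split.
    move=> [[[Ax ->]|[Ax ->]] [[[_ ->]|[_ ->]] H]];
      by do !split=> //; rewrite ?opprK; tauto.
  move=> [Ax [Hu [Hv H]]]; split; last split=> //.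
    by case: Hu => ->; [left|right]; split.
  by case: Hv => ->; [left|right]; split.
have px (i : 'I_n) : polyfun (fun z : option 'I_n.+1 -> R => xpart z i).
  exact: pf_var.
apply: def_and.
  by apply: def_or; apply: (definable_graph _ px);
    [apply: pf_var | apply: pf_opp; apply: pf_var].
apply: def_and.
  by apply: def_or; apply: (definable_graph _ px);
    [apply: pf_var | apply: pf_opp; apply: pf_var].
apply: def_and; first by apply: def_le; [apply: pf_const | apply: pf_var].
apply: def_imp; first exact: def_cst.
by apply: def_le; [apply: pf_const | apply: pf_var].
Qed.

Lemma closed_graph_norm (h : ('I_n -> R) -> R) (o : option 'I_n.+1)
    (T : (option 'I_n.+1 -> R) -> Prop) z : continuous_on A h ->
  (forall y, T y -> A (xpart y) /\ `|h (xpart y)| = `|y o|) ->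
  (forall e, 0 < e -> exists2 y, T y & near_pt e y z) -> A (xpart z) ->
  `|h (xpart z)| = `|z o|.
Proof.
move=> conth HT Hz Az; apply/eqP; rewrite -subr_eq0 -normr_eq0.
rewrite eq_le normr_ge0 andbT leNgt; apply/negP => e0.
set e := `| _ | in e0; have e2 : 0 < e / 2 by lra.
have [c c0 Hc] := conth _ Az _ e2.
have m0 : 0 < Num.min c (e / 2) by rewrite lt_min c0 e2.
have [y /HT[Ay hy] yz] := Hz _ m0.
have H1 : `|h (xpart y) - h (xpart z)| < e / 2.
  by apply: Hc => // i; apply: lt_le_trans (yz _) (min_lel _ _).
have H2 : `|y o - z o| < e / 2 by apply: lt_le_trans (yz _) (min_ler _ _).
have : e <= `|h (xpart y) - h (xpart z)| + `|y o - z o|.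
  rewrite {1}/e; have := ler_dist_dist (h (xpart y)) (h (xpart z)).
  have := ler_dist_dist (y o) (z o); rewrite hy.
  set a := `|y o|; set b := `|z o|; set c' := `|h _|.
  have -> : c' - b = (a - b) - (a - c') by ring.
  have := ler_normB (a - b) (a - c'); lra.
lra.
Qed.

Lemma closed_levelset s flag : closedS (levelset s flag).
Proof.
move=> z Hz.
have Az : A (xpart z).
  apply: closedA => e /Hz[y [Ay _] yz]; exists (xpart y); split=> // i.
  exact: yz.
split=> //; split.
  apply/pm_norm; apply: (closed_graph_norm contf _ Hz Az) => y [Ay [/pm_norm H _]].
  by [].
split.
  apply/pm_norm; apply: (closed_graph_norm contg _ Hz Az) => y [Ay [_ [/pm_norm H _]]].
  by [].
split.
  apply: (closed_le (pf_const _ s) (pf_var _ (Some ord_max))) => e /Hz[y Hy yz].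
  by exists y => //; have [_ [_ [_ []]]] := Hy.
move=> flag1; apply: (closed_le (pf_const _ 0) (pf_var _ None)) => e /Hz[y Hy yz].
by exists y => //; have [_ [_ [_ [_]]]] := Hy; apply.
Qed.

Lemma bounded_levelset s flag : boundedS (levelset s flag).
Proof.
have [M HM] := boundedA.
have [Mf Hf] := fun_bounded contf saf; have [Mg Hg] := fun_bounded contg sag.
exists (`|M| + `|Mf| + `|Mg|) => z [Az [/pm_norm Hu [/pm_norm Hv _]]] j.
have := ler_norm M; have := ler_norm Mf; have := ler_norm Mg.
have := normr_ge0 M; have := normr_ge0 Mf; have := normr_ge0 Mg.
case: j => [i|]; last by rewrite -Hu; have := Hf _ Az; lra.
case: (unliftP ord_max i) => [j ->|->].
  by have := HM _ Az j; rewrite /xpart; lra.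
by rewrite -Hv; have := Hg _ Az; lra.
Qed.

(** With both signs and both substitutions in the family, equal signs transfer the graph formulas of
    f and g from [z] to [z']; membership in [A] comes with them. The indices [inr] transfer the two
    inequalities. *)
Lemma local_levelset s flag z z' : levelset s flag z ->
  (forall l, Num.sg (point_eval (evp iota s) z' (Ufam l)) =
             Num.sg (point_eval (evp iota s) z (Ufam l))) ->
  levelset s flag z'.
Proof.
have [phif [atf Hf]] := saf; have [phig [atg Hg]] := sag.
move=> [Az [Hu [Hv [Hs Hflag]]]] sgE.
have transfer (h : ('I_n -> R) -> R) phi b (sgn : bool) : atoms_in QR phi ->
    (forall x y, A x /\ y = h x <-> holds (ext_pt x y) phi) ->
    h (xpart z) = (-1) ^+ sgn * (if b then z None else z (Some ord_max)) ->
    A (xpart z') /\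
    h (xpart z') = (-1) ^+ sgn * (if b then z' None else z' (Some ord_max)).
  move=> atp Hphi hz.
  suff /Hphi[Az' ->] : holds (ext_pt (xpart z')
    ((-1) ^+ sgn * (if b then z' None else z' (Some ord_max)))) phi by [].
  have : holds (ext_pt (xpart z)
    ((-1) ^+ sgn * (if b then z None else z (Some ord_max)))) phi.
    by apply/Hphi.
  apply: (proj1 (holds_sg atp _)) => p /(nthP 0)[i iQ <-].
  have := sgE (inl (Ordinal iQ, b, sgn)).
  by rewrite /= !point_eval_subst !point_eval_signed.
have sE (b0 : bool) (a b : R) : a = (-1) ^+ b0 * b -> a = b \/ a = - b.
  by case: b0 => ->; rewrite ?mulN1r ?mul1r; [right | left].
have Eu : exists b0 : bool, f (xpart z) = (-1) ^+ b0 * z None.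
  by case: Hu => ->; [exists false; rewrite mul1r | exists true; rewrite mulN1r].
have Ev : exists b0 : bool, g (xpart z) = (-1) ^+ b0 * z (Some ord_max).
  by case: Hv => ->; [exists false; rewrite mul1r | exists true; rewrite mulN1r].
have [b1 E1] := Eu; have [b2 E2] := Ev.
have [Az' Ef'] := transfer f phif true b1 atf Hf E1.
have [_ Eg'] := transfer g phig false b2 atg Hg E2.
split=> //; split; first exact: sE Ef'.
split; first exact: sE Eg'.
split.
  have := sgE (inr false); rewrite /= !point_eval_Vs => H.
  by rewrite -subr_ge0 -sgr_ge0 H sgr_ge0 subr_ge0.
move=> /Hflag; have := sgE (inr true); rewrite /= !point_eval_U => H.
by rewrite -sgr_ge0 -H sgr_ge0.
Qed.

Lemma levelset_min s flag : (exists z, levelset s flag z) ->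
  exists p, [/\ levelset s flag p,
    forall z, levelset s flag z -> p None <= z None &
    exists I : {set Lidx}, forall P : {poly {poly E}},
     (forall phi (eta : R) x, crit1 (2 * d) (sum_sqr Ufam I) phi eta x ->
        crit2 (2 * d) (sum_sqr Ufam I) phi eta x -> evp phi eta P = 0) ->
     evp (evp iota s) (p None) (lead_coef P) = 0].
Proof.
move=> nS.
exact: (critical_value msize_Ufam (definable_levelset s flag)
  (@closed_levelset s flag) (bounded_levelset s flag) nS
  (@local_levelset s flag)).
Qed.

End GraphMinimum.

(** * From the resultant to the inequality *)

Section RootBounds.
Variable R : rcfType.

(** For small [s] the lowest nonzero term dominates. It is applied twice, first to the coefficients
    of [chi] in the variable s, then to [chi] in the variable u. *)
Lemma poly_low (p : {poly R}) (j0 : nat) (mu Lam s : R) :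
  (forall j, (j < j0)%N -> p`_j = 0) -> mu <= `|p`_j0| ->
  \sum_(j < size p) `|p`_j| <= Lam -> 0 < s -> s <= 1 ->
  s ^+ j0 * (mu - Lam * s) <= `|p.[s]|.
Proof.
move=> p0 pmu pL s0 s1.
have L0 : 0 <= Lam by apply: le_trans pL; apply: sumr_ge0.
have sj : 0 < s ^+ j0 by rewrite exprn_gt0.
have [jp|pj] := ltnP j0 (size p); last first.
  apply: le_trans (normr_ge0 _); rewrite pmulr_rle0 // nth_default // in pmu *.
  by rewrite normr0 in pmu; nra.
rewrite horner_coef (bigD1 (Ordinal jp)) //=.
set T := \sum_(i < _ | _) _.
have HT : `|T| <= Lam * s * s ^+ j0.
  apply: le_trans (ler_norm_sum _ _ _) _.
  apply: le_trans (_ : \sum_(j < size p) `|p`_j| * (s * s ^+ j0) <= _); last first.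
    by rewrite -mulr_suml mulrA ler_pM2r // ler_pM2r.
  rewrite [X in X <= _]big_mkcond; apply: ler_sum => j _.
  case: eqP => [_|/eqP jj] /=; first by rewrite !mulr_ge0 // ltW // mulr_gt0.
  rewrite normrM (gtr0_norm (x := s ^+ j)) ?exprn_gt0 //.
  have [jl|] := ltnP j j0; first by rewrite p0 // normr0 !mul0r.
  rewrite leq_eqVlt => /orP[/eqP E|jl].
    by move/negP: jj; case; apply/eqP/val_inj.
  rewrite ler_wpM2l // -exprS; apply: ler_wiXn2l => //; exact: ltW.
have := lerB_normD (p`_j0 * s ^+ j0) T.
rewrite normrM (gtr0_norm sj).
have : mu * s ^+ j0 <= `|p`_j0| * s ^+ j0 by rewrite ler_pM2r.
rewrite mulrBr [_ * (Lam * s)]mulrC [_ * mu]mulrC; lra.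
Qed.

(** Cauchy's bound for the roots in terms of the leading coefficient. *)
Lemma poly_high (p : {poly R}) (i1 : nat) (mu Lam w : R) :
  (forall i, (i1 < i)%N -> p`_i = 0) -> mu <= `|p`_i1| ->
  \sum_(i < size p) `|p`_i| <= Lam -> 1 <= `|w| -> p.[w] = 0 ->
  mu * `|w| <= Lam.
Proof.
move=> p0 pmu pL w1 pw.
have L0 : 0 <= Lam by apply: le_trans pL; apply: sumr_ge0.
have w0 : 0 < `|w| by lra.
have wi : 0 < `|w| ^+ i1 by rewrite exprn_gt0.
have [ip|pi] := ltnP i1 (size p); last first.
  by rewrite nth_default // normr0 in pmu; nra.
move: pw; rewrite horner_coef (bigD1 (Ordinal ip)) //=.
set T := \sum_(i < _ | _) _ => /eqP; rewrite addr_eq0 => /eqP pT.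
have HT : `|T| * `|w| <= Lam * `|w| ^+ i1.
  apply: le_trans (ler_wpM2r (ltW w0) (ler_norm_sum _ _ _)) _.
  rewrite mulr_suml.
  apply: le_trans (_ : \sum_(j < size p) `|p`_j| * `|w| ^+ i1 <= _); last first.
    by rewrite -mulr_suml ler_pM2r.
  rewrite [X in X <= _]big_mkcond; apply: ler_sum => j _.
  case: eqP => [_|/eqP jj] /=; first by rewrite !mulr_ge0 // ltW.
  rewrite normrM normrX -mulrA.
  have [jl|] := ltnP i1 j; first by rewrite p0 // normr0 !mul0r.
  rewrite leq_eqVlt => /orP[/eqP E|jl].
    by move/negP: jj; case; apply/eqP/val_inj.
  by rewrite ler_wpM2l // -exprSr ler_weXn2l.
move: HT; rewrite -normrN -pT normrM normrX -mulrA [_ * `|w|]mulrC mulrA.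
rewrite ler_pM2r //; apply: le_trans.
by rewrite ler_pM2r.
Qed.

Variables (K : idomainType) (iota : {rmorphism K -> R}).

Definition coefnorm (c : {poly K}) : R := \sum_(j < size c) `|iota c`_j|.
Definition coefnorm2 (chi : {poly {poly K}}) : R :=
  \sum_(i < size chi) coefnorm chi`_i.

Lemma sum_map_poly (T : idomainType) (h : {rmorphism T -> R}) (c : {poly T}) :
  \sum_(j < size (map_poly h c)) `|(map_poly h c)`_j| =
  \sum_(j < size c) `|h c`_j|.
Proof.
rewrite (big_ord_widen (size c) (fun j => `|(map_poly h c)`_j|)); last first.
  exact: size_poly.
rewrite big_mkcond; apply: eq_bigr => i _; rewrite coef_map /=.
case: ltnP => // H; have := nth_default 0 H; rewrite coef_map /= => ->.
by rewrite normr0.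
Qed.

Lemma evp_le (c : {poly K}) (s : R) : 0 <= s -> s <= 1 ->
  `|evp iota s c| <= coefnorm c.
Proof.
move=> s0 s1; rewrite /evp /= /horner_eval (@horner_coef_wide _ (size c)); last first.
  exact: size_poly.
apply: le_trans (ler_norm_sum _ _ _) _; apply: ler_sum => j _.
rewrite coef_map normrM normrX (ger0_norm s0).
by rewrite -[X in _ <= X]mulr1 ler_wpM2l // exprn_ile1.
Qed.

Variables (chi : {poly {poly K}}) (N : nat) (mu Lam s : R).
Hypothesis sz_chi : forall i, (size (chi`_i)%R <= N.+1)%N.
Hypothesis mu_gt0 : 0 < mu.
Hypothesis mu_chi : forall i j, chi`_i`_j != 0 -> mu <= `|iota chi`_i`_j|.
Hypothesis Lam_chi : coefnorm2 chi <= Lam.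
Hypothesis s_gt0 : 0 < s.
Hypothesis s_le1 : s <= 1.
Hypothesis s_small : 2 * Lam * s <= mu.

Lemma coefnorm_ge0 c : 0 <= coefnorm c.
Proof. exact: sumr_ge0. Qed.

(** The condition s <= mu / (2 Lam) leaves half of the lowest term, and the order of vanishing at s
    = 0 is at most [N]. *)
Lemma coef_low i : chi`_i != 0 -> s ^+ N * mu / 2 <= `|evp iota s chi`_i|.
Proof.
move=> c0; set c := chi`_i in c0 *; have m0 := mu_gt0.
have exj : exists j, c`_j != 0.
  by exists (size c).-1; rewrite -lead_coefE lead_coef_eq0.
case: (ex_minnP exj) => j0 cj0 minj.
have isz : (i < size chi)%N.
  by rewrite ltnNge; apply: contra c0 => H; rewrite /c nth_default.
have := @poly_low (map_poly iota c) j0 mu Lam s _ _ _ s_gt0 s_le1.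
rewrite coef_map sum_map_poly -[_.[s]]/(evp iota s c) => H.
apply: le_trans (H _ _ _) => //.
- have j0N : (j0 <= N)%N.
    rewrite -ltnS; apply: leq_trans (sz_chi i); rewrite ltnNge.
    by apply: contra cj0 => Hj; rewrite nth_default.
  have : s ^+ N <= s ^+ j0 by apply: ler_wiXn2l => //; apply: ltW.
  have : 0 < s ^+ N by rewrite exprn_gt0.
  have : mu / 2 <= mu - Lam * s by move: s_small mu_gt0; rewrite -mulrA; lra.
  by move=> ? ? ?; rewrite -mulrA; apply: ler_pM => //; lra.
- move=> j jj0; rewrite coef_map /=; apply/eqP.
  have : c`_j == 0 by apply/negPn/negP => /minj; rewrite leqNgt jj0.
  by move/eqP ->; rewrite rmorph0.
- exact: mu_chi.
- apply: le_trans Lam_chi; rewrite /coefnorm2 (bigD1 (Ordinal isz)) //=.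
  by rewrite lerDl; apply: sumr_ge0 => k _; apply: coefnorm_ge0.
Qed.

Lemma sum_evp_le :
  \sum_(i < size (map_poly (evp iota s) chi)) `|(map_poly (evp iota s) chi)`_i|
    <= Lam.
Proof.
rewrite sum_map_poly; apply: le_trans Lam_chi; apply: ler_sum => i _.
by apply: evp_le => //; apply: ltW.
Qed.

Lemma root_low (u : R) : chi != 0 -> 0 < u -> evp (evp iota s) u chi = 0 ->
  s ^+ N * mu <= 2 * Lam * u.
Proof.
move=> chi0 u0 Hu; have m0 := mu_gt0.
have exi : exists i, chi`_i != 0.
  by exists (size chi).-1; rewrite -lead_coefE lead_coef_eq0.
case: (ex_minnP exi) => i0 ci0 mini.
have cl := coef_low ci0.
have sN : 0 < s ^+ N by rewrite exprn_gt0.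
have aN : 0 < s ^+ N * mu / 2 by rewrite divr_gt0 // mulr_gt0.
(* This settles u > 1, outside the range of [poly_low]. *)
have LL : s ^+ N * mu / 2 <= Lam.
  apply: le_trans cl _; apply: le_trans sum_evp_le.
  set p := map_poly _ _.
  have E : p`_i0 = evp iota s chi`_i0 by rewrite coef_map.
  have isz : (i0 < size p)%N.
    rewrite ltnNge; apply/negP => H; have := nth_default 0 H; rewrite E => E0.
    by have := coef_low ci0; rewrite E0 normr0; lra.
  rewrite -E (bigD1 (Ordinal isz)) //= lerDl; exact: sumr_ge0.
have [u1|u1] := leP u 1; last by nra.
have := @poly_low (map_poly (evp iota s) chi) i0 (s ^+ N * mu / 2) Lam u.
rewrite -[_.[u]]/(evp (evp iota s) u chi) Hu normr0 coef_map => H.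
have := H _ cl sum_evp_le u0 u1.
rewrite pmulr_rle0 ?exprn_gt0 // => H'.
suff : s ^+ N * mu / 2 - Lam * u <= 0 by lra.
apply: H' => j ji; rewrite coef_map /=.
have : chi`_j == 0 by apply/negPn/negP => /mini; rewrite leqNgt ji.
by move/eqP ->; rewrite rmorph0.
Qed.

Lemma root_high (w : R) : chi != 0 -> 1 <= `|w| ->
  evp (evp iota s) w chi = 0 -> s ^+ N * mu * `|w| <= 2 * Lam.
Proof.
move=> chi0 w1 Hw.
have ci1 : chi`_(size chi).-1 != 0 by rewrite -lead_coefE lead_coef_eq0.
have cl := coef_low ci1.
have := @poly_high (map_poly (evp iota s) chi) (size chi).-1 (s ^+ N * mu / 2) Lam w.
rewrite -[_.[w]]/(evp (evp iota s) w chi) coef_map => H.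
have -> : s ^+ N * mu * `|w| = 2 * (s ^+ N * mu / 2 * `|w|) by field.
rewrite ler_pM2l //.
apply: H => //; last exact: sum_evp_le.
move=> i Hi; rewrite coef_map /= nth_default ?rmorph0 //.
by move: Hi; case: (size chi).
Qed.

End RootBounds.

Section Lojasiewicz.
Variables (R : rcfType) (K : idomainType) (iota : {rmorphism K -> R}).
Variables (n d : nat) (Q : seq {mpoly K[n.+1]}).
Hypothesis d_gt1 : (2 <= d)%N.
Hypothesis degQ : deg_le d Q.
Local Notation E := {poly K}.
Local Notation QR := (map (map_mpoly iota) Q).

(** The degree bound of [elimination] for [n.+1] variables: the first factor is the size of the
    determinant, the second bounds the degree in s of its entries. The 2 in front of the parenthesis
    is the degree in s of (v - s)^2. *)
Definition deg_bound : nat :=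
  ((2 * d).+1 ^ n.+1 * (2 * (n.+2 * (2 * d)).+1))%N.

Definition norm_bound (Lambda : nat) : nat :=
  (((2 * d).+1 ^ n.+1)`! * ((2 * d).+2 * Lambda *
    ((2 * d).+1 * Lambda) ^ (n.+2 * (2 * d)) + (2 * d).+2) ^ ((2 * d).+1 ^ n.+1))%N.

Lemma deg_Ufam (l : Lidx Q) :
  mpolyfil (polyfil (fun a (p : E) => (size p <= a.+1)%N)) 1 (Ufam l).
Proof.
have fE := @degfil_size K; have fT := degfil_poly fE.
have fB := degfil_mpoly n.+1 fT.
have BC a (c : {poly E}) : polyfil (fun a (p : E) => (size p <= a.+1)%N) a c ->
    mpolyfil (polyfil (fun a (p : E) => (size p <= a.+1)%N)) a c%:MP_[n.+1].
  move=> Hc m; rewrite mcoeffC; case: (m == _); rewrite ?mulr1 ?mulr0 //.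
  exact: (degfil0 fT).
have BCC a (c : E) : (size c <= a.+1)%N ->
    polyfil (fun a (p : E) => (size p <= a.+1)%N) a c%:P.
  by move=> Hc i; rewrite coefC; case: (i == _); rewrite ?size_poly0.
have BX j : mpolyfil (polyfil (fun a (p : E) => (size p <= a.+1)%N)) 0
    ('X_j : {mpoly {poly E}[n.+1]}).
  move=> m; rewrite mcoeffX; case: (_ == _); first exact: (degfil1 fT).
  exact: (degfil0 fT).
have BU : mpolyfil (polyfil (fun a (p : E) => (size p <= a.+1)%N)) 0
    ('X%:MP : {mpoly {poly E}[n.+1]}).
  apply: BC => i; rewrite coefX; case: (_ == _); rewrite ?size_poly1 //.
  by rewrite size_poly0.
case: l => [[[i b] sgn]|[]] /=.
- apply: (degfilW fB (leq0n _)); rewrite -[0%N](muln0 d).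
  apply: (degfil_mmap fB (d := d)) => [c|j|].
  + by apply: BC; apply: BCC; apply: size_polyC_leq1.
  + case: (_ == _) => //; rewrite -[0%N]/(0 + 0)%N; apply: (degfilM fB).
      case: sgn; rewrite ?expr1 ?expr0; last exact: (degfil1 fB).
      by apply: (degfilN fB); apply: (degfil1 fB).
    by case: b.
  + exact: degQ (nth_mem_Q i).
- exact: (degfilW fB (leq0n _)).
- apply: (degfilD fB); first exact: (degfilW fB (leq0n _)).
  by apply: (degfilN fB); apply: BC; apply: BCC; rewrite size_polyX.
Qed.

Lemma char0_K j : j.+1%:R != 0 :> K.
Proof.
apply/eqP => H; have := congr1 iota H.
by rewrite rmorph_nat rmorph0 => /eqP; rewrite pnatr_eq0.
Qed.

(** One determinant for each possible active set, chosen independently of the level s; finiteness of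
    the index type later gives constants valid for all s. *)
Lemma chi_family : exists P : {set Lidx Q} -> {poly {poly E}}, forall I,
  [/\ P I != 0,
      forall phi (eta : R) x, crit1 (2 * d) (sum_sqr (@Ufam K n Q) I) phi eta x ->
        crit2 (2 * d) (sum_sqr (@Ufam K n Q) I) phi eta x -> evp phi eta (P I) = 0,
      forall i j, (size ((P I)`_i`_j)%R <= deg_bound.+1)%N &
      forall Lambda nu, (0 < Lambda)%N ->
        coef_normed (sum_sqr (@Ufam K n Q) I) Lambda nu ->
        (nu (P I) <= norm_bound Lambda)%N].
Proof.
suff H I : exists P : {poly {poly E}},
  [/\ P != 0,
      forall phi (eta : R) x, crit1 (2 * d) (sum_sqr (@Ufam K n Q) I) phi eta x ->
        crit2 (2 * d) (sum_sqr (@Ufam K n Q) I) phi eta x -> evp phi eta P = 0,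
      forall i j, (size (P`_i`_j)%R <= deg_bound.+1)%N &
      forall Lambda nu, (0 < Lambda)%N ->
        coef_normed (sum_sqr (@Ufam K n Q) I) Lambda nu ->
        (nu P <= norm_bound Lambda)%N].
  by have [P HP] := choice H; exists P.
have D0 : (2 * d).+2%:R != 0 :> {poly E}.
  by rewrite -!polyC_natr !polyC_eq0 char0_K.
have [P [P0 HP Hdeg Hnorm]] := @elimination _ R n.+1 (2 * d)
  (sum_sqr (@Ufam K n Q) I) (@deg_sum_sqr _ _ _ _ _ (msize_Ufam d_gt1 degQ) I) D0.
exists P; split=> // i j.
pose B2 := polyfil (fun a (p : E) => (size p <= a.+1)%N).
have fB2 : degfil B2 by apply: degfil_poly; apply: degfil_size.
have fB := degfil_mpoly n.+1 fB2.
apply: (Hdeg 2 (polyfil B2)); split.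
- exact: degfil_poly.
- by move=> e; rewrite coefX; case: (_ == _); [apply: (degfil1 fB2) | apply: (degfil0 fB2)].
- move=> m e; rewrite coefC; case: (_ == _); last exact: (degfil0 fB2).
  have : mpolyfil B2 2 (sum_sqr (@Ufam K n Q) I); last exact.
  apply: degfil_sum => // l _; rewrite expr2 -[2%N]/(1 + 1)%N.
  by apply: (degfilM fB); apply: deg_Ufam.
Qed.

Variables (A : ('I_n -> R) -> Prop) (f g : ('I_n -> R) -> R).
Hypothesis closedA : closed_set A.
Hypothesis boundedA : bounded_set A.
Hypothesis contf : continuous_on A f.
Hypothesis contg : continuous_on A g.
Hypothesis saf : semialg_fun QR A f.
Hypothesis sag : semialg_fun QR A g.
Hypothesis fg0 : forall x, A x -> f x = 0 -> g x = 0.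

Variable P : {set Lidx Q} -> {poly {poly E}}.
Hypothesis P0 : forall I, P I != 0.
Hypothesis critP : forall I phi (eta : R) x,
  crit1 (2 * d) (sum_sqr (@Ufam K n Q) I) phi eta x ->
  crit2 (2 * d) (sum_sqr (@Ufam K n Q) I) phi eta x -> evp phi eta (P I) = 0.

Variables (N : nat) (mu Lam : R).
Hypothesis N_gt0 : (0 < N)%N.
Hypothesis sizeP : forall I i j, (size ((P I)`_i`_j)%R <= N.+1)%N.
Hypothesis mu_gt0 : 0 < mu.
Hypothesis mu_le1 : mu <= 1.
Hypothesis Lam_ge1 : 1 <= Lam.
Hypothesis muP : forall I i j, (lead_coef (P I))`_i`_j != 0 ->
  mu <= `|iota (lead_coef (P I))`_i`_j|.
Hypothesis LamP : forall I, coefnorm2 iota (lead_coef (P I)) <= Lam.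

Let s0 := mu / (2 * Lam).
Let G := 1 + 2 * Lam / (mu * s0 ^+ N).

Lemma s0_gt0 : 0 < s0. Proof. by rewrite divr_gt0 // mulr_gt0 //; have := Lam_ge1; lra. Qed.

Lemma s0_le1 : s0 <= 1.
Proof. by rewrite ler_pdivrMr ?mul1r; have := mu_le1; have := Lam_ge1; lra. Qed.

Lemma s0_small s : s <= s0 -> 2 * Lam * s <= mu.
Proof.
have L2 : 0 < 2 * Lam by have := Lam_ge1; lra.
by rewrite ler_pdivlMr // mulrC.
Qed.

Definition graph_pt (x : 'I_n -> R) (u v : R) (o : option 'I_n.+1) : R :=
  match o with Some i => ext_pt x v i | None => u end.

Lemma xpart_graph_pt x u v : xpart (graph_pt x u v) = x.
Proof. by apply/funext=> i; rewrite /xpart /graph_pt /ext_pt liftK. Qed.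

Lemma last_graph_pt x u v : graph_pt x u v (Some ord_max) = v.
Proof. by rewrite /graph_pt /ext_pt unlift_none. Qed.

Lemma pm_absr (a : R) : a = `|a| \/ a = - `|a|.
Proof.
have [a0|a0] := ger0P a; first by left.
by right; rewrite opprK.
Qed.

(** The inclusion of zero sets makes the minimum of u positive: u = 0 would force f = 0, then g = 0,
    against |g| >= s > 0. A positive root is what [root_low] bounds from below. *)
Lemma lower_bound (s : R) x : 0 < s -> s <= s0 -> A x -> s <= `|g x| ->
  s ^+ N * mu <= 2 * Lam * `|f x|.
Proof.
move=> sgt0 ss0 Ax sg.
have Lx : levelset A f g s true (graph_pt x `|f x| `|g x|).
  rewrite /levelset xpart_graph_pt last_graph_pt /=.
  by do !split => //; apply: pm_absr.
have [p [Lp minp [I HI]]] := levelset_min d_gt1 degQ closedA boundedA contf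
  contg saf sag (ex_intro _ _ Lx).
have := minp _ Lx => /= pf.
have [Axp [Hu [Hv [Hs /(_ isT) pu0]]]] := Lp.
have pu : 0 < p None.
  rewrite lt_neqAle pu0 andbT eq_sym; apply/eqP => pE.
  have f0 : f (xpart p) = 0 by case: Hu => ->; rewrite pE ?oppr0.
  have := fg0 Axp f0 => g0; rewrite g0 in Hv.
  have : p (Some ord_max) = 0.
    by case: Hv => [<-//|/esym/eqP]; rewrite oppr_eq0 => /eqP.
  lra.
have chi0 : lead_coef (P I) != 0 by rewrite lead_coef_eq0.
have sz i : (size ((lead_coef (P I))`_i)%R <= N.+1)%N by apply: sizeP.
have := root_low sz mu_gt0 (@muP I) (LamP I) sgt0 (le_trans ss0 s0_le1)
  (s0_small ss0) chi0 pu (HI _ (@critP I)).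
move/le_trans; apply; rewrite ler_pM2l //; have := Lam_ge1; lra.
Qed.

Lemma upper_bound x : A x -> `|g x| <= G.
Proof.
move=> Ax.
have s0p := s0_gt0; have s01 := s0_le1.
have sN : 0 < mu * s0 ^+ N by rewrite mulr_gt0 // exprn_gt0.
have G1 : 1 <= G.
  by rewrite /G lerDl divr_ge0 ?(ltW sN) //; have := Lam_ge1; lra.
have [g1|g1] := leP `|g x| 1; first exact: le_trans G1.
(* Here g plays both roles and u may be negative, so the least u is minus the largest |g|; the level
   [s0] is reached because |g x| > 1. *)
have Lx : levelset A g g s0 false (graph_pt x (- `|g x|) `|g x|).
  rewrite /levelset xpart_graph_pt last_graph_pt /= opprK.
  split=> //; split; first by case: (pm_absr (g x)); [right | left].
  by split; [exact: pm_absr | split=> //; lra].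
have [p [Lp minp [I HI]]] := levelset_min d_gt1 degQ closedA boundedA contg
  contg sag sag (ex_intro _ _ Lx).
have := minp _ Lx => /= pg.
have pn : `|g x| <= `|p None|.
  have := ler_norm (- p None); rewrite normrN; lra.
have chi0 : lead_coef (P I) != 0 by rewrite lead_coef_eq0.
have sz i : (size ((lead_coef (P I))`_i)%R <= N.+1)%N by apply: sizeP.
have w1 : 1 <= `|p None| by lra.
have := root_high sz mu_gt0 (@muP I) (LamP I) s0p s01
  (s0_small (lexx _)) chi0 w1 (HI _ (@critP I)).
rewrite [s0 ^+ N * mu]mulrC => H; apply: le_trans pn _.
by rewrite /G -ler_pdivlMl // mulrC in H *; lra.
Qed.

(** If |g x| <= [s0], the level s = |g x| gives the inequality directly. Otherwise the level [s0]
    bounds |f x| below, and the factor (G / s0)^N makes up for |g x|^N <= G^N. *)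
Lemma lojasiewicz x : A x ->
  `|g x| ^+ N <= (2 * Lam / mu * (G / s0) ^+ N) * `|f x|.
Proof.
move=> Ax; have s0p := s0_gt0; have s01 := s0_le1.
have sN : 0 < mu * s0 ^+ N by rewrite mulr_gt0 // exprn_gt0.
have G1 : 1 <= G.
  by rewrite /G lerDl divr_ge0 ?(ltW sN) //; have := Lam_ge1; lra.
have Gs : 1 <= G / s0 by rewrite ler_pdivlMr // mul1r; lra.
have GsN : 1 <= (G / s0) ^+ N by apply: exprn_ege1.
have L0 : 0 < 2 * Lam by have := Lam_ge1; lra.
have C0 : 0 < 2 * Lam / mu by rewrite divr_gt0.
have [g0|g0] := eqVneq (g x) 0.
  rewrite g0 normr0 expr0n gtn_eqF //=; apply: mulr_ge0 => //.
  by apply: mulr_ge0 (ltW C0) (le_trans ler01 GsN).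
have gp : 0 < `|g x| by rewrite normr_gt0.
have f0 : 0 <= 2 * Lam * `|f x| / mu.
  by rewrite divr_ge0 ?(ltW mu_gt0) // mulr_ge0 // ltW.
have -> : 2 * Lam / mu * (G / s0) ^+ N * `|f x| =
    (G / s0) ^+ N * (2 * Lam * `|f x| / mu) by ring.
have [gs|gs] := leP `|g x| s0.
  have := lower_bound gp gs Ax (lexx _); rewrite -ler_pdivlMr // => H.
  by apply: le_trans H _; apply: ler_peMl.
have := lower_bound s0p (lexx _) Ax (ltW gs); rewrite -ler_pdivlMr // => H.
apply: le_trans (_ : G ^+ N <= _).
  by apply: lerXn2r (upper_bound Ax); rewrite ?nnegrE // (le_trans ler01).
have -> : G ^+ N = (G / s0) ^+ N * s0 ^+ N.
  by rewrite -exprMn divfK // gt_eqF.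
by rewrite ler_wpM2l // (le_trans ler01).
Qed.

End Lojasiewicz.

(** * Explicit bounds *)

Section Numerics.

(** The two factors are at most (8d)^(n+1) and (8d)^(n+3), and 2n + 4 <= 2(n + 7). *)
Lemma deg_bound_le n d : (2 <= d)%N ->
  (deg_bound n d <= (8 * d) ^ (2 * (n + 7)))%N.
Proof.
move=> d2; have d8 : (0 < 8 * d)%N by lia.
have H1 : ((2 * d).+1 ^ n.+1 <= (8 * d) ^ n.+1)%N by rewrite leq_exp2r //; lia.
have H2 : (2 * (n.+2 * (2 * d)).+1 <= (8 * d) ^ n.+3)%N.
  rewrite expnS; apply: leq_trans (_ : 8 * d * n.+2 <= _)%N; first by lia.
  rewrite leq_mul2l; apply/orP; right.
  apply: leq_trans (ltnW (ltn_expl n.+2 (ltnSn 1))) _.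
  by rewrite leq_exp2r //; lia.
apply: leq_trans (leq_mul H1 H2) _; rewrite -expnD leq_pexp2l //; lia.
Qed.

Variable Z : nat.
Hypothesis Z2 : (2 <= Z)%N.

(** All quantities are compared with powers of Z = d^(n+1), which absorb d, n and numerical
    constants; a sum costs one unit of exponent. *)
Lemma powD x y a : (x <= Z ^ a -> y <= Z ^ a -> x + y <= Z ^ a.+1)%N.
Proof.
move=> xa ya; rewrite expnS; apply: leq_trans (leq_add xa ya) _.
by rewrite addnn -mul2n leq_mul2r Z2 orbT.
Qed.

Lemma powM x y a b : (x <= Z ^ a -> y <= Z ^ b -> x * y <= Z ^ (a + b))%N.
Proof. by move=> xa yb; rewrite expnD leq_mul. Qed.

Lemma powW x a b : (x <= Z ^ a -> a <= b -> x <= Z ^ b)%N.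
Proof.
by move=> xa ab; apply: leq_trans xa _; rewrite leq_pexp2l //; lia.
Qed.

Lemma pow2X x a : (x <= a -> 2 ^ x <= Z ^ a)%N.
Proof.
move=> xa; apply: leq_trans (_ : 2 ^ a <= _)%N; first by rewrite leq_exp2l.
by case: a xa => // a _; rewrite leq_exp2r.
Qed.

Lemma leq_exp2_self x : (x <= 2 ^ x)%N.
Proof. exact: ltnW (ltn_expl _ _). Qed.

Lemma fact_le r : (r`! <= 2 ^ (r * r))%N.
Proof.
apply: leq_trans (_ : r ^ r <= _)%N; last first.
  rewrite expnM; case: r => // r; rewrite leq_exp2r //; exact: leq_exp2_self.
elim: r => // r IHr; rewrite factS expnS leq_mul2l /=.
by apply: leq_trans IHr _; case: r => // r; rewrite leq_exp2r.
Qed.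

(** [W] bounds the number of monomials. In turn: W <= Z^2, determinant size r <= Z^3, Lambda <=
    2^(tau Z^6), entries at most 2^(tau Z^13); with r! <= 2^(r^2), r^2 + r Z^13 <= Z^17. *)
Lemma norm_bound_le (n d tau W Lambda : nat) : Z = (d ^ n.+1)%N -> (2 <= d)%N ->
  (0 < tau)%N -> W = (d.+1 ^ n.+1)%N -> (0 < Lambda)%N ->
  (Lambda <= (4 * 2 ^ ((tau + 2) * W) + 3) * (W * 2 ^ tau) ^ 2)%N ->
  (norm_bound n d Lambda <= 2 ^ (tau * Z ^ 17))%N.
Proof.
move=> ZE d2 tau0 WE L0 LL.
have Zd : (d <= Z)%N.
  by rewrite ZE -[X in (X <= _)%N]expn1 leq_pexp2l //; lia.
have Zn : (n.+1 <= Z)%N.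
  apply: leq_trans (leq_exp2_self _) _; rewrite ZE leq_exp2r //.
have WZ : (W <= Z ^ 2)%N.
  rewrite WE ZE -expnM [(n.+1 * 2)%N]mulnC expnM leq_exp2r // expnS expn1; nia.
have rZ : ((2 * d).+1 ^ n.+1 <= Z ^ 3)%N.
  rewrite ZE -expnM [(n.+1 * 3)%N]mulnC expnM leq_exp2r // !expnS expn0; nia.
set r := ((2 * d).+1 ^ n.+1)%N in rZ *.
have W1 : (0 < W)%N by rewrite WE expn_gt0.
have Llam : (Lambda <= 2 ^ (tau * Z ^ 6))%N.
  apply: leq_trans LL _.
  apply: leq_trans (_ : 2 ^ ((tau + 2) * W + 3) * (2 ^ W * 2 ^ tau) ^ 2 <= _)%N.
    apply: leq_mul.
      rewrite expnD; have : (1 <= 2 ^ ((tau + 2) * W))%N by rewrite expn_gt0.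
      by rewrite -[(2 ^ 3)%N]/8%N; lia.
    by rewrite leq_exp2r // leq_mul2r leq_exp2_self orbT.
  rewrite -!expnD -expnM -expnD leq_exp2l //.
  apply: leq_trans (_ : tau * (10 * W) <= _)%N; first by nia.
  rewrite leq_mul2l; apply/orP; right.
  by apply: (powM (a := 4) (b := 2)) => //; apply: leq_trans (pow2X (leqnn 4)).
have dZ : ((2 * d).+2 <= 2 ^ (tau * Z ^ 6))%N.
  apply: leq_trans (leq_exp2_self _) _; rewrite leq_exp2l //.
  apply: leq_trans (_ : 1 * Z ^ 6 <= _)%N; last by rewrite leq_mul2r tau0 orbT.
  rewrite mul1n; apply: (@powW _ 3) => //.
  apply: leq_trans (_ : 3 * Z <= _)%N; first by lia.
  apply: (powM (a := 2) (b := 1)); last by rewrite expn1.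
  exact: leq_trans (pow2X (leqnn 2)).
have eZ : (n.+2 * (2 * d) <= Z ^ 4)%N.
  apply: (powM (a := 2) (b := 2)).
    by rewrite -[n.+2]addn1; apply: powD; rewrite expn1 //; lia.
  by rewrite -[2%N]/(1 + 1)%N; apply: powM; rewrite expn1.
have BE : ((2 * d).+2 * Lambda * ((2 * d).+1 * Lambda) ^ (n.+2 * (2 * d)) +
    (2 * d).+2 <= 2 ^ (tau * Z ^ 13))%N.
  set p := (tau * Z ^ 6)%N in Llam dZ.
  apply: leq_trans (_ : 2 ^ (2 * p) * (2 ^ (2 * p)) ^ (Z ^ 4) * 2 <= _)%N.
    rewrite muln2 -addnn leq_add //.
      apply: leq_mul.
        by rewrite [(2 * p)%N]mul2n -addnn expnD leq_mul.
      apply: leq_trans (_ : (2 ^ (2 * p)) ^ (n.+2 * (2 * d)) <= _)%N.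
        rewrite leq_exp2r; last by lia.
        by rewrite [(2 * p)%N]mul2n -addnn expnD leq_mul // ltnW.
      by rewrite leq_pexp2l // expn_gt0.
    apply: leq_trans dZ _; apply: leq_trans (_ : 2 ^ (2 * p) * 1 <= _)%N.
      by rewrite muln1 leq_exp2l // leq_pmull.
    by rewrite leq_mul2l !expn_gt0 orbT.
  rewrite -expnM -!expnD -expnSr leq_exp2l //.
  apply: leq_trans (_ : p * (2 + 2 * Z ^ 4 + 1) <= _)%N.
    have : (0 < p)%N by rewrite muln_gt0 tau0 expn_gt0; lia.
    nia.
  rewrite /p -mulnA leq_mul2l; apply/orP; right.
  apply: (powM (a := 6) (b := 7)) => //; apply: powD; last first.
    by rewrite expn_gt0; lia.
  apply: powD; last by apply: (powM (a := 1) (b := 4)); rewrite ?expn1.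
  by apply: (@powW _ 1) => //; rewrite expn1.
have r0 : (0 < r)%N by rewrite expn_gt0.
apply: leq_trans (leq_mul (fact_le _) (_ : _ <= (2 ^ (tau * Z ^ 13)) ^ r)%N) _.
  by rewrite leq_exp2r.
rewrite -expnM -expnD leq_exp2l //.
apply: leq_trans (_ : tau * (r * r + Z ^ 13 * r) <= _)%N.
  by rewrite mulnDr leq_add ?leq_pmull // mulnA.
rewrite leq_mul2l; apply/orP; right; apply: powD.
  by apply: powW (powM rZ rZ) _.
by apply: (powM (a := 13) (b := 3)).
Qed.

(** From 8d <= d^4 and 8(n + 7) <= 56(n + 1) comes N <= Z^56, then 1 + N(N + 3) <= Z^116; the first
    factor is at most tau Z^18, and 18 + 116 = 134. *)
Lemma final_exponent (n d tau N : nat) : Z = (d ^ n.+1)%N -> (2 <= d)%N ->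
  (0 < tau)%N -> N = ((8 * d) ^ (2 * (n + 7)))%N ->
  ((tau * Z ^ 17).+1 * (1 + N * (N + 3)) <= tau * Z ^ 134)%N.
Proof.
move=> ZE d2 tau0 NE.
have NZ : (N <= Z ^ 56)%N.
  rewrite NE ZE -expnM; apply: leq_trans (_ : (d ^ 4) ^ (2 * (n + 7)) <= _)%N.
    rewrite leq_exp2r; last by lia.
    by rewrite mulnC [X in (_ <= X)%N]expnS leq_mul2l (leq_exp2r 2 d (e := 3)) // d2 orbT.
  by rewrite -expnM leq_pexp2l //; lia.
have N3 : (N + 3 <= Z ^ 57)%N.
  apply: powD => //; apply: (@powW _ 2) => //.
  exact: leq_trans (pow2X (leqnn 2)).
have H : (1 + N * (N + 3) <= Z ^ 116)%N.
  apply: powD; first by rewrite expn_gt0; lia.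
  apply: (@powW _ (56 + 57)) => //; exact: powM.
apply: leq_trans (leq_mul (_ : _ <= tau * Z ^ 18)%N H) _.
  have y0 : (0 < tau * Z ^ 17)%N by rewrite muln_gt0 tau0 expn_gt0; lia.
  rewrite (expnS Z 17) mulnCA; move: (tau * Z ^ 17)%N y0 => y y0.
  apply: leq_trans (_ : 2 * y <= _)%N; first by lia.
  by rewrite leq_mul2r Z2 orbT.
by rewrite -mulnA -expnD.
Qed.

End Numerics.

(** * Counting monomials and integer polynomials *)

Section Counting.

Lemma size_msupp_le k d (T : idomainType) (p : {mpoly T[k]}) :
  (msize p <= d.+1)%N -> (size (msupp p) <= d.+1 ^ k)%N.
Proof.
move=> pd; pose c (m : 'X_{1..k}) : {ffun 'I_k -> 'I_d.+1} :=
  [ffun i => inord (m i)].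
have mi m i : m \in msupp p -> (m i < d.+1)%N.
  move=> /msize_mdeg_lt mp; apply: leq_trans pd; apply: leq_ltn_trans mp.
  by rewrite mdegE (bigD1 i) //= leq_addr.
have cu : uniq [seq c m | m <- msupp p].
  rewrite map_inj_in_uniq ?msupp_uniq // => m m' mp m'p.
  move=> /ffunP cE; apply/mnmP => i; have := congr1 val (cE i).
  by rewrite !ffunE /= !inordK ?mi.
rewrite -(size_map c) -(card_uniqP cu); apply: leq_trans (max_card _) _.
by rewrite card_ffun !card_ord.
Qed.

(** The bound on c must not depend on how many polynomials are given. Degree and bit-size leave only
    finitely many distinct ones, told apart by their coefficients on a box of exponents. *)
Lemma size_uniq_polys k d tau (Q : seq {mpoly int[k]}) :
  uniq Q -> deg_le d Q -> bitsize_le tau Q ->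
  (size Q <= 2 ^ ((tau + 2) * d.+1 ^ k))%N.
Proof.
move=> uQ dQ bQ; pose M := {ffun 'I_k -> 'I_d.+1}.
pose mn (b : M) : 'X_{1..k} := [multinom b i : nat | i < k].
(* The shift by 2^tau makes all coefficients positive, so [absz] stays injective on them. *)
pose c (p : {mpoly int[k]}) : {ffun M -> 'I_(2 ^ tau.+1).+1} :=
  [ffun b => inord (absz (p@_(mn b) + (2 ^ tau)%:Z))].
have cb p m : p \in Q -> (absz (p@_m + (2 ^ tau)%:Z)%R < (2 ^ tau.+1).+1)%N.
  move=> /bQ/(_ m); rewrite expnS; move: (2 ^ tau)%N => t; lia.
have cu : uniq [seq c p | p <- Q].
  rewrite map_inj_in_uniq // => p p' pQ p'Q /ffunP cE; apply/mpolyP => m.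
  have [/forallP mb|] := boolP [forall i, m i < d.+1]%N.
    have E : mn [ffun i => Ordinal (mb i)] = m.
      by apply/mnmP => i; rewrite mnmE ffunE.
    have := congr1 val (cE [ffun i => Ordinal (mb i)]).
    rewrite !ffunE /= !inordK ?cb // E.
    have := bQ p pQ m; have := bQ p' p'Q m; move: (2 ^ tau)%N => t; lia.
  rewrite negb_forall => /existsP[i]; rewrite -leqNgt => di.
  have out q : q \in Q -> q@_m = 0.
    move=> qQ; apply: memN_msupp_eq0; apply/negP => /msize_mdeg_lt mq.
    have := leq_trans mq (dQ q qQ); rewrite ltnNge => /negP; apply.
    by apply: leq_trans di _; rewrite mdegE (bigD1 i) //= leq_addr.
  by rewrite !out.
rewrite -(size_map c) -(card_uniqP cu); apply: leq_trans (max_card _) _.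
rewrite card_ffun card_ord card_ffun !card_ord expnM.
apply: leq_trans (_ : (2 ^ (tau + 2)) ^ (d.+1 ^ k) <= _)%N => //.
rewrite leq_exp2r ?expn_gt0 // addn2 [(2 ^ tau.+2)%N]expnS.
have : (0 < 2 ^ tau.+1)%N by rewrite expn_gt0.
by lia.
Qed.

End Counting.

(** * The inequality over a real closed field *)

Lemma loj_part1 (R : rcfType) (n d : nat) (Q : seq {mpoly R[n.+1]})
    (A : ('I_n -> R) -> Prop) (f g : ('I_n -> R) -> R) :
  (2 <= d)%N -> deg_le d Q -> closed_set A -> bounded_set A ->
  continuous_on A f -> continuous_on A g ->
  semialg_fun Q A f -> semialg_fun Q A g ->
  (forall x, A x -> f x = 0 -> g x = 0) ->
  exists c : R,
    forall x, A x -> `|g x| ^+ ((8 * d) ^ (2 * (n + 7))) <= c * `|f x|.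
Proof.
move=> d2 degQ cA bA cf cg sf sg fg.
have QE : map (map_mpoly (idfun : {rmorphism R -> R})) Q = Q.
  rewrite -[RHS]map_id; apply: eq_map => p; apply/mpolyP => m.
  by rewrite mcoeff_map_mpoly.
rewrite -QE in sf sg.
have [P HP] := chi_family (idfun : {rmorphism R -> R}) d2 degQ.
pose chi I := lead_coef (P I).
(* A positive lower bound for nonzero coefficients exists because there are finitely many sets [I]
   and each polynomial has finitely many coefficients. *)
have [mu0 mu00 Hmu] : exists2 mu : R, 0 < mu & forall (I : {set Lidx Q}) i j,
    (chi I)`_i`_j != 0 -> mu <= `|(chi I)`_i`_j|.
  apply: (@fin_pos R {set Lidx Q} (fun I mu => forall i j,
    (chi I)`_i`_j != 0 -> mu <= `|(chi I)`_i`_j|)).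
    by move=> I e e' _ ee' H i j /H; apply: le_trans.
  move=> I; have [mu mu0 H] : exists2 mu : R, 0 < mu & forall i : 'I_(size (chi I)),
      forall j, (chi I)`_i`_j != 0 -> mu <= `|(chi I)`_i`_j|.
    apply: (@fin_pos R 'I_(size (chi I)) (fun i mu => forall j,
      (chi I)`_i`_j != 0 -> mu <= `|(chi I)`_i`_j|)).
      by move=> i e e' _ ee' H j /H; apply: le_trans.
    move=> i; have [mu mu0 H] : exists2 mu : R, 0 < mu &
        forall j : 'I_(size (chi I)`_i), (chi I)`_i`_j != 0 ->
        mu <= `|(chi I)`_i`_j|.
      apply: (@fin_pos R 'I_(size (chi I)`_i) (fun j mu =>
        (chi I)`_i`_j != 0 -> mu <= `|(chi I)`_i`_j|)).
        by move=> j e e' _ ee' H /H; apply: le_trans.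
      move=> j; have [->|cij] := eqVneq (chi I)`_i`_j 0; first by exists 1.
      by exists `|(chi I)`_i`_j| => //; rewrite normr_gt0.
    exists mu => // j cij; have [ji|ij] := ltnP j (size (chi I)`_i).
      exact: (H (Ordinal ji)).
    by rewrite nth_default ?eqxx in cij.
  exists mu => // i j cij; have [ii|ii] := ltnP i (size (chi I)).
    exact: (H (Ordinal ii)).
  by rewrite [(chi I)`_i]nth_default // coef0 eqxx in cij.
pose Lam := 1 + \sum_I coefnorm2 (idfun : {rmorphism R -> R}) (chi I).
have cn0 I : 0 <= coefnorm2 (idfun : {rmorphism R -> R}) (chi I).
  by apply: sumr_ge0 => i _; apply: coefnorm_ge0.
have N0 : (0 < (8 * d) ^ (2 * (n + 7)))%N by rewrite expn_gt0; lia.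
pose mu := Num.min mu0 1.
have HP0 I : P I != 0 by have [] := HP I.
have HPc I := let: And4 _ H _ _ := HP I in H.
have HPs I i j : (size ((P I)`_i`_j)%R <= ((8 * d) ^ (2 * (n + 7))).+1)%N.
  have [_ _ H _] := HP I; apply: leq_trans (H i j) _.
  by rewrite ltnS deg_bound_le.
eexists=> x Ax.
apply: (lojasiewicz (iota := idfun) (mu := mu) (Lam := Lam) d2 degQ cA bA cf cg
  sf sg fg HP0 HPc N0 HPs) => //.
- by rewrite lt_min mu00 ltr01.
- exact: min_ler.
- by rewrite lerDl; apply: sumr_ge0 => I _.
- by move=> I i j /Hmu; apply: le_trans; apply: min_lel.
- move=> I; rewrite /Lam (bigD1 I) //= addrCA lerDl addr_ge0 // sumr_ge0 //.
Qed.

(** * Norms of the determinants over the integers *)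

Section IntegerNorms.
Variables (n d tau : nat) (Q : seq {mpoly int[n.+1]}).
Hypothesis d_gt1 : (2 <= d)%N.
Hypothesis tau_gt0 : (0 < tau)%N.
Hypothesis uQ : uniq Q.
Hypothesis degQ : deg_le d Q.
Hypothesis bitQ : bitsize_le tau Q.

Let nu1 : {poly int} -> nat := polynorm (fun c : int => absz c).
Let nu2 : {poly {poly int}} -> nat := polynorm nu1.
Let nu3 : {poly {poly {poly int}}} -> nat := polynorm nu2.
Let fnu1 : seminorm nu1 := seminorm_poly seminorm_absz.
Let fnu2 : seminorm nu2 := seminorm_poly fnu1.
Let fnu3 : seminorm nu3 := seminorm_poly fnu2.
Let W := (d.+1 ^ n.+1)%N.

(** Substituting +-u or +-v for Y cannot increase the l1-norm of a member of [Q], which has at most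
    [W] monomials with coefficients below 2^tau. *)
Lemma norm_Ufam (l : Lidx Q) : (mpolynorm nu2 (Ufam l) <= W * 2 ^ tau)%N.
Proof.
have fm := seminorm_mpoly fnu2 n.+1.
have nU : (mpolynorm nu2 ('X%:MP_[n.+1])%R <= 1)%N.
  by rewrite (mpolynormC fnu2); apply: (polynormX fnu1).
have W3 : (3 <= W)%N.
  by rewrite /W expnS; have : (0 < d.+1 ^ n)%N by [rewrite expn_gt0]; nia.
have t2 : (1 <= 2 ^ tau)%N by rewrite expn_gt0.
case: l => [[[i b] sgn]|[]] /=.
- set p := Q`_i; have pQ : p \in Q := nth_mem_Q i.
  rewrite /subst_last; apply: leq_trans (seminorm_mmap _ _ fm _) _.
    move=> j; case: (_ == _); last exact: mpolynormX.
    apply: leq_trans (seminormM fm _ _) _; rewrite -[1%N]mul1n; apply: leq_mul.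
      exact: seminorm_sign.
    by case: b => //; apply: mpolynormX.
  apply: leq_trans (_ : \sum_(m <- msupp p) 2 ^ tau <= _)%N.
    apply: leq_sum => m _; rewrite /lift_coef /comp (mpolynormC fnu2).
    rewrite /nu2 (polynormC fnu1) /nu1 (polynormC seminorm_absz).
    have := bitQ pQ m; move: (p@_m) (2 ^ tau)%N => c t /=; lia.
  rewrite big_const_seq count_predT iter_addn_0 mulnC leq_mul2r.
  by rewrite size_msupp_le ?orbT //; apply: degQ.
- by apply: leq_trans nU _; nia.
- apply: leq_trans (seminormD fm _ _) _; rewrite (seminormN fm).
  apply: leq_trans (leq_add (mpolynormX fnu2 _) (_ : _ <= 1)%N) _.
    rewrite (mpolynormC fnu2) /nu2 (polynormC fnu1).
    exact: (polynormX seminorm_absz).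
  by nia.
Qed.

(* 2 ^ ((tau + 2) * W) bounds the number of distinct polynomials in Q, of which
   each contributes four members to the family. *)
Let Lambda := ((4 * 2 ^ ((tau + 2) * W) + 3) * (W * 2 ^ tau) ^ 2)%N.

Lemma normed_sum_sqr (I : {set Lidx Q}) :
  coef_normed (sum_sqr (@Ufam int n Q) I) Lambda nu3.
Proof.
have fm := seminorm_mpoly fnu2 n.+1.
split=> //; first exact: (polynormX fnu2).
set q := sum_sqr _ _.
have -> : (\sum_(m <- msupp q) nu3 (q@_m)%:P)%N = mpolynorm nu2 q.
  by apply: eq_bigr => m _; rewrite /nu3 (polynormC fnu2).
apply: leq_trans (seminorm_sum fm _ _ _) _.
apply: leq_trans (_ : \sum_(l in I) (W * 2 ^ tau) ^ 2 <= _)%N.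
  apply: leq_sum => l _; rewrite expr2 expnS expn1.
  apply: leq_trans (seminormM fm _ _) _.
  by apply: leq_mul; apply: norm_Ufam.
rewrite sum_nat_const leq_mul2r; apply/orP; right.
apply: leq_trans (max_card _) _.
rewrite card_sum !card_prod !card_bool card_ord.
have := size_uniq_polys uQ degQ bitQ; rewrite -/W.
by move: (2 ^ _)%N (size Q) => a b; lia.
Qed.

Lemma norm_lead_coef (R : rcfType) (I : {set Lidx Q})
    (P : {poly {poly {poly int}}}) (Z := (d ^ n.+1)%N) :
  (forall Lam nu, (0 < Lam)%N ->
     coef_normed (sum_sqr (@Ufam int n Q) I) Lam nu ->
     (nu P <= norm_bound n d Lam)%N) ->
  coefnorm2 (intr : {rmorphism int -> R}) (lead_coef P)
    <= (2 ^ (tau * Z ^ 17))%:R.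
Proof.
move=> HP.
have L0 : (0 < Lambda)%N.
  by rewrite /Lambda muln_gt0 addn_gt0 orbT expn_gt0 muln_gt0 !expn_gt0.
have Z2 : (2 <= Z)%N.
  by apply: leq_trans d_gt1 _; rewrite /Z expnS leq_pmulr // expn_gt0; lia.
have HB : (nu2 (lead_coef P) <= 2 ^ (tau * Z ^ 17))%N.
  apply: leq_trans (polynorm_coef fnu2 _ _) _.
  apply: leq_trans (HP _ _ L0 (normed_sum_sqr I)) _.
  exact: (norm_bound_le Z2 (erefl _) d_gt1 tau_gt0 (erefl _) L0 (leqnn _)).
apply: le_trans (_ : (nu2 (lead_coef P))%:R <= _); last by rewrite ler_nat.
rewrite /coefnorm2 /nu2 /polynorm natr_sum; apply: ler_sum => i _.
rewrite /coefnorm /nu1 /polynorm natr_sum; apply: ler_sum => j _.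
by rewrite -intr_norm natr_absz.
Qed.

End IntegerNorms.

(** The constant of [lojasiewicz] for mu = 1. With T = 2 Lam = 2^(b+1) one has 1 / s0 = T and G = 1
    + T^(N+1) <= T^(N+2), so the constant is at most T (T^(N+3))^N. *)
Lemma constant_bound (R : rcfType) (b N : nat) (Lam : R := (2 ^ b)%:R)
    (s0 : R := 1 / (2 * Lam)) (G : R := 1 + 2 * Lam / (1 * s0 ^+ N)) :
  2 * Lam / 1 * (G / s0) ^+ N <= 2%:R ^+ (b.+1 * (1 + N * (N + 3))).
Proof.
pose T : R := 2 * Lam.
have TE : T = 2%:R ^+ b.+1 by rewrite /T /Lam natrX exprS.
have T2 : 2 <= T.
  by rewrite TE exprS -[X in X <= _]mulr1 ler_pM2l // exprn_ege1 // ler1n.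
have T0 : T != 0 by rewrite gt_eqF //; lra.
have s0E : s0 = T^-1 by rewrite /s0 -/T mul1r.
have GE : G = 1 + T ^+ N.+1.
  by rewrite /G s0E -/T mul1r exprVn invrK -exprS.
rewrite GE s0E invrK -/T divr1 exprM -TE exprD expr1 ler_pM2l; last by lra.
rewrite mulnC exprM; apply: lerXn2r; rewrite ?nnegrE.
- by rewrite mulr_ge0 ?addr_ge0 ?exprn_ge0 //; lra.
- by rewrite exprn_ge0 //; lra.
rewrite addn3 [T ^+ N.+3]exprSr ler_pM2r; last by lra.
rewrite [T ^+ N.+2]exprS; have : 1 <= T ^+ N.+1 by rewrite exprn_ege1 //; lra.
nra.
Qed.

Lemma semialg_fun_sub (R : rcfType) n (Q Q' : seq {mpoly R[n.+1]})
    (A : ('I_n -> R) -> Prop) (f : ('I_n -> R) -> R) :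
  {subset Q <= Q'} -> semialg_fun Q A f -> semialg_fun Q' A f.
Proof.
move=> sQ [phi [atf Hf]]; exists phi; split=> //.
elim: phi atf {Hf} => [|p|p|p|phi IH|a IHa b IHb|a IHa b IHb] //=;
  by [apply: sQ | case=> /IHa ? /IHb ?].
Qed.

Lemma loj_part2 (R : realType) (n d tau : nat) (Q0 : seq {mpoly int[n.+1]})
    (A : ('I_n -> R) -> Prop) (f g : ('I_n -> R) -> R) :
  (2 <= d)%N -> deg_le d Q0 -> bitsize_le tau Q0 ->
  closed_set A -> bounded_set A -> continuous_on A f -> continuous_on A g ->
  semialg_fun (intpolys R Q0) A f -> semialg_fun (intpolys R Q0) A g ->
  (forall x, A x -> f x = 0 -> g x = 0) ->
  exists2 c : R, c <= 2%:R ^+ (tau * (d ^ n.+1) ^ 134) &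
    forall x, A x -> `|g x| ^+ ((8 * d) ^ (2 * (n + 7))) <= c * `|f x|.
Proof.
move=> d2 degQ0 bitQ0 cA bA cf cg sf0 sg0 fg.
have [tau0|tau_gt0] := posnP tau.
  (* All polynomials vanish, so no nonempty graph can be defined. *)
  have Qz p : p \in Q0 -> p = 0.
    move=> /bitQ0 H; apply/mpolyP => m; have := H m; rewrite tau0 mcoeff0.
    by rewrite expn0; lia.
  have nA x : ~ A x.
    move=> Ax; have [phi [atf Hf]] := sf0.
    have Hx : holds (ext_pt x (f x)) phi by apply/Hf.
    have /Hf[_] : holds (ext_pt x (f x + 1)) phi.
      apply: (proj1 (holds_sg (iota := intr) (Q := Q0) atf _)) Hx => p /Qz ->.
      by rewrite !raddf0.
    by lra.
  exists 0; first by rewrite exprn_ge0.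
  by move=> x /nA.
(* Repetitions are removed so that [size_uniq_polys] applies. *)
pose Q := undup Q0.
have degQ : deg_le d Q by move=> p; rewrite mem_undup; apply: degQ0.
have bitQ : bitsize_le tau Q by move=> p; rewrite mem_undup; apply: bitQ0.
have sub : {subset intpolys R Q0 <= map (map_mpoly (intr : int -> R)) Q}.
  by move=> p /mapP[q qQ ->]; apply: map_f; rewrite mem_undup.
have sf := semialg_fun_sub sub sf0; have sg := semialg_fun_sub sub sg0.
have [P HP] := chi_family (intr : {rmorphism int -> R}) d2 degQ.
have HP0 I : P I != 0 by have [] := HP I.
have HPc I := let: And4 _ H _ _ := HP I in H.
have HPn I := let: And4 _ _ _ H := HP I in H.
pose N := ((8 * d) ^ (2 * (n + 7)))%N.
have HPs I i j : (size ((P I)`_i`_j)%R <= N.+1)%N.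
  have [_ _ H _] := HP I; apply: leq_trans (H i j) _.
  by rewrite ltnS deg_bound_le.
have N0 : (0 < N)%N by rewrite expn_gt0 muln_gt0 (ltnW d2).
pose Z := (d ^ n.+1)%N; pose b := (tau * Z ^ 17)%N.
have Z2 : (2 <= Z)%N.
  by apply: leq_trans (d2) _; rewrite /Z expnS leq_pmulr // expn_gt0 (ltnW d2).
exists (2 * (2 ^ b)%:R / 1 * ((1 + 2 * (2 ^ b)%:R / (1 * (1 / (2 * (2 ^ b)%:R)) ^+ N))
    / (1 / (2 * (2 ^ b)%:R))) ^+ N).
  apply: le_trans (constant_bound R b N) _.
  apply: ler_weXn2l; first by rewrite ler1n.
  exact: (final_exponent Z2 (erefl _) d2 tau_gt0 (erefl _)).
move=> x Ax.
apply: (lojasiewicz (iota := intr) (mu := 1) (Lam := (2 ^ b)%:R) d2 degQ cA bA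
  cf cg sf sg fg HP0 HPc N0 HPs) => //.
- by rewrite ler1n expn_gt0.
(* A nonzero integer has absolute value at least 1, hence mu = 1. *)
- by move=> I i j cij; rewrite -intr_norm ler1z -gtz0_ge1 normr_gt0.
- move=> I; apply: (norm_lead_coef d2 tau_gt0 (undup_uniq Q0) degQ bitQ).
  exact: HPn.
Qed.

Theorem theorem2p2 :
  (forall (R : rcfType) (n d : nat) (P : seq {mpoly R[n]})
      (Q : seq {mpoly R[n.+1]}) (A : ('I_n -> R) -> Prop)
      (f g : ('I_n -> R) -> R),
    (2 <= d)%N ->
    deg_le d P -> deg_le d Q ->
    semialg P A -> closed_set A -> bounded_set A ->
    continuous_on A f -> continuous_on A g ->
    semialg_fun Q A f -> semialg_fun Q A g ->
    (forall x, A x -> f x = 0 -> g x = 0) ->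
    exists (c : R) (N : nat),
      (N <= (8 * d) ^ (2 * (n + 7)))%N /\
      forall x, A x -> `|g x| ^+ N <= c * `|f x|)
  /\
  (exists C : nat,
    forall (R : realType) (n d tau : nat) (P : seq {mpoly int[n]})
      (Q : seq {mpoly int[n.+1]}) (A : ('I_n -> R) -> Prop)
      (f g : ('I_n -> R) -> R),
    (2 <= d)%N ->
    deg_le d P -> deg_le d Q ->
    bitsize_le tau P -> bitsize_le tau Q ->
    semialg (intpolys R P) A -> closed_set A -> bounded_set A ->
    continuous_on A f -> continuous_on A g ->
    semialg_fun (intpolys R Q) A f -> semialg_fun (intpolys R Q) A g ->
    (forall x, A x -> f x = 0 -> g x = 0) ->
    exists c : R,
      c <= 2%:R ^+ (tau * d ^ (C * n.+1 ^ 2)) /\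
      c <= 2%:R ^+ (tau * d ^ (C * n.+1 * up_log 2 d)) /\
      forall x, A x -> `|g x| ^+ ((8 * d) ^ (2 * (n + 7))) <= c * `|f x|).
Proof.
split.
  move=> R n d P Q A f g d2 _ degQ _ cA bA cf cg sf sg fg.
  have [c Hc] := loj_part1 d2 degQ cA bA cf cg sf sg fg.
  by exists c, ((8 * d) ^ (2 * (n + 7)))%N.
(* The single bound with d^(134 (n + 1)) gives both estimates: n + 1 <= (n + 1)^2, and [up_log 2 d]
   >= 1 since d >= 2. *)
exists 134%N => R n d tau P Q A f g d2 _ degQ _ bitQ _ cA bA cf cg sf sg fg.
have [c Hc Hx] := loj_part2 d2 degQ bitQ cA bA cf cg sf sg fg.
have le_exp k : (n.+1 * 134 <= k)%N -> c <= 2%:R ^+ (tau * d ^ k).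
  move=> Hk; apply: le_trans Hc _; apply: ler_weXn2l; first by rewrite ler1n.
  by rewrite -expnM leq_mul2l leq_pexp2l ?orbT //; lia.
exists c; split; [|split=> //]; apply: le_exp; rewrite [(n.+1 * _)%N]mulnC.
  by rewrite leq_mul2l expnS leq_pmulr ?orbT // expn_gt0.
by rewrite leq_pmulr // up_log_gt0 /=; lia.
Qed.
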